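(* Each of the following quaternary sums is universal over $\mathbb{Z}$: $2p_5+4p_5+p_8+p_8$, $4p_5+p_8+p_8+p_8$, $2p_5+p_8+p_8+2p_8$, $p_8+p_8+p_8+2p_8$, $4p_5+p_8+2p_8+2p_8$, $p_8+2p_8+2p_8+2p_8$, $3p_4+p_5+2p_5+p_8$, $6p_3+p_5+2p_5+2p_5$, $3p_4+p_5+p_8+p_8$, $6p_3+p_5+2p_5+p_8$, $3p_4+2p_5+p_8+p_8$, $3p_4+p_8+p_8+p_8$, $6p_3+2p_5+2p_5+p_8$, $6p_3+2p_5+p_8+p_8$, $3p_3+p_5+p_5+4p_5$, $3p_3+p_5+p_5+2p_8$, $3p_3+3p_4+p_5+p_8$, $3p_3+6p_3+p_5+2p_5$, $3p_4+p_8+p_8+2p_8$, $6p_3+2p_5+p_8+2p_8$, $3p_3+p_5+4p_5+p_8$, $3p_3+p_5+p_8+2p_8$, $p_3+p_4+3p_4+p_8$, $p_3+6p_3+p_4+2p_5$, $p_3+2p_3+3p_4+p_8$, $p_3+6p_3+p_4+p_8$, $2p_5+4p_5+p_8+2p_8$, $4p_5+p_8+p_8+2p_8$, $2p_5+p_8+2p_8+2p_8$, $p_8+p_8+2p_8+2p_8$, $p_5+2p_5+4p_5+p_8$, $p_5+2p_5+p_8+2p_8$, $p_5+4p_5+p_8+p_8$, $p_5+p_8+p_8+2p_8$, $p_3+p_4+4p_5+p_8$, $p_3+p_4+p_8+2p_8$, $p_3+2p_3+2p_5+4p_5$, $p_3+2p_3+2p_5+2p_8$, $2p_3+2p_4+p_5+p_8$,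 $2p_3+4p_3+p_5+p_8$, $p_3+2p_5+4p_5+6p_5$, $p_3+2p_5+6p_5+2p_8$, $2p_5+4p_5+p_8+3p_8$, $4p_5+p_8+p_8+3p_8$, $2p_5+p_8+2p_8+3p_8$, $p_8+p_8+2p_8+3p_8$, $4p_5+p_8+2p_8+6p_8$, $p_8+2p_8+2p_8+6p_8$, $3p_4+p_8+p_8+3p_8$, $6p_3+2p_5+p_8+3p_8$, $3p_4+p_8+p_8+4p_8$, $6p_3+2p_5+p_8+4p_8$, $3p_3+p_5+4p_5+2p_8$, $3p_3+p_5+2p_8+2p_8$, $3p_4+p_8+p_8+5p_8$, $6p_3+2p_5+p_8+5p_8$, $3p_4+p_8+p_8+6p_8$, $6p_3+2p_5+p_8+6p_8$, $3p_3+p_5+4p_5+3p_8$, $3p_3+p_5+2p_8+3p_8$, $4p_5+p_8+2p_8+3p_8$, $p_8+2p_8+2p_8+3p_8$, $4p_5+p_8+2p_8+5p_8$, $p_8+2p_8+2p_8+5p_8$, $2p_3+2p_4+p_8+3p_8$, $2p_3+4p_3+p_8+3p_8$.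
   Context: For an integer $m\ge 3$ and $x\in\mathbb{Z}$, the generalized $m$-gonal number is $p_m(x)=\frac{(m-2)x^2-(m-4)x}{2}$; thus $p_3(x)=x(x+1)/2$, $p_4(x)=x^2$, $p_5(x)=x(3x-1)/2$, $p_8(x)=x(3x-2)$. For positive integers $a,b,c,d$ and $r,s,t,u\ge 3$, the notation $ap_r+bp_s+cp_t+dp_u$ denotes the function $(h,l,m,n)\mapsto ap_r(h)+bp_s(l)+cp_t(m)+dp_u(n)$ on $\mathbb{Z}^4$ (four independent integer variables). Such a sum is called universal over $\mathbb{Z}$ if its set of values $\{ap_r(h)+bp_s(l)+cp_t(m)+dp_u(n): h,l,m,n\in\mathbb{Z}\}$ equals $\mathbb{N}_0=\{0,1,2,\dots\}$. *)

(* Defs.v *)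
From Stdlib Require Import ZArith.
Open Scope Z_scope.

(* Generalized m-gonal number p_m(x) = ((m-2)x^2 - (m-4)x)/2, x in Z.
   The numerator is always even, so Z.div is exact division here. *)
Definition pgon (m x : Z) : Z := ((m - 2) * x ^ 2 - (m - 4) * x) / 2.

Definition universal (a r b s c t d u : Z) : Prop :=
  forall N : Z,
    (exists h l m n : Z, a * pgon r h + b * pgon s l + c * pgon t m + d * pgon u n = N)
    <-> 0 <= N.

(* Main.v *)
(* Completing squares turns each sum into a diagonal quadratic form whose
   variables are odd, or prime to 3, or both.  Since x^2 + 2 y^2 and
   x^2 + y^2 + z^2 admit rational isometries of denominator 3, a common
   factor 3 of the variables can always be removed, and three of the four terms
   already represent every number n for which a suitable linear function of n
   is a sum of three squares; the fourth term is then used to avoid the numbers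
   4^a (8 b + 7).

   The three-square theorem is obtained as follows.  For squarefree n take
   Q = q or 2 q with q = 1 mod 4 a prime such that -Q is a square modulo n and n
   a square modulo Q; the pigeonhole principle gives a nontrivial zero of
   w^2 + Q z^2 - n t^2, Q is a sum of two squares, so n is a sum of three
   rational squares, and Aubry's descent makes them integral.  The prime q is
   prescribed by finitely many quadratic characters only, so real characters
   suffice in Dirichlet's argument: sum chi(p) ln p / p is bounded for every
   nonprincipal real chi, because the partial sums of chi(k) / k stay away
   from 0, as one sees by counting the divisor sums of chi with the weight
   n^(-1/2). *)
Require Import Defs.
From Stdlib Require Import ZArith Lia Zwf.
From mathcomp Require all_boot all_order all_algebra cyclic.
From mathcomp Require reals sequences exp Rstruct.
From mathcomp Require ring lra zify.
Open Scope Z_scope.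

(** * Rational and integral sums of three squares *)

(** The two demands on q are compatible exactly in the right residue classes. For a prime r dividing
    n, -Q is a square modulo r when (Q/r) = (-1/r). Since q = 1 mod 4, reciprocity multiplies these
    conditions up to (n/q) = chi(n), where chi is the Kronecker symbol of discriminant -4 if Q = q
    and of discriminant -8 if Q = 2 q. For odd n one of the two symbols is 1 unless n = 7 mod 8; for
    twice an odd number the choice between q = 1 and q = 5 mod 8 adjusts the factor (2/q). The
    analytic part uses finite sums only: L(1, chi) enters through its partial sums, for which a
    positive lower bound and a tail of order 1/m are enough. The removal of a factor 3 has one
    obstacle: a pair of zero variables is divisible by 3 for good. The values concerned, squares and
    doubles of squares, need an argument of their own. *)

Definition three_squares (n : Z) : Prop := exists x y z, n = x * x + y * y + z * z.

Lemma nearest_multiple (x T : Z) : 0 < T -> exists a, 2 * Z.abs (x - a * T) <= T.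
Proof.
intros HT. exists ((2 * x + T) / (2 * T)).
pose proof (Z.div_mod (2 * x + T) (2 * T) ltac:(lia)) as E.
pose proof (Z.mod_pos_bound (2 * x + T) (2 * T) ltac:(lia)) as B.
revert E B. generalize ((2 * x + T) / (2 * T)) ((2 * x + T) mod (2 * T)).
intros q r E B. replace (2 * T * q) with (2 * (q * T)) in E by ring. lia.
Qed.

(* Aubry's descent: reflect the rational point (x, y, z) / T in the integer
   point (a, b, c) nearest to it. *)
Lemma three_squares_of_rational (T n x y z : Z) :
  0 < T -> n * (T * T) = x * x + y * y + z * z -> three_squares n.
Proof.
revert x y z. induction T as [T IH] using (well_founded_induction (Zwf_well_founded 0)).
intros x y z HT H.
destruct (nearest_multiple x T HT) as [a Ha].
destruct (nearest_multiple y T HT) as [b Hb].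
destruct (nearest_multiple z T HT) as [c Hc].
set (A := a * a + b * b + c * c). set (B := a * x + b * y + c * z).
(* [S / T] is the squared distance between (a, b, c) and (x, y, z) / T; [S] will be the new
   denominator. *)
set (S := A * T - 2 * B + n * T).
set (R := (x - a * T) * (x - a * T) + (y - b * T) * (y - b * T) + (z - c * T) * (z - c * T)).
assert (HR : R = T * S).
{ assert (E : R - T * S = x * x + y * y + z * z - n * (T * T)) by (unfold R, S, A, B; ring). lia. }
(* Each of the three coordinates is off by at most 1/2, and 3/4 < 1 makes the denominator drop. *)
assert (HR4 : 4 * R <= 3 * (T * T)).
{ unfold R. revert Ha Hb Hc. generalize (x - a * T) (y - b * T) (z - c * T). intros u v w Hu Hv Hw.
  assert (sq : forall s, 2 * Z.abs s <= T -> 4 * (s * s) <= T * T) 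
    by (intros s Hs; pose proof (Z.square_le_mono_nonneg (2 * Z.abs s) T ltac:(lia) Hs);
      pose proof (Z.abs_square s); lia).
  pose proof (sq u Hu). pose proof (sq v Hv). pose proof (sq w Hw). lia. }
assert (HR0 : 0 <= R).
{ unfold R. pose proof (Z.square_nonneg (x - a * T)). pose proof (Z.square_nonneg (y - b * T)).
  pose proof (Z.square_nonneg (z - c * T)). lia. }
destruct (Z.eq_dec R 0) as [R0|R0].
- assert (Hx : x = a * T /\ y = b * T /\ z = c * T).
  { unfold R in R0. revert R0. generalize (x - a * T) (y - b * T) (z - c * T)
      (Z.sub_move_0_r x (a * T)) (Z.sub_move_0_r y (b * T)) (Z.sub_move_0_r z (c * T)).
    intros u v w Iu Iv Iw R0. 
    pose proof (Z.square_nonneg u). pose proof (Z.square_nonneg v). pose proof (Z.square_nonneg w).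
    assert (u = 0 /\ v = 0 /\ w = 0)
      by (repeat split; apply Z.eq_square_0; lia). tauto. }
  destruct Hx as (-> & -> & ->).
  exists a, b, c. apply (Z.mul_reg_r _ _ (T * T)); [rewrite Z.eq_square_0; lia|]. rewrite H. ring.
- assert (HS : 0 < S < T).
  { split; [apply (Z.mul_pos_cancel_l T S HT); lia|].
    assert (4 * S <= 3 * T); [|lia].
    apply (Z.mul_le_mono_pos_l _ _ T HT).
    replace (T * (4 * S)) with (4 * (T * S)) by ring.
    replace (T * (3 * T)) with (3 * (T * T)) by ring. lia. }
  (* [S] times the second point in which the line through (a, b, c) and (x, y, z) / T meets the
     sphere. *)
  apply (IH S) with (x := (A - n) * x + 2 * (n * T - B) * a)
    (y := (A - n) * y + 2 * (n * T - B) * b) (z := (A - n) * z + 2 * (n * T - B) * c);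
    [unfold Zwf; lia | lia |].
  assert (E : n * (S * S) - (((A - n) * x + 2 * (n * T - B) * a) * ((A - n) * x + 2 * (n * T - B) * a)
    + ((A - n) * y + 2 * (n * T - B) * b) * ((A - n) * y + 2 * (n * T - B) * b)
    + ((A - n) * z + 2 * (n * T - B) * c) * ((A - n) * z + 2 * (n * T - B) * c))
    = (A - n) * (A - n) * (n * (T * T) - (x * x + y * y + z * z))) by (unfold S, A, B; ring).
  rewrite H in E. lia.
Qed.

(** The congruences make w^2 + Q z^2 - n t^2 divisible by Q, because e^2 = n mod Q, and by n,
    because f^2 = -Q mod n. The size bounds then leave only the values 0 and n Q, and both lead to a
    rational representation of n by W^2 + Q Z^2. *)
Lemma three_squares_of_congruences (n Q e f e1 f1 al be a b w z t u v : Z) :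
  0 < n -> 0 < Q -> (forall s, s * s <> Q) -> (forall s, s * s <> n * Q) ->
  al * n + be * Q = 1 -> e * e = n + Q * e1 -> f * f + Q = n * f1 ->
  Q = a * a + b * b ->
  w + e * t = Q * u -> w + f * z = n * v ->
  w * w <= n * Q -> z * z <= n -> t * t <= Q -> ~ (w = 0 /\ z = 0 /\ t = 0) ->
  three_squares n.
Proof.
intros Hn HQ nsQ nsnQ Hcop He Hf Hab Hu Hv Bw Bz Bt Hnz.
set (D := w * w + Q * (z * z) - n * (t * t)).
assert (DQ : D = Q * (u * (w - e * t) + z * z + e1 * (t * t))).
{ unfold D.
  assert (E : w * w - n * (t * t) = (w + e * t) * (w - e * t) + (e * e - n) * (t * t)) by ring.
  rewrite Hu, He in E. lia. }
assert (Dn : D = n * (v * (w - f * z) + f1 * (z * z) - t * t)).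
{ unfold D.
  assert (E : w * w + Q * (z * z) = (w + f * z) * (w - f * z) + (f * f + Q) * (z * z)) by ring.
  rewrite Hv, Hf in E. lia. }
assert (Dk : exists k, D = n * Q * k).
{ exists (al * (u * (w - e * t) + z * z + e1 * (t * t)) + be * (v * (w - f * z) + f1 * (z * z) - t * t)).
  transitivity (al * n * D + be * Q * D).
  - replace (al * n * D + be * Q * D) with ((al * n + be * Q) * D) by ring. rewrite Hcop. ring.
  - rewrite DQ at 1. rewrite Dn at 1. ring. }
destruct Dk as [k Dk].
(* Bounds from integer square roots are not strict; that Q and n Q are not squares makes them
   strict, which excludes the multipliers -1 and 2. *)
assert (Bw' : w * w < n * Q) by (specialize (nsnQ w); lia).
assert (Bt' : t * t < Q) by (specialize (nsQ t); lia).
pose proof (Z.square_nonneg w). pose proof (Z.square_nonneg z). pose proof (Z.square_nonneg t).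
assert (HnQ : 0 < n * Q) by (apply Z.mul_pos_pos; lia).
pose proof (Z.mul_le_mono_nonneg_l _ _ Q ltac:(lia) Bz).
pose proof (proj1 (Z.mul_lt_mono_pos_l n _ _ Hn) Bt').
assert (0 <= Q * (z * z)) by (apply Z.mul_nonneg_nonneg; lia).
assert (0 <= n * (t * t)) by (apply Z.mul_nonneg_nonneg; lia).
assert (Hk : k = 0 \/ k = 1).
{ assert (-1 < k < 2); [|lia].
  split; apply (Z.mul_lt_mono_pos_l (n * Q)); try lia; rewrite <- Dk; unfold D; lia. }
assert (Fin : forall T W Z, 0 < T -> n * (T * T) = W * W + Q * (Z * Z) -> three_squares n).
{ intros T W Z HT HE. apply (three_squares_of_rational T n W (a * Z) (b * Z) HT).
  rewrite HE, Hab. ring. }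
destruct Hk as [-> | ->].
- apply (Fin (Z.abs t) w z).
  + assert (t <> 0); [|lia]. intros ->. apply Hnz. unfold D in Dk.
    assert (Q * (z * z) = 0) by lia. assert (w * w = 0) by lia.
    assert (z * z = 0) by (apply (Z.eq_mul_0_r Q); lia).
    repeat split; apply Z.eq_square_0; lia.
  + rewrite <- Z.abs_mul, (Z.abs_eq (t * t)) by lia. unfold D in Dk. lia.
(* Here n (t^2 + Q) = w^2 + Q z^2; multiply by t^2 + Q, the norm form x^2 + Q y^2 being
   multiplicative. *)
- apply (Fin (t * t + Q) (w * t - Q * z) (w + z * t)); [lia|].
  assert (E : n * (t * t + Q) = w * w + Q * (z * z)) by (unfold D in Dk; lia).
  replace (n * ((t * t + Q) * (t * t + Q))) with (n * (t * t + Q) * (t * t + Q)) by ring.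
  rewrite E. ring.
Qed.

(** Keeps the difference of two points of a pigeonhole box within the bounds of the box. *)
Lemma square_sub_le (x y K : Z) : 0 <= x -> 0 <= y -> x * x <= K -> y * y <= K ->
  (x - y) * (x - y) <= K.
Proof.
intros Hx Hy HxK HyK. destruct (Z.le_ge_cases x y).
- replace ((x - y) * (x - y)) with ((y - x) * (y - x)) by ring.
  pose proof (Z.square_le_mono_nonneg (y - x) y ltac:(lia) ltac:(lia)). lia.
- pose proof (Z.square_le_mono_nonneg (x - y) x ltac:(lia) ltac:(lia)). lia.
Qed.

Lemma multiplier_eq1 (q k : Z) : 0 < q -> 0 < q * k -> q * k < 2 * q -> k = 1.
Proof.
intros Hq H0 H2. assert (0 < k < 2); [|lia].
split; apply (Z.mul_lt_mono_pos_l q); lia.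
Qed.

Lemma sum_squares_pos (x y : Z) : ~ (x = 0 /\ y = 0) -> 0 < x * x + y * y.
Proof.
intros H. pose proof (Z.square_nonneg x). pose proof (Z.square_nonneg y).
pose proof (Z.eq_square_0 x). pose proof (Z.eq_square_0 y). lia.
Qed.

Lemma three_squares_scale (k n : Z) : three_squares n -> three_squares (k * k * n).
Proof. intros [x [y [z ->]]]. exists (k * x), (k * y), (k * z). ring. Qed.

Module Import ThreeSquares.
Import all_boot all_order all_algebra cyclic.
Import reals sequences exp Rstruct.
Import ring lra zify.
Set Implicit Arguments.
Unset Strict Implicit.
Unset Printing Implicit Defensive.
Import Order.TTheory GRing.Theory Num.Theory.
Delimit Scope Z_scope with Z.
Local Open Scope ring_scope.

(** * Nonvanishing of the harmonic sums of a real character *)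

Lemma sum_abel (R : realFieldType) (f g : nat -> R) (B : R) (m n : nat) :
  (forall j, (m <= j)%N -> 0 <= g j) ->
  (forall j, (m <= j)%N -> g j.+1 <= g j) ->
  (forall j, `|\sum_(m <= k < j) f k| <= B) ->
  `|\sum_(m <= k < n) f k * g k| <= B * g m.
Proof.
move=> g0 gd fB.
have B0 : 0 <= B by apply: le_trans (fB m).
have [lenm|ltmn] := leqP n m.
  by rewrite big_geq // normr0 mulr_ge0 // g0.
(* Abel summation as an induction: the weighted sum differs from its boundary term by at most [B]
   times the decrease of [g]. *)
have key i : `|\sum_(m <= k < (m + i).+1) f k * g k
              - (\sum_(m <= k < (m + i).+1) f k) * g (m + i)%N|
             <= B * (g m - g (m + i)%N).
  elim: i => [|i IHi].
    by rewrite addn0 !big_nat1 !subrr mulr0 normr0.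
  rewrite addnS [in X in `|X|]big_nat_recr /=; last by lia.
  rewrite [in X in _ - X * _]big_nat_recr /=; last by lia.
  set s := \sum_(m <= k < (m + i).+1) f k * g k in IHi *.
  set a := \sum_(m <= k < (m + i).+1) f k in IHi *.
  have -> : s + f (m + i).+1 * g (m + i).+1 - (a + f (m + i).+1) * g (m + i).+1
     = (s - a * g (m + i)%N) + a * (g (m + i)%N - g (m + i).+1) by ring.
  apply: le_trans (ler_normD _ _) _.
  have h : g (m + i).+1 <= g (m + i)%N by apply: gd; lia.
  have : `|a * (g (m + i)%N - g (m + i).+1)| <= B * (g (m + i)%N - g (m + i).+1).
    rewrite normrM [X in _ * X]ger0_norm ?subr_ge0 //.
    by rewrite ler_wpM2r ?subr_ge0 // fB.
  move: IHi; lra.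
have := key (n - m.+1)%N.
have -> : (m + (n - m.+1)).+1 = n by lia.
set j := (m + _)%N.
have gj : 0 <= g j by apply: g0; rewrite /j; lia.
have : `|(\sum_(m <= k < n) f k) * g j| <= B * g j.
  by rewrite normrM (ger0_norm gj) ler_wpM2r // fB.
set u := \sum_(m <= k < n) f k * g k; set v := _ * g j => h1 h2.
have := ler_normD (u - v) v; rewrite subrK; lra.
Qed.

Lemma sum_multiples (V : nmodType) (F : nat -> V) (d x : nat) : (0 < d)%N ->
  \sum_(1 <= n < x.+1 | (d %| n)%N) F n = \sum_(1 <= j < (x %/ d).+1) F (d * j)%N.
Proof.
move=> d0; elim: x => [|x IHx]; first by rewrite div0n !big_geq.
rewrite big_mkcond big_nat_recr //= -big_mkcond /= IHx divnS //.
case: ifP => dx; last by rewrite add0n addr0.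
rewrite add1n [RHS]big_nat_recr //=; congr (_ + F _).
by move: (divnK dx); rewrite divnS // dx add1n mulnC => ->.
Qed.

Definition divisor_sum (R : realFieldType) (f : nat -> R) (n : nat) : R :=
  \sum_(1 <= d < n.+1 | (d %| n)%N) f d.

Lemma divisor_sum_widen (R : realFieldType) (f : nat -> R) (n x : nat) :
  (0 < n <= x)%N -> \sum_(1 <= d < x.+1 | (d %| n)%N) f d = divisor_sum f n.
Proof.
case/andP=> n0 nx; rewrite /divisor_sum [RHS](@big_nat_widen _ _ _ _ _ x.+1) //.
apply: eq_bigl => d /=; have [/(dvdn_leq n0)|//] := boolP (d %| n)%N.
by rewrite ltnS => ->.
Qed.

(** A divisor of p^(k+1) m is either prime to p, hence a divisor of m, or p times a divisor of p^k
    m. *)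
Lemma divisor_sumM (R : realFieldType) (f : nat -> R) (p k m : nat) :
  (forall a b, f (a * b)%N = f a * f b) -> prime p -> ~~ (p %| m)%N -> (0 < m)%N ->
  divisor_sum f (p ^ k.+1 * m) = divisor_sum f m + f p * divisor_sum f (p ^ k * m).
Proof.
move=> fM pp pm m0; have p0 := prime_gt0 pp.
have n0 i : (0 < p ^ i * m)%N by rewrite muln_gt0 expn_gt0 p0.
rewrite {1}/divisor_sum (bigID (fun d => p %| d)%N) /= addrC; congr (_ + _).
  rewrite -(@divisor_sum_widen _ _ _ (p ^ k.+1 * m)); last first.
    by rewrite m0 leq_pmull // expn_gt0 p0.
  apply: eq_bigl => d; have [pd|pd] := boolP (p %| d)%N => /=.
    by rewrite andbF; apply/esym/negP => /(dvdn_trans pd); rewrite (negbTE pm).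
  rewrite andbT Gauss_dvdr // coprimeXr // coprime_sym prime_coprime //.
rewrite big_mkcondl /=.
rewrite sum_multiples // expnS -mulnA mulKn // /divisor_sum big_distrr /=.
rewrite [RHS]big_mkcond; apply: eq_bigr => j _.
by rewrite dvdn_pmul2l // fM.
Qed.

(** With D the divisor sum at m, the sums at p^k m run through D, 2 D, 3 D, ... if f p = 1, stay at
    D if f p = 0, and alternate D, 0, D, ... if f p = -1. *)
Lemma divisor_sum_ppart (R : realFieldType) (f : nat -> R) (p m : nat) :
  (forall a b, f (a * b)%N = f a * f b) -> (forall a, f a \in [:: 0; 1; -1]) ->
  prime p -> ~~ (p %| m)%N -> (0 < m)%N -> 0 <= divisor_sum f m ->
  forall k, 0 <= divisor_sum f (p ^ k * m) /\
            divisor_sum f m <= divisor_sum f (p ^ k.*2 * m).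
Proof.
move=> fM fv pp pm m0 D0.
have DS k := divisor_sumM k fM pp pm m0.
(* Two steps at a time: for f p = -1 the nonnegativity at k alone does not give it at k + 1. *)
have D2 k : 0 <= divisor_sum f (p ^ k * m) -> 
    0 <= divisor_sum f (p ^ k.+2 * m).
  move=> Dk; rewrite !DS; move: (fv p); rewrite !inE => /or3P[] /eqP ->; nra.
have D1 : 0 <= divisor_sum f (p ^ 1 * m).
  by rewrite DS expn0 mul1n; move: (fv p); rewrite !inE => /or3P[] /eqP ->; nra.
have Dge k : 0 <= divisor_sum f (p ^ k * m) /\ 0 <= divisor_sum f (p ^ k.+1 * m).
  elim: k => [|k [h1 h2]]; first by rewrite {1}expn0 mul1n.
  by split=> //; apply: D2.
move=> k; split; first by case: (Dge k).
elim: k => [|k IHk]; first by rewrite double0 expn0 mul1n.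
rewrite doubleS !DS; case: (Dge k.*2) => h _.
by move: (fv p); rewrite !inE => /or3P[] /eqP ->; nra.
Qed.

(** Induction that strips off the full power of one prime. In a square all exponents are even, where
    the sums never fall below their start; this lower bound is the source of divergence in
    [W_ge]. *)
Lemma divisor_sum_ge0 (R : realFieldType) (f : nat -> R) (n : nat) :
  f 1%N = 1 -> (forall a b, f (a * b)%N = f a * f b) ->
  (forall a, f a \in [:: 0; 1; -1]) -> (0 < n)%N ->
  0 <= divisor_sum f n /\ 1 <= divisor_sum f (n ^ 2).
Proof.
move=> f1 fM fv.
elim/ltn_ind: n => n IHn n0.
have [n1|n1] := leqP n 1.
  have -> : n = 1%N by lia.
  by rewrite exp1n /divisor_sum big_mkcond big_nat1 dvdnn f1 lexx ler01.
have pp := pdiv_prime n1; have := pdiv_dvd n; move: pp; move: (pdiv n) => p pp pn.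
have [m pm nE] := pfactor_coprime pp n0.
have {}pm : ~~ (p %| m)%N by rewrite -prime_coprime.
have m0 : (0 < m)%N by case: (m) pm => //; rewrite dvdn0.
have k0 : (0 < logn p n)%N by rewrite logn_gt0 mem_primes pp n0.
have [mge msq] : 0 <= divisor_sum f m /\ 1 <= divisor_sum f (m ^ 2).
  apply: IHn => //; rewrite nE -{1}[m]muln1 ltn_pmul2l //.
  by rewrite -{1}(expn0 p) ltn_exp2l // prime_gt1.
have pm2 : ~~ (p %| m ^ 2)%N by rewrite Euclid_dvdX // (negbTE pm).
have msq0 := le_trans ler01 msq.
split; first by rewrite nE mulnC; case: (divisor_sum_ppart fM fv pp pm m0 mge (logn p n)).
rewrite nE mulnC expnMn -expnM muln2; apply: le_trans msq _.
have m20 : (0 < m ^ 2)%N by rewrite expn_gt0 m0.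
by case: (divisor_sum_ppart fM fv pp pm2 m20 msq0 (logn p n)).
Qed.

(** A partial sum of L(1, f). *)
Definition harmonic_sum (R : realFieldType) (f : nat -> R) (n : nat) : R :=
  \sum_(1 <= k < n.+1) f k / k%:R.

Lemma sum_tail_split (V : zmodType) (F : nat -> V) (m n : nat) : (m <= n)%N ->
  \sum_(1 <= k < n.+1) F k = \sum_(1 <= k < m.+1) F k + \sum_(m.+1 <= k < n.+1) F k.
Proof. by move=> mn; rewrite -big_cat_nat //= ltnS. Qed.

(** The rate of convergence of L(1, f), stated between two finite sums so that no limit is
    involved. *)
Lemma harmonic_sum_tail (R : realFieldType) (f : nat -> R) (B : R) (m n : nat) :
  (forall i j, `|\sum_(i <= k < j) f k| <= B) -> (m <= n)%N ->
  `|harmonic_sum f n - harmonic_sum f m| <= B / m.+1%:R.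
Proof.
move=> fB mn; rewrite /harmonic_sum (sum_tail_split _ mn) addrC addKr.
apply: (@sum_abel _ f (fun k => k%:R^-1)) => // j mj.
  by rewrite invr_ge0.
by rewrite lef_pV2 ?posrE ?ltr0n ?ler_nat //; lia.
Qed.

(** * Partial sums of the inverse square roots *)

Section InverseSquareRoots.
Variable R : rcfType.
Implicit Types (n m : nat) (t : R).

Let sq n : R := Num.sqrt n%:R.

Let sq_ge0 n : 0 <= sq n. Proof. exact: sqrtr_ge0. Qed.
Let sq_gt0 n : (0 < n)%N -> 0 < sq n.
Proof. by move=> n0; rewrite sqrtr_gt0 ltr0n. Qed.
Let sqK n : sq n * sq n = n%:R.
Proof. by rewrite -expr2 sqr_sqrtr ?ler0n. Qed.
Let sq_le m n : (m <= n)%N -> sq m <= sq n.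
Proof. by move=> mn; rewrite ler_wsqrtr // ler_nat. Qed.

Definition inv_sqrt_sum n : R := \sum_(1 <= k < n.+1) (Num.sqrt k%:R)^-1.

Let E n := inv_sqrt_sum n - 2 * sq n.

(** The difference 2 (sqrt (n+1) - sqrt n) lies between 1 / sqrt (n+1) and 1 / sqrt n. The exception
    [n = 0] comes from the convention that the inverse of 0 is 0. *)
Let E_step n : E n.+1 <= E n /\ E n - E n.+1 <= (sq n)^-1 - (sq n.+1)^-1 \/ n = 0%N.
Proof.
case: n => [|n]; [by right|left].
have -> : E n.+2 = inv_sqrt_sum n.+1 + (sq n.+2)^-1 - 2 * sq n.+2.
  by rewrite /E /inv_sqrt_sum big_nat_recr.
rewrite /E; move: (inv_sqrt_sum n.+1) => s.
have a0 := sq_gt0 (ltn0Sn n); have b0 := sq_gt0 (ltn0Sn n.+1).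
have ab : sq n.+1 <= sq n.+2 by apply: sq_le.
have aa := sqK n.+1; have bb := sqK n.+2.
have d1 : (sq n.+2 - sq n.+1) * (sq n.+2 + sq n.+1) = 1.
  have -> : (sq n.+2 - sq n.+1) * (sq n.+2 + sq n.+1) = sq n.+2 * sq n.+2 - sq n.+1 * sq n.+1 by ring.
  by rewrite aa bb -natrB // subSn // subnn.
move: a0 b0 ab d1; move: (sq n.+1) (sq n.+2) => a b a0 b0 ab d1.
have d2 : b - a = (b + a)^-1.
  by rewrite -[RHS]mul1r -d1 mulfK // gt_eqF // addr_gt0.
have h1 : b^-1 <= 2 * (b - a).
  rewrite d2 -[2]invrK -invfM lef_pV2 ?posrE; lra.
have h2 : 2 * (b - a) <= a^-1.
  rewrite d2 -[2]invrK -invfM lef_pV2 ?posrE; lra.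
split; lra.
Qed.

Let E_mono m n : (0 < m <= n)%N -> 0 <= E m - E n <= (sq m)^-1 - (sq n)^-1.
Proof.
case/andP=> m0 mn; rewrite -(subnKC mn); elim: (n - m)%N => [|k IHk].
  by rewrite addn0 !subrr lexx.
rewrite addnS; case: (E_step (m + k)) => [[h1 h2]|]; last by lia.
by move/andP: IHk => [h3 h4]; apply/andP; split; lra.
Qed.

Let E_bound n : (0 < n)%N -> -2 <= E n <= 0.
Proof.
move=> n0; have /andP[h1 h2] := @E_mono 1 n n0.
have E1 : E 1 = -1 by rewrite /E /inv_sqrt_sum big_nat1 /sq sqrtr1 invr1; ring.
have s1 : (sq 1)^-1 = 1 by rewrite /sq sqrtr1 invr1.
have s2 : 0 <= (sq n)^-1 by rewrite invr_ge0.
rewrite E1 s1 in h1 h2; apply/andP; split; lra.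
Qed.

Lemma inv_sqrt_sum_bounds n : 0 <= inv_sqrt_sum n <= 2 * Num.sqrt n%:R.
Proof.
case: n => [|n]; first by rewrite /inv_sqrt_sum big_geq // sqrtr0 mulr0 lexx.
apply/andP; split; first by apply: sumr_ge0 => k _; rewrite invr_ge0 sqrtr_ge0.
by have := @E_bound n.+1 isT; rewrite /E -/(sq n.+1) => /andP[]; lra.
Qed.

(* The Euler-Maclaurin constant of the inverse square roots, up to an error
   that vanishes as [x] grows. *)
Lemma inv_sqrt_sum_approx (x : nat) : (0 < x)%N ->
  exists2 e : R, `|e| <= 2 & forall (t : R) (a : nat), (0 < a <= x)%N ->
    a%:R <= t < a.+1%:R ->
    `|inv_sqrt_sum a - 2 * Num.sqrt t - e| <= 2 / Num.sqrt t.
Proof.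
(* The limit of [E] would be zeta(1/2); its value at [x], the largest argument in use, serves
   instead. *)
move=> x0; exists (E x); first by have /andP[h1 h2] := E_bound x0; rewrite ler_norml; apply/andP; split; lra.
move=> t a /andP[a0 ax] /andP[at1 ta].
have /andP[h1 h2] : 0 <= E a - E x <= (sq a)^-1 - (sq x)^-1 by apply: E_mono; rewrite a0.
have s2 : 0 <= (sq x)^-1 by rewrite invr_ge0.
have t0 : 0 < t by apply: lt_le_trans at1; rewrite ltr0n.
have st : 0 < Num.sqrt t by rewrite sqrtr_gt0.
have sa := sq_gt0 a0.
have le1 : sq a <= Num.sqrt t by rewrite ler_wsqrtr.
have tt : Num.sqrt t * Num.sqrt t = t by rewrite -expr2 sqr_sqrtr // ltW.
have aS : a.+1%:R = a%:R + 1 :> R by rewrite -addn1 natrD.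
have a1 : 1 <= a%:R :> R by rewrite ler1n.
have le2 : Num.sqrt t <= 2 * sq a.
  have aa := sqK a; nra.
have le3 : 2 * (Num.sqrt t - sq a) <= (sq a)^-1.
  rewrite -(ler_pM2r sa) mulVf ?gt_eqF //; have aa := sqK a; nra.
have le4 : (sq a)^-1 <= 2 / Num.sqrt t.
  by rewrite ler_pdivlMr // mulrC ler_pdivrMr.
have EE : E a = inv_sqrt_sum a - 2 * sq a by [].
by rewrite ler_norml; apply/andP; split; lra.
Qed.

End InverseSquareRoots.

(** Each dyadic block from 2^k + 1 to 2^(k+1) contributes at least 1/2. *)
Lemma harmonic_unbounded (R : archiRealFieldType) (C : R) :
  exists2 y : nat, (0 < y)%N & C <= \sum_(1 <= k < y.+1) k%:R^-1.
Proof.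
have H k : k%:R / 2 <= \sum_(1 <= i < (2 ^ k).+1) i%:R^-1 :> R.
  elim: k => [|k IHk]; first by rewrite expn0 big_nat1 mul0r invr1 ler01.
  rewrite (@sum_tail_split _ _ (2 ^ k)); last by rewrite leq_exp2l.
  have -> : k.+1%:R / 2 = k%:R / 2 + 2^-1 :> R by rewrite -addn1 natrD mulrDl mul1r.
  rewrite lerD //.
  have <- : \sum_((2 ^ k).+1 <= i < (2 ^ k.+1).+1) ((2 ^ k.+1)%:R : R)^-1 = 2^-1.
    have E2 : (2 ^ k.+1 - 2 ^ k = 2 ^ k)%N by rewrite expnS; lia.
    rewrite sumr_const_nat subSS E2 expnS natrM -[_ *+ 2 ^ k]mulr_natr.
    by rewrite invfM -mulrA mulVf ?mulr1 // pnatr_eq0 expn_eq0.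
  rewrite !big_nat; apply: ler_sum => i /andP[h1 h2].
  by rewrite lef_pV2 ?posrE ?ltr0n ?ler_nat ?expn_gt0 //; lia.
have [m Cm] : exists m : nat, C * 2 <= m%:R.
  exists (Num.bound `|C * 2|).
  by apply: le_trans (ler_norm _) _; rewrite ltW // archi_boundP.
exists (2 ^ m)%N; first by rewrite expn_gt0.
by apply: le_trans (H m); rewrite ler_pdivlMr.
Qed.

(** * A lower bound for L(1, f) by Dirichlet's hyperbola method *)

Section Nonvanishing.
Variables (R : rcfType) (f : nat -> R) (B : R).
Hypotheses (f1 : f 1%N = 1) (fM : forall a b, f (a * b)%N = f a * f b).
Hypotheses (fv : forall a, f a \in [:: 0; 1; -1]).
Hypotheses (fB : forall i j, `|\sum_(i <= k < j) f k| <= B).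

(** Estimated twice at y^2: the squares alone give at least a harmonic sum, while splitting the
    divisors at y gives at most 2 y [harmonic_sum f y] plus a constant. *)
Let W n : R := \sum_(1 <= k < n.+1) divisor_sum f k / Num.sqrt k%:R.

(** The terms are nonnegative, and the one at k = j^2 is at least 1 / j. *)
Let W_ge y : \sum_(1 <= k < y.+1) k%:R^-1 <= W (y ^ 2).
Proof.
elim: y => [|y IHy]; first by rewrite exp0n // /W !big_geq.
have D0 k : (0 < k)%N -> 0 <= divisor_sum f k / Num.sqrt k%:R.
  by move=> k0; rewrite divr_ge0 ?sqrtr_ge0 //; case: (divisor_sum_ge0 f1 fM fv k0).
rewrite big_nat_recr //= /W.
rewrite (@sum_tail_split _ (fun k => divisor_sum f k / Num.sqrt k%:R) (y ^ 2)) ?leq_exp2r //.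
apply: lerD => //; have [k Ek] : exists k, (y.+1 ^ 2)%N = k.+1.
  by exists (y.+1 ^ 2).-1; rewrite prednK // expn_gt0.
have yk : (y ^ 2 <= k)%N by rewrite -ltnS -Ek ltn_exp2r.
rewrite Ek big_nat_recr //= -Ek -[X in X <= _]add0r lerD //.
  by rewrite big_nat; apply: sumr_ge0 => i /andP[i1 _]; apply: D0; lia.
rewrite natrX sqrtr_sqr ger0_norm // -[X in X <= _]mul1r ler_wpM2r ?invr_ge0 //.
by case: (@divisor_sum_ge0 _ f y.+1 f1 fM fv isT).
Qed.

Let Z := @inv_sqrt_sum R.

Let W_dirichlet x : W x = \sum_(1 <= d < x.+1) f d / Num.sqrt d%:R * Z (x %/ d).
Proof.
transitivity (\sum_(1 <= n < x.+1) \sum_(1 <= d < x.+1)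
   if (d %| n)%N then f d / Num.sqrt n%:R else 0).
  rewrite /W !big_nat; apply: eq_bigr => n nx.
  by rewrite -(@divisor_sum_widen _ f n x) // big_distrl /= big_mkcond.
rewrite exchange_big /= !big_nat; apply: eq_bigr => d /andP[d1 _].
rewrite -big_mkcond sum_multiples // /Z /inv_sqrt_sum big_distrr /=.
by apply: eq_bigr => j _; rewrite natrM sqrtrM // invfM mulrA.
Qed.

(** For d <= y, replace Z (y^2 / d) by 2 y / sqrt d + e. The main parts add up to 2 y L(1, f), and
    each of the y errors, once multiplied by f d / sqrt d, is at most 2 / y. *)
Let head_bound y : (0 < y)%N ->
  \sum_(1 <= d < y.+1) f d / Num.sqrt d%:R * Z (y ^ 2 %/ d)
  <= 2 * y%:R * harmonic_sum f y + 2 + 2 * B.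
Proof.
move=> y0; have y20 : (0 < y ^ 2)%N by rewrite expn_gt0 y0.
have [e e2 ee] := @inv_sqrt_sum_approx R _ y20.
have yR : 0 < y%:R :> R by rewrite ltr0n.
have fn d : `|f d| <= 1.
  by move: (fv d); rewrite !inE => /or3P[] /eqP ->; rewrite ?normr0 ?normrN ?normr1.
(* The constant [e] does not depend on d, so Abel summation applies to what it multiplies. *)
have ebd : e * \sum_(1 <= d < y.+1) f d / Num.sqrt d%:R <= 2 * B.
  apply: le_trans (ler_norm _) _; rewrite normrM ler_pM //.
  have := @sum_abel R f (fun k => (Num.sqrt k%:R)^-1) B 1 y.+1.
  rewrite sqrtr1 invr1 mulr1; apply=> // j j1; first by rewrite invr_ge0 sqrtr_ge0.
  by rewrite lef_pV2 ?posrE ?sqrtr_gt0 ?ltr0n // ler_wsqrtr // ler_nat.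
have -> : 2 * y%:R * harmonic_sum f y + 2 + 2 * B =
   \sum_(1 <= d < y.+1) (2 * y%:R * (f d / d%:R) + 2 / y%:R) + 2 * B.
  rewrite big_split /= -big_distrr /= sumr_const_nat subSS subn0 -(mulr_natr (2 / y%:R)).
  by rewrite mulfVK // gt_eqF.
apply: le_trans (lerD (lexx _) ebd); rewrite big_distrr /= -big_split /= !big_nat.
apply: ler_sum => d /andP[d0 dy].
have dR : 0 < d%:R :> R by rewrite ltr0n.
have sd : 0 < Num.sqrt d%:R :> R by rewrite sqrtr_gt0.
have sdd : Num.sqrt d%:R * Num.sqrt d%:R = d%:R :> R by rewrite -expr2 sqr_sqrtr // ltW.
pose t : R := (y ^ 2)%:R / d%:R.
have st : Num.sqrt t = y%:R / Num.sqrt d%:R.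
  by rewrite /t sqrtrM // natrX sqrtr_sqr ger0_norm // sqrtrV.
have h : `|Z (y ^ 2 %/ d) - 2 * (y%:R / Num.sqrt d%:R) - e| <= 2 / (y%:R / Num.sqrt d%:R).
  rewrite -st; apply: ee.
    rewrite divn_gt0 // leq_div // andbT.
    by rewrite (@leq_trans y) // -mulnn leq_pmulr.
  rewrite /t ler_pdivlMr // ltr_pdivrMr // -!natrM ler_nat ltr_nat leq_trunc_div.
  by rewrite ltn_ceil.
have {}h : `|f d / Num.sqrt d%:R * (Z (y ^ 2 %/ d) - 2 * (y%:R / Num.sqrt d%:R) - e)| 
   <= 2 / y%:R.
  rewrite normrM normf_div (gtr0_norm sd).
  have -> : 2 / y%:R = (1 / Num.sqrt d%:R) * (2 / (y%:R / Num.sqrt d%:R)) :> R.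
    by field; rewrite ?gt_eqF // ?andbT.
  apply: ler_pM => //; first by rewrite divr_ge0 // ltW.
  by rewrite ler_wpM2r // invr_ge0 ltW.
have {h}/ler_normlP[_ h] := h.
have -> : 2 * y%:R * (f d / d%:R) = f d / Num.sqrt d%:R * (2 * (y%:R / Num.sqrt d%:R)).
  by rewrite -{1}sdd; field; rewrite gt_eqF.
have <- : f d / Num.sqrt d%:R * (Z (y ^ 2 %/ d) - 2 * (y%:R / Num.sqrt d%:R) - e)
  + f d / Num.sqrt d%:R * (2 * (y%:R / Num.sqrt d%:R)) + e * (f d / Num.sqrt d%:R)
  = f d / Num.sqrt d%:R * Z (y ^ 2 %/ d) by ring.
lra.
Qed.

(** For d > y, sum over d first: by Abel summation each inner sum is at most B / sqrt y, and the
    outer sum of 1 / sqrt k over k <= y is at most 2 sqrt y. *)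
Let tail_bound y : (0 < y)%N ->
  \sum_(y.+1 <= d < (y ^ 2).+1) f d / Num.sqrt d%:R * Z (y ^ 2 %/ d) <= 2 * B.
Proof.
move=> y0; set X := (y ^ 2)%N.
have yR : 0 < y%:R :> R by rewrite ltr0n.
have B0 : 0 <= B by apply: le_trans (fB 0 0).
have -> : \sum_(y.+1 <= d < X.+1) f d / Num.sqrt d%:R * Z (X %/ d) =
  \sum_(1 <= k < y.+1) (Num.sqrt k%:R)^-1 *
     \sum_(y.+1 <= d < (X %/ k).+1) f d / Num.sqrt d%:R.
  (* From k d <= y^2 and d > y follows k <= y, so a fixed range for k loses nothing. *)
  transitivity (\sum_(y.+1 <= d < X.+1) \sum_(1 <= k < y.+1)
     if (k * d <= X)%N then f d / Num.sqrt d%:R / Num.sqrt k%:R else 0).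
    rewrite !big_nat; apply: eq_bigr => d /andP[yd dX].
    rewrite /Z /inv_sqrt_sum big_distrr /= (@big_nat_widen _ _ _ _ _ y.+1).
      rewrite -big_mkcond; apply: eq_bigl => k; rewrite /= ltnS leq_divRL //; lia.
    by rewrite ltn_divLR ?ltnS; [rewrite /X; nia | lia].
  rewrite exchange_big /= !big_nat; apply: eq_bigr => k /andP[k1 _].
  rewrite big_distrr /= [RHS](@big_nat_widen _ _ _ _ _ X.+1); last by rewrite ltnS leq_div.
  rewrite -big_mkcond; apply: eq_big => [d|d _]; last by rewrite mulrC.
  by rewrite ltnS leq_divRL // mulnC.
have sy : 0 < Num.sqrt y%:R :> R by rewrite sqrtr_gt0.
apply: (@le_trans _ _ (\sum_(1 <= k < y.+1) (Num.sqrt k%:R)^-1 * (B / Num.sqrt y%:R))).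
  apply: ler_sum => k _; apply: ler_wpM2l; first by rewrite invr_ge0 sqrtr_ge0.
  apply: le_trans (ler_norm _) _.
  apply: le_trans (@sum_abel R f (fun k => (Num.sqrt k%:R)^-1) B y.+1 _ _ _ _) _ => //.
  - by move=> j _; rewrite invr_ge0 sqrtr_ge0.
  - move=> j yj; rewrite lef_pV2 ?posrE ?sqrtr_gt0 ?ltr0n //; last by lia.
    by rewrite ler_wsqrtr // ler_nat.
  - apply: ler_wpM2l => //; rewrite lef_pV2 ?posrE ?sqrtr_gt0 ?ltr0n //.
    by rewrite ler_wsqrtr // ler_nat.
rewrite -big_distrl /= mulrCA [X in _ <= X]mulrC ler_wpM2l //.
rewrite ler_pdivrMr //.
by have /andP[_] := inv_sqrt_sum_bounds R y.
Qed.

Lemma harmonic_sum_lower y : (0 < y)%N ->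
  \sum_(1 <= k < y.+1) k%:R^-1 <= 2 * y%:R * harmonic_sum f y + 2 + 4 * B.
Proof.
move=> y0; apply: le_trans (W_ge y) _; rewrite W_dirichlet.
rewrite (@sum_tail_split _ _ y); last by rewrite -mulnn leq_pmulr.
have := head_bound y0; have := tail_bound y0; lra.
Qed.

End Nonvanishing.

(** Once the harmonic sum up to y exceeds 6 B + 4, [harmonic_sum_lower] makes the partial sum at y
    at least (B + 1) / y. Later terms change it by at most B / y, so 1 / y remains. *)
Lemma harmonic_sum_positive (R : realType) (f : nat -> R) (B : R) :
  f 1%N = 1 -> (forall a b, f (a * b)%N = f a * f b) ->
  (forall a, f a \in [:: 0; 1; -1]) ->
  (forall i j, `|\sum_(i <= k < j) f k| <= B) ->
  exists c : R, exists2 y : nat, 0 < c & forall z, (y <= z)%N -> c <= harmonic_sum f z.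
Proof.
move=> f1 fM fv fB.
have [y y0 Hy] := harmonic_unbounded (6 * B + 4).
have yR : 0 < y%:R :> R by rewrite ltr0n.
exists (y%:R^-1), y; first by rewrite invr_gt0.
move=> z yz; have /ler_normlP[h _] := harmonic_sum_tail fB yz.
have B0 : 0 <= B by apply: le_trans (fB 0 0)%N.
have h2 : B / y.+1%:R <= B / y%:R.
  by rewrite ler_wpM2l // lef_pV2 ?posrE ?ltr0n // ler_nat.
have h3 := harmonic_sum_lower f1 fM fv fB y0.
have h4 : (B + 1) / y%:R <= harmonic_sum f y.
  by rewrite ler_pdivrMr //; lra.
rewrite mulrDl mul1r in h4.
by rewrite -(lerD2l (B / y%:R)) (le_trans h4) // -lerBlDr -opprB (le_trans h).
Qed.

(** * Prime sums twisted by a real character *)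

Section PrimeSums.
Variable R : realType.
Implicit Types (n m x p k : nat).

Let L n : R := ln n%:R.

Let L_ge0 n : 0 <= L n.
Proof. by case: n => [|n]; [rewrite /L ln0 | rewrite /L ln_ge0 // ler1n]. Qed.

Let LM m n : (0 < m)%N -> (0 < n)%N -> L (m * n) = L m + L n.
Proof. by move=> m0 n0; rewrite /L natrM lnM // posrE ltr0n. Qed.

Let LX m k : (0 < m)%N -> L (m ^ k) = L m *+ k.
Proof. by move=> m0; rewrite /L natrX lnXn // ltr0n. Qed.

Let L_le m n : (0 < m <= n)%N -> L m <= L n.
Proof.
case/andP=> m0 mn; rewrite /L ler_ln ?posrE ?ltr0n ?ler_nat //; lia.
Qed.

Lemma ln_natS m : (0 < m)%N -> ln m.+1%:R <= ln m%:R + m%:R^-1 :> R.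
Proof.
move=> m0; have mR : 0 < m%:R :> R by rewrite ltr0n.
have -> : ln m.+1%:R = ln m%:R + ln (1 + m%:R^-1) :> R.
  rewrite -lnM ?posrE // ?addr_gt0 ?invr_gt0 //; congr ln.
  by rewrite mulrDr mulr1 mulfV ?gt_eqF // -addn1 natrD.
by rewrite lerD2l le_ln1Dx // (@lt_trans _ _ 0) ?ltrN10 ?invr_gt0.
Qed.

Let L_lt n : L n <= n%:R.
Proof.
by case: n => [|n]; [rewrite /L ln0 | rewrite /L ltW // ln_sublinear // ltr0n].
Qed.

Lemma logn_count_le p n x : prime p -> (n <= x)%N -> (0 < n)%N ->
  logn p n = (\sum_(1 <= k < x.+1) (p ^ k %| n))%N.
Proof.
move=> pp nx n0; rewrite (logn_count_dvd _ pp).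
rewrite (@big_nat_widen _ _ _ _ n x.+1); last by lia.
rewrite big_mkcond; apply: eq_bigr => k _; case: ltnP => //= nk.
have [/(dvdn_leq n0) pk|//] := boolP (p ^ k %| n)%N.
by have := ltn_expl k (prime_gt1 pp); lia.
Qed.

Lemma ln_prime_powers n x : (0 < n <= x)%N ->
  ln (n%:R : R) = \sum_(1 <= p < x.+1 | prime p) \sum_(1 <= k < x.+1 | (p ^ k %| n)%N) ln p%:R.
Proof.
case/andP=> n0 nx; rewrite -/(L n).
transitivity (\sum_(0 <= p < n.+1) L p *+ logn p n).
  rewrite -{1}(partnT n0) /partn /=.
  (* The index 0 occurs in [partn]; its exponent is 0, so the factor is 1 and the logarithm stays
     additive. *)
  have : all (fun p => 0 < p ^ logn p n)%N (index_iota 0 n.+1).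
    apply/allP => -[|p] _; last by rewrite expn_gt0.
    by rewrite lognE /=.
  elim: (index_iota 0 n.+1) => [|p s IHs] /=.
    by rewrite !big_nil /L ln1.
  case/andP=> p0 s0; rewrite !big_cons /= LM //; last first.
    by rewrite big_seq_cond prodn_cond_gt0 // => i /andP[/(allP s0)].
  rewrite IHs //; congr (_ + _); case: (p) p0 => [|q] q0; last by rewrite LX.
  by rewrite lognE /= /L ln1.
transitivity (\sum_(1 <= p < x.+1 | prime p) L p *+ logn p n).
  rewrite big_ltn // lognE mulr0n add0r [RHS]big_mkcond.
  rewrite (@big_nat_widen _ _ _ _ n.+1 x.+1) // [LHS]big_mkcond /=.
  apply: eq_bigr => p _; case: ltnP => pn; case: (boolP (prime p)) => // pp.
    by rewrite lognE (negbTE pp).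
  by rewrite lognE pp n0 /=; case: ifP => // /(dvdn_leq n0); lia.
apply: eq_bigr => p pp; rewrite (logn_count_le pp nx n0) [RHS]big_mkcond /= -sumrMnr.
by apply: eq_bigr => k _; case: (_ %| _)%N.
Qed.

(** Writes ln n as the sum of von Mangoldt's function over the divisors of n and exchanges the
    summations. *)
Lemma sum_ln_prime_powers (G : nat -> R) x :
  \sum_(1 <= n < x.+1) G n * ln n%:R =
  \sum_(1 <= p < x.+1 | prime p) \sum_(1 <= k < x.+1)
    ln p%:R * \sum_(1 <= j < (x %/ p ^ k).+1) G (p ^ k * j)%N.
Proof.
transitivity (\sum_(1 <= n < x.+1) \sum_(1 <= p < x.+1 | prime p)
   \sum_(1 <= k < x.+1) if (p ^ k %| n)%N then ln p%:R * G n else 0).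
  rewrite !big_nat; apply: eq_bigr => n nx; rewrite (ln_prime_powers nx) big_distrr /=.
  apply: eq_bigr => p _; rewrite big_distrr big_mkcond; apply: eq_bigr => k _ /=.
  by rewrite mulrC.
rewrite exchange_big /=; apply: eq_bigr => p pp; rewrite exchange_big /=.
apply: eq_bigr => k _; rewrite -big_mkcond sum_multiples ?expn_gt0 ?prime_gt0 //.
by rewrite big_distrr.
Qed.

Lemma geometric_tail p x : (1 < p)%N ->
  \sum_(2 <= k < x.+1) (p ^ k)%:R^-1 <= (p%:R * (p%:R - 1))^-1 :> R.
Proof.
move=> p1; have pR : 1 < p%:R :> R by rewrite ltr1n.
have p0 : 0 < p%:R :> R by lra.
have key i : \sum_(2 <= k < i.+2) (p ^ k)%:R^-1 =
    (1 - (p%:R ^+ i)^-1) / (p%:R * (p%:R - 1)) :> R.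
  elim: i => [|i IHi]; first by rewrite big_geq // expr0 invr1 subrr mul0r.
  rewrite big_nat_recr //= IHi natrX !exprS; field.
  by rewrite expf_neq0 ?subr_eq0 ?gt_eqF.
have p2 : 0 <= (p%:R * (p%:R - 1))^-1 :> R by rewrite invr_ge0 mulr_ge0 //; lra.
case: x => [|x]; first by rewrite big_geq.
rewrite key ler_piMl // lerBlDr lerDl invr_ge0 exprn_ge0 //; lra.
Qed.

(** The decrements of (ln m + 2) / m dominate ln m / (m (m - 1)), which makes prime power tails
    telescope. Of the added 2, one unit pays for u (b - a) <= 1 and one for b <= a + 1. *)
Lemma ln_div_step m :
  ln m.+2%:R * (m.+2%:R * (m.+2%:R - 1))^-1
  <= (ln m.+1%:R + 2) / m.+1%:R - (ln m.+2%:R + 2) / m.+2%:R :> R.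
Proof.
have mR : 0 < m.+1%:R :> R by rewrite ltr0n.
have m2 : m.+2%:R = m.+1%:R + 1 :> R by rewrite -addn1 natrD.
have := ln_natS (ltn0Sn m).
move: (ln m.+1%:R : R) (ln m.+2%:R : R) => a b; rewrite m2 addrK.
have h1 : m.+1%:R * m.+1%:R^-1 = 1 :> R by rewrite mulfV ?gt_eqF.
have h2 : m.+1%:R^-1 <= 1 :> R by rewrite invf_le1 // ler1n.
move: (m.+1%:R : R) mR h1 h2 => u u0 h1 h2 h.
have -> : (a + 2) / u - (b + 2) / (u + 1) =
    ((a + 2) * (u + 1) - (b + 2) * u) / ((u + 1) * u).
  field; have u1 : u + 1 != 0 by rewrite gt_eqF // addr_gt0.
  by rewrite (gt_eqF u0) u1.
apply: ler_wpM2r; first by rewrite invr_ge0 mulr_ge0 ?addr_ge0 // ltW.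
have : u * b <= u * (a + u^-1) by rewrite ler_pM2l.
rewrite mulrDr h1; move: (u^-1) h h2 => v; lra.
Qed.

(** Primes are replaced by all integers from 2 on, and the sum telescopes to at most (ln 1 + 2) /
    1. *)
Lemma prime_power_tail x :
  \sum_(1 <= p < x.+1 | prime p) ln p%:R * \sum_(2 <= k < x.+1) (p ^ k)%:R^-1 <= 2 :> R.
Proof.
pose g m : R := (L m + 2) / m%:R.
apply: (@le_trans _ _ (\sum_(1 <= m < x.+1) if m == 1%N then 0 else g m.-1 - g m)).
  rewrite big_mkcond !big_nat; apply: ler_sum => -[|[|m]] // _.
  have key := ln_div_step m.
  have m2 : m.+2%:R = m.+1%:R + 1 :> R by rewrite -addn1 natrD.
  case: ifP => pp /=; last first.
    apply: le_trans key; apply: mulr_ge0; first exact: L_ge0.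
    by rewrite invr_ge0 m2 addrK mulr_ge0 // addr_ge0.
  by apply: le_trans key; apply: ler_wpM2l; [exact: L_ge0 | exact: geometric_tail].
case: x => [|x]; first by rewrite big_geq.
rewrite big_ltn //= add0r.
have -> : \sum_(2 <= m < x.+2) (if m == 1%N then 0 else g m.-1 - g m) = g 1%N - g x.+1.
  elim: x => [|x IHx]; first by rewrite big_geq // subrr.
  by rewrite big_nat_recr //= IHx; ring.
have : 0 <= g x.+1 by rewrite /g divr_ge0 // addr_ge0.
have -> : g 1%N = 2 by rewrite /g /L ln1 add0r divr1.
by move: (g _) => u; lra.
Qed.

(** * Chebyshev's bound for the logarithms of the primes *)

Lemma prime_dvd_fact p m : prime p -> (p %| m`!)%N -> (p <= m)%N.
Proof.
move=> pp; elim: m => [|m IHm].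
  by rewrite fact0 dvdn1 => /eqP E; rewrite E in pp.
by rewrite factS Euclid_dvdM // => /orP[/dvdn_leq->//|/IHm/leqW].
Qed.

(** A prime in (m, 2 m] divides (2 m)! but not m!. The free end [j] is there for the induction. *)
Lemma prime_product_dvd_bin m j : (j <= m.*2.+1)%N ->
  (\prod_(m.+1 <= p < j | prime p) p %| 'C(m.*2, m))%N.
Proof.
elim: j => [|j IHj] jm; first by rewrite big_geq.
have [mj|mj] := leqP m.+1 j; last by rewrite big_geq.
rewrite big_mkcond big_nat_recr //= -big_mkcond /=; case: ifP => pj; last first.
  by rewrite muln1 IHj // ltnW.
rewrite Gauss_dvd ?IHj ?(ltnW jm) //=.
  have : (j %| 'C(m.*2, m) * (m`! * (m.*2 - m)`!))%N.
    by rewrite bin_fact -?addnn ?leq_addr // addnn dvdn_fact // prime_gt0 //=.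
  rewrite -addnn addnK !Euclid_dvdM // orbA -orbA orbb.
  suff -> : (j %| m`!)%N = false by rewrite orbF.
  by apply/negP => /(prime_dvd_fact pj); lia.
rewrite coprime_sym prime_coprime // big_nat_cond.
apply/negP => H.
have : exists2 p, (p < j)%N & prime p && (j %| p)%N.
  elim: {mj IHj} (index_iota m.+1 j) H => [|p s IHs].
    by rewrite big_nil dvdn1 => /eqP E; rewrite E in pj.
  rewrite big_cons; case: ifP => // /andP[/andP[_ pj'] pp].
  by rewrite Euclid_dvdM // => /orP[jp|/IHs//]; exists p; rewrite ?pp.
by case=> p pj' /andP[pp /(dvdn_leq (prime_gt0 pp))]; lia.
Qed.

(** Primes in (m, 2 m] contribute at most ln 'C(2 m, m) <= 2 m ln 2 <= 2 m. Halving x repeatedly,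
    the constant 4 leaves room for the crude bound ln x <= x on the last term of an odd x. *)
Lemma theta_bound x : \sum_(1 <= p < x.+1 | prime p) ln p%:R <= 4 * x%:R :> R.
Proof.
have L2 : L 2 <= 1.
  by have := @ln_natS 1 isT; rewrite /L ln1 invr1 add0r.
have step m : \sum_(m.+1 <= p < m.*2.+1 | prime p) L p <= 2 * m%:R.
  have -> : \sum_(m.+1 <= p < m.*2.+1 | prime p) L p
       = L (\prod_(m.+1 <= p < m.*2.+1 | prime p) p).
    elim: (index_iota _ _) => [|p s IHs]; first by rewrite !big_nil /L ln1.
    rewrite !big_cons; case: ifP => // pp; rewrite LM ?IHs //; first exact: prime_gt0.
    by apply: prodn_cond_gt0 => i /prime_gt0.
  apply: (@le_trans _ _ (L (2 ^ m.*2))).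
    apply: L_le; rewrite prodn_cond_gt0 /=; last by move=> i /prime_gt0.
    apply: (@leq_trans 'C(m.*2, m)).
      apply: dvdn_leq; last exact: prime_product_dvd_bin.
      by rewrite bin_gt0 -addnn leq_addr.
    rewrite -[2%N]/(1 + 1)%N Pascal; have mm : (m < m.*2.+1)%N by rewrite ltnS -addnn leq_addr.
    by rewrite (bigD1 (Ordinal mm)) //= !exp1n !muln1 leq_addr.
  rewrite LX // -(mulr_natr (L 2)) -mul2n natrM.
  by apply: ler_piMl => //; rewrite mulr_ge0.
elim/ltn_ind: x => -[|x] IHx; first by rewrite big_geq // mulr0.
have E := odd_double_half x.+1; set m := x.+1./2 in E.
have mx : (m < x.+1)%N by rewrite /m; lia.
have {}IHx : \sum_(1 <= p < m.+1 | prime p) L p <= 4 * m%:R := IHx m mx.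
have := step m.
have Lx : 0 <= L x.+1 <= x.+1%:R by rewrite L_ge0 L_lt.
have tail : \sum_(m.*2.+1 <= p < x.+2 | prime p) L p <= if odd x.+1 then L x.+1 else 0.
  case: (odd x.+1) E => E; last by rewrite big_geq //; lia.
  have -> : m.*2.+1 = x.+1 by lia.
  by rewrite big_mkcond big_nat1; case: ifP.
have -> : \sum_(1 <= p < x.+2 | prime p) ln p%:R =
   \sum_(1 <= p < m.+1 | prime p) L p + \sum_(m.+1 <= p < m.*2.+1 | prime p) L p
   + \sum_(m.*2.+1 <= p < x.+2 | prime p) L p.
  rewrite -big_cat_nat //=; last by lia.
  by rewrite -big_cat_nat //=; lia.
have xR : x.+1%:R = (odd x.+1)%:R + 2 * m%:R :> R.
  by rewrite -{1}E natrD -muln2 natrM [_ * 2%:R]mulrC.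
have m0 : 0 <= m%:R :> R by [].
move: tail xR Lx; case: (odd x.+1) => /= tail xR /andP[_ Lx] h; move: IHx tail xR Lx h m0.
  move: (\sum_(_ <= _ < _ | _) _) (\sum_(_ <= _ < _ | _) _) (\sum_(_ <= _ < _ | _) _).
  by move: (x.+1%:R) => *; lra.
move: (\sum_(_ <= _ < _ | _) _) (\sum_(_ <= _ < _ | _) _) (\sum_(_ <= _ < _ | _) _).
  by move: (x.+1%:R) => *; lra.
Qed.

End PrimeSums.

Definition prime_sum (R : realType) (f : nat -> R) (x : nat) : R :=
  \sum_(1 <= p < x.+1 | prime p) f p * ln p%:R / p%:R.

Lemma ln_nat_ge0 (R : realType) (n : nat) : 0 <= ln n%:R :> R.
Proof. by case: n => [|n]; [rewrite ln0 | rewrite ln_ge0 // ler1n]. Qed.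

(** The sum of f n ln n / n is bounded by Abel summation. Factoring ln n turns it into the sum of f
    p ln p / p times the partial sum of L(1, f) at x / p, up to prime powers; Chebyshev's bound
    allows replacing x / p by x, and the factor so split off is at least [c]. *)
Lemma prime_sum_bounded (R : realType) (f : nat -> R) (B : R) :
  f 1%N = 1 -> (forall a b, f (a * b)%N = f a * f b) ->
  (forall a, f a \in [:: 0; 1; -1]) ->
  (forall i j, `|\sum_(i <= k < j) f k| <= B) ->
  exists C : R, exists y : nat, forall x, (y <= x)%N -> `|prime_sum f x| <= C.
Proof.
move=> f1 fM fv fB.
have [c [y c0 cS]] := harmonic_sum_positive f1 fM fv fB.
have B0 : 0 <= B by apply: le_trans (fB 0%N 0%N).
have fn d : `|f d| <= 1.
  by move: (fv d); rewrite !inE => /or3P[] /eqP ->; rewrite ?normr0 ?normrN ?normr1.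
have SB n : `|harmonic_sum f n| <= B.
  have := harmonic_sum_tail fB (leq0n n).
  by rewrite {2}/harmonic_sum big_geq // subr0 divr1.
(* 4 B from Abel summation, 2 B from the prime powers and 4 B from replacing x / p by x. *)
exists (10 * B / c), y.+1 => x yx.
have x0 : 0 < x%:R :> R by rewrite ltr0n; lia.
have AB : `|\sum_(1 <= n < x.+1) f n / n%:R * ln n%:R| <= 4 * B.
  (* The weight ln n / n increases at first; (ln n + 2) / n decreases from 1 on, and the correction
     is a multiple of [harmonic_sum]. *)
  have -> : \sum_(1 <= n < x.+1) f n / n%:R * ln n%:R =
     \sum_(1 <= n < x.+1) f n * ((ln n%:R + 2) / n%:R) - 2 * harmonic_sum f x.
    rewrite /harmonic_sum big_distrr /= -sumrB; apply: eq_bigr => n _; ring.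
  have h1 : `|\sum_(1 <= n < x.+1) f n * ((ln n%:R + 2) / n%:R)| <= B * 2.
    have := @sum_abel R f (fun n => (ln n%:R + 2) / n%:R) B 1 x.+1.
    rewrite /= ln1 add0r divr1; apply=> // [j _|j].
      by rewrite divr_ge0 // addr_ge0 // ln_nat_ge0.
    case: j => // j _; rewrite -subr_ge0; apply: le_trans (ln_div_step R j).
    rewrite mulr_ge0 ?ln_nat_ge0 // invr_ge0 mulr_ge0 // subr_ge0 ler1n //.
  apply: le_trans (ler_normB _ _) _; rewrite normrM ger0_norm //.
  have := SB x; lra.
have main : `|\sum_(1 <= p < x.+1 | prime p) f p * ln p%:R / p%:R * harmonic_sum f (x %/ p)|
   <= 6 * B.
  have E : \sum_(1 <= n < x.+1) f n / n%:R * ln n%:R =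
    \sum_(1 <= p < x.+1 | prime p) f p * ln p%:R / p%:R * harmonic_sum f (x %/ p)
    + \sum_(1 <= p < x.+1 | prime p) \sum_(2 <= k < x.+1)
        ln p%:R * (f (p ^ k)%N / (p ^ k)%:R * harmonic_sum f (x %/ p ^ k)).
    rewrite (sum_ln_prime_powers (fun n => f n / n%:R)) -big_split /=.
    have H d : (0 < d)%N -> \sum_(1 <= j < (x %/ d).+1) f (d * j)%N / (d * j)%:R
         = f d / d%:R * harmonic_sum f (x %/ d).
      move=> d0; rewrite /harmonic_sum big_distrr /=; apply: eq_bigr => j _.
      by rewrite fM natrM invfM; ring.
    apply: eq_bigr => p pp; rewrite big_ltn; last by lia.
    rewrite expn1 H ?prime_gt0 //; congr (_ + _); first by ring.
    by apply: eq_bigr => k _; rewrite H // expn_gt0 prime_gt0.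
  have T : `|\sum_(1 <= p < x.+1 | prime p) \sum_(2 <= k < x.+1)
        ln p%:R * (f (p ^ k)%N / (p ^ k)%:R * harmonic_sum f (x %/ p ^ k))| <= B * 2.
    apply: le_trans (ler_norm_sum _ _ _) _.
    apply: le_trans (ler_wpM2l B0 (prime_power_tail R x)); rewrite big_distrr /=.
    apply: ler_sum => p pp; apply: le_trans (ler_norm_sum _ _ _) _.
    rewrite mulrCA big_distrr big_distrr /=; apply: ler_sum => k _.
    rewrite normrM (ger0_norm (ln_nat_ge0 _ _)) ler_wpM2l ?ln_nat_ge0 //.
    rewrite !normrM [X in _ <= X]mulrC ler_pM ?mulr_ge0 //.
    by rewrite [X in _ * X]ger0_norm ?invr_ge0 // ler_piMl ?invr_ge0.
  have -> : \sum_(1 <= p < x.+1 | prime p) f p * ln p%:R / p%:R * harmonic_sum f (x %/ p)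
     = \sum_(1 <= n < x.+1) f n / n%:R * ln n%:R -
       \sum_(1 <= p < x.+1 | prime p) \sum_(2 <= k < x.+1)
        ln p%:R * (f (p ^ k)%N / (p ^ k)%:R * harmonic_sum f (x %/ p ^ k)).
    by rewrite E addrK.
  by apply: le_trans (ler_normB _ _) _; lra.
have err : `|\sum_(1 <= p < x.+1 | prime p)
     f p * ln p%:R / p%:R * (harmonic_sum f x - harmonic_sum f (x %/ p))| <= 4 * B.
  have -> : 4 * B = B / x%:R * (4 * x%:R) by field; rewrite gt_eqF.
  have Bx : 0 <= B / x%:R by rewrite divr_ge0 // ltW.
  apply: le_trans (ler_wpM2l Bx (theta_bound R x)); rewrite big_distrr /=.
  apply: le_trans (ler_norm_sum _ _ _) _; apply: ler_sum => p pp.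
  have p0 : 0 < p%:R :> R by rewrite ltr0n prime_gt0.
  rewrite normrM (_ : B / x%:R * ln p%:R = ln p%:R / p%:R * (p%:R * B / x%:R)); last first.
    by field; rewrite !gt_eqF.
  apply: ler_pM => //.
    rewrite -mulrA normrM [X in _ * X]ger0_norm ?divr_ge0 ?ln_nat_ge0 //.
    by rewrite ler_piMl // divr_ge0 ?ln_nat_ge0.
  apply: le_trans (harmonic_sum_tail fB (leq_div x p)) _.
  rewrite ler_pdivrMr ?ltr0n // mulrAC ler_pdivlMr // [p%:R * B]mulrC -!mulrA.
  rewrite ler_wpM2l // -natrM ler_nat mulnC ltnW // ltn_ceil // prime_gt0 //.
have PS : prime_sum f x * harmonic_sum f x =
   \sum_(1 <= p < x.+1 | prime p) f p * ln p%:R / p%:R * harmonic_sum f (x %/ p) +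
   \sum_(1 <= p < x.+1 | prime p)
     f p * ln p%:R / p%:R * (harmonic_sum f x - harmonic_sum f (x %/ p)).
  by rewrite /prime_sum big_distrl -big_split /=; apply: eq_bigr => p _; ring.
rewrite ler_pdivlMr //.
apply: (@le_trans _ _ (`|prime_sum f x| * `|harmonic_sum f x|)).
  by rewrite ler_wpM2l // (le_trans (cS _ (ltnW yx))) // ler_norm.
rewrite -normrM PS; apply: le_trans (ler_normD _ _) _; lra.
Qed.

Lemma ln_fact_lower (R : realType) (n : nat) :
  n%:R * ln n%:R - n%:R <= \sum_(1 <= k < n.+1) ln k%:R :> R.
Proof.
elim: n => [|n IHn]; first by rewrite mul0r subr0 big_geq.
rewrite big_nat_recr //=; apply: le_trans (lerD IHn (lexx _)).
case: n {IHn} => [|n]; first by rewrite ln1 mulr0 mul0r; lra.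
have n0 : 0 < n.+1%:R :> R by rewrite ltr0n.
have n2 : n.+2%:R = n.+1%:R + 1 :> R by rewrite -addn1 natrD.
have h1 : n.+1%:R * n.+1%:R^-1 = 1 :> R by rewrite mulfV ?gt_eqF.
have := ln_natS R (ltn0Sn n).
move: (ln n.+1%:R : R) (ln n.+2%:R : R) => a b; rewrite n2.
move: (n.+1%:R : R) n0 h1 => u u0 h1 h.
have : u * b <= u * (a + u^-1) by rewrite ler_pM2l.
rewrite mulrDr h1; lra.
Qed.

(** Mertens: compare ln x! >= x ln x - x with its expansion over prime powers after dropping the
    floors. The 3 is 1 from the factorial and 2 from the higher powers. *)
Lemma prime_sum1_lower (R : realType) (x : nat) : (0 < x)%N ->
  ln x%:R - 3 <= prime_sum (fun=> 1) x :> R.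
Proof.
move=> x1; have x0 : 0 < x%:R :> R by rewrite ltr0n.
have E : \sum_(1 <= k < x.+1) ln k%:R <= x%:R * prime_sum (fun=> 1) x + x%:R * 2 :> R.
  have -> : \sum_(1 <= k < x.+1) ln k%:R = \sum_(1 <= k < x.+1) 1 * ln k%:R :> R.
    by apply: eq_bigr => k _; rewrite mul1r.
  rewrite (sum_ln_prime_powers (fun=> 1)).
  apply: le_trans (lerD (lexx _) (ler_wpM2l (ltW x0) (prime_power_tail R x))).
  rewrite /prime_sum !big_distrr -big_split /=; apply: ler_sum => p pp.
  have fl d : (0 < d)%N -> (x %/ d)%:R <= x%:R * d%:R^-1 :> R.
    by move=> d0; rewrite ler_pdivlMr ?ltr0n // -natrM ler_nat leq_trunc_div.
  rewrite big_ltn; last by lia.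
  apply: lerD.
    rewrite sumr_const_nat subSS subn0 expn1 mul1r mulrCA ler_wpM2l ?ln_nat_ge0 //.
    by rewrite fl // prime_gt0.
  rewrite mulrCA !big_distrr /=; apply: ler_sum => k _.
  rewrite ler_wpM2l ?ln_nat_ge0 // sumr_const_nat subSS subn0 fl //.
  by rewrite expn_gt0 prime_gt0.
have := le_trans (ln_fact_lower R x) E.
move=> h; rewrite -(ler_pM2l x0); move: h.
by move: (x%:R : R) (ln _) (prime_sum _ _) => u a b; lra.
Qed.

Lemma prime_sum1_unbounded (R : realType) (C : R) :
  exists y : nat, forall x, (y <= x)%N -> C <= prime_sum (fun=> 1) x.
Proof.
exists (Num.bound (expR (C + 3))) => x yx.
have e0 : 0 < expR (C + 3) :> R by apply: expR_gt0.
have xe : expR (C + 3) <= x%:R.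
  apply: le_trans (_ : (Num.bound (expR (C + 3)))%:R <= _); last by rewrite ler_nat.
  by apply: ltW; apply: archi_boundP; apply: ltW.
have x0 : 0 < x%:R :> R by apply: lt_le_trans xe.
have := prime_sum1_lower R (x := x); rewrite -(ltr0n R) => /(_ x0).
have : C + 3 <= ln x%:R by rewrite -[C + 3]expRK ler_ln ?posrE.
lra.
Qed.

(** * Quadratic residues *)

(** Euler's criterion taken as definition, with the modulus as first argument; the last case stands
    for the power -1, by [half_power_Fp]. *)
Definition legendre (p a : nat) : int :=
  let x := (a%:R : 'F_p) ^+ p./2 in
  if x == 0 then 0 else if x == 1 then 1 else -1.

Section Legendre.
Variable p : nat.
Hypotheses (pp : prime p) (p2 : (2 < p)%N).

Lemma odd_half_prime : p = (p./2).*2.+1.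
Proof.
have := odd_double_half p; have [p_eq2|->] := even_prime pp; last by lia.
by move: p2; rewrite p_eq2.
Qed.

Lemma natFp_eq0 a : ((a%:R : 'F_p) == 0) = (p %| a)%N.
Proof. by rewrite (dvdn_pcharf (pchar_Fp pp)). Qed.

Lemma natFp_eq a b : ((a%:R : 'F_p) == b%:R) = (a == b %[mod p])%N.
Proof. by rewrite -val_eqE /= !(val_Fp_nat pp). Qed.

Lemma two_Fp_neq0 : (2%:R : 'F_p) != 0.
Proof. by rewrite natFp_eq0; apply/negP => /dvdn_leq; lia. Qed.

Lemma half_power_Fp (x : 'F_p) : x != 0 -> (x ^+ p./2 == 1) || (x ^+ p./2 == -1).
Proof.
move=> x0; rewrite -sqrf_eq1 -exprM muln2.
have xE : x = (x : nat)%:R by rewrite natr_Zp.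
have cop : coprime x p.
  by rewrite coprime_sym prime_coprime // -natFp_eq0 -xE.
have Ep : (p./2).*2 = p.-1 by rewrite [in RHS]odd_half_prime.
rewrite xE -natrX -[1]/(1%:R) natFp_eq Ep -totient_prime //.
by rewrite Euler_exp_totient.
Qed.

Lemma legendre_Fp a : (legendre p a)%:~R = (a%:R : 'F_p) ^+ p./2.
Proof.
rewrite /legendre; case: ifP => [/eqP -> //|/negbT h].
have a0 : (a%:R : 'F_p) != 0.
  apply: contraNneq h => ->; rewrite expr0n; have := odd_half_prime.
  by case: (p./2) => //; lia.
case/orP: (half_power_Fp a0) => /eqP ->; first by rewrite eqxx.
by case: eqP => [->|_]; rewrite ?rmorphN.
Qed.

Lemma legendre_vals a : legendre p a \in [:: 0; 1; -1].
Proof. by rewrite /legendre; do 2 case: ifP => // _. Qed.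

(** As p > 2, the signs stay distinct in the field, so identities between symbols may be checked
    there. *)
Lemma sign_Fp_inj (x y : int) : x \in [:: 0; 1; -1] -> y \in [:: 0; 1; -1] ->
  x%:~R = y%:~R :> 'F_p -> x = y.
Proof.
have n1 := oner_neq0 'F_p; have n2 := two_Fp_neq0.
have e2 : 1 + 1 != 0 :> 'F_p by [].
rewrite !inE => /or3P[] /eqP -> /or3P[] /eqP -> // /eqP;
  rewrite ?mulrN1z ?mulr1z ?mulr0z.
- by rewrite eq_sym oppr_eq0 (negbTE n1).
- by rewrite -subr_eq0 opprK (negbTE e2).
- by rewrite oppr_eq0 (negbTE n1).
- by rewrite eq_sym -subr_eq0 opprK (negbTE e2).
Qed.

Lemma sign_mul_vals (x y : int) : x \in [:: 0; 1; -1] -> y \in [:: 0; 1; -1] ->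
  x * y \in [:: 0; 1; -1].
Proof. by rewrite !inE => /or3P[] /eqP -> /or3P[] /eqP ->. Qed.

Lemma sign_exp_vals k : (-1) ^+ k \in ([:: 0; 1; -1] : seq int).
Proof. by rewrite -signr_odd; case: (odd k). Qed.

Lemma legendreM a b : legendre p (a * b) = legendre p a * legendre p b.
Proof.
apply: sign_Fp_inj; rewrite ?sign_mul_vals ?legendre_vals //.
by rewrite rmorphM /= !legendre_Fp natrM exprMn.
Qed.

Lemma legendre_mod a : legendre p (a %% p) = legendre p a.
Proof. by rewrite /legendre Fp_nat_mod. Qed.

Lemma legendre1 : legendre p 1 = 1.
Proof. by rewrite /legendre expr1n oner_eq0 eqxx. Qed.

Lemma legendre_eq0 a : (legendre p a == 0) = (p %| a)%N.
Proof.
rewrite -natFp_eq0 /legendre expf_eq0; have -> : (0 < p./2)%N by have := odd_half_prime; lia.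
by rewrite andTb; case: (boolP (a%:R == 0 :> 'F_p)) => // _; case: ifP.
Qed.

Lemma half_power_roots (s : seq 'F_p) : uniq s ->
  all (fun x => x ^+ p./2 == 1) s -> (size s <= p./2)%N.
Proof.
move=> us al; have h0 : (0 < p./2)%N by have := odd_half_prime; lia.
have P0 : 'X^(p./2) - 1 != 0 :> {poly 'F_p} by rewrite -size_poly_eq0 size_XnsubC.
rewrite -ltnS -(@size_XnsubC _ (p./2) (1 : 'F_p)) // max_poly_roots //.
by apply: sub_all al => x; rewrite rootE !hornerE subr_eq0.
Qed.

(** The squares of 1, ..., (p-1)/2 are that many distinct roots of X^((p-1)/2) = 1; a non-square [a]
    would be one root too many. *)
Lemma legendre_square a : legendre p a = 1 -> exists x, (x * x = a %[mod p])%N.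
Proof.
move=> la; have ha : (a%:R : 'F_p) ^+ p./2 = 1 by rewrite -legendre_Fp la.
pose s := [seq (k%:R : 'F_p) ^+ 2 | k <- iota 1 p./2].
have us : uniq s.
  rewrite map_inj_in_uniq ?iota_uniq // => i j; rewrite !mem_iota => hi hj /eqP.
  have Ep := odd_half_prime.
  rewrite eqf_sqr => /orP[].
    by rewrite natFp_eq !modn_small; [move/eqP | lia | lia].
  rewrite -subr_eq0 opprK -natrD natFp_eq0 => /dvdn_leq; lia.
have als : all (fun x => x ^+ p./2 == 1) s.
  apply/allP => y /mapP[k]; rewrite mem_iota => hk ->.
  have k0 : (k%:R : 'F_p) != 0.
    by rewrite natFp_eq0; apply/negP => /dvdn_leq; have := odd_half_prime; lia.
  have := half_power_Fp k0; rewrite -sqrf_eq1 -exprM mulnC exprM.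
  by rewrite -exprM muln2 -mul2n exprM.
have [/mapP[k _ ak]|nas] := boolP (a%:R \in s).
  by exists k; apply/eqP; rewrite -natFp_eq natrM ak expr2.
have := @half_power_roots (a%:R :: s); rewrite /= nas us ha eqxx als size_map size_iota.
by move=> /(_ isT isT); rewrite ltnn.
Qed.

Lemma legendre_nonresidue : exists a, legendre p a = -1.
Proof.
have Ep := odd_half_prime.
have [/hasP[a _ /eqP h]|] := boolP (has (fun a => legendre p a == -1) (iota 1 p.-1)).
  by exists a.
rewrite -all_predC => /allP al.
pose s := [seq (k%:R : 'F_p) | k <- iota 1 p.-1].
have us : uniq s.
  rewrite map_inj_in_uniq ?iota_uniq // => i j; rewrite !mem_iota => hi hj /eqP.
  by rewrite natFp_eq !modn_small; [move/eqP | lia | lia].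
have := half_power_roots us; rewrite size_map size_iota => h.
suff : (p.-1 <= p./2)%N by lia.
apply: h; apply/allP => y /mapP[k hk ->].
have := al _ hk; rewrite /= -legendre_Fp; move: (legendre_vals k) (legendre_eq0 k).
rewrite !inE => /or3P[] /eqP -> //=.
by rewrite eqxx => /esym/dvdn_leq; move: hk; rewrite mem_iota; lia.
Qed.

(** Gauss counts the k for which a k mod p exceeds p / 2; the floor of 2 a k / p has the parity of
    that indicator, and floors can be added and compared later. *)
Lemma gauss_lemma a : ~~ (p %| a)%N ->
  legendre p a = (-1) ^+ (\sum_(1 <= k < (p./2).+1) (2 * (a * k)) %/ p).
Proof.
move=> pa; have Ep := odd_half_prime; set h := p./2 in Ep *.
pose r k := ((a * k) %% p)%N.
(* The absolute value of the least absolute residue of a k. *)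
pose s k := if (r k <= h)%N then r k else (p - r k)%N.
have p0 : (0 < p)%N by lia.
have nd k : (0 < k <= h)%N -> ~~ (p %| k)%N by move=> hk; apply/negP => /dvdn_leq; lia.
have rs k : (0 < k <= h)%N -> (0 < r k < p)%N.
  by move=> hk; rewrite ltn_mod p0 andbT lt0n -/(dvdn p _) Euclid_dvdM // negb_or pa nd.
have ss k : (0 < k <= h)%N -> (0 < s k <= h)%N.
  by move=> /rs; rewrite /s; case: ifP; lia.
have sE k : (0 < k <= h)%N -> (a * k)%:R = (-1) ^+ ((2 * (a * k)) %/ p) * (s k)%:R :> 'F_p.
  move=> hk; have rk := rs k hk.
  have E := divn_eq (a * k) p; rewrite -/(r k) in E.
  have dE : ((2 * (a * k)) %/ p = (a * k) %/ p * 2 + (h < r k))%N.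
    have -> : (2 * (a * k) = ((a * k) %/ p * 2) * p + 2 * r k)%N by lia.
    rewrite divnMDl //; congr addn; case: ltnP => hr.
      have -> : (2 * r k = 1 * p + (2 * r k - p))%N by lia.
      by rewrite divnMDl // divn_small //; lia.
    by rewrite divn_small //; lia.
  rewrite dE exprD exprM sqrr_sign mul1r -(Fp_nat_mod pp) -/(r k) /s ltnNge.
  case: leqP => /= hr; first by rewrite mul1r.
  by rewrite natrB ?pchar_Fp_0 // ?sub0r ?mulrNN ?mul1r //; lia.
(* Equal values mean a i = a j or a i = - a j modulo p, and i + j < p excludes the second; hence [s]
   permutes 1, ..., h. *)
have sinj : {in iota 1 h &, injective s}.
  move=> i j; rewrite !mem_iota !add1n !ltnS => hi hj eqs.
  have : ((a * i)%:R : 'F_p) ^+ 2 == (a * j)%:R ^+ 2.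
    by rewrite (sE i hi) (sE j hj) eqs !exprMn !sqrr_sign.
  rewrite !natrM !exprMn -subr_eq0 -mulrBr mulf_eq0 expf_eq0 natFp_eq0 (negbTE pa) /=.
  rewrite subr_eq0 eqf_sqr => /orP[].
    by rewrite natFp_eq !modn_small; [move/eqP | lia | lia].
  by rewrite -subr_eq0 opprK -natrD natFp_eq0 => /dvdn_leq; lia.
have perm : perm_eq [seq s k | k <- iota 1 h] (iota 1 h).
  have us : uniq [seq s k | k <- iota 1 h] by rewrite map_inj_in_uniq ?iota_uniq.
  have sub : {subset [seq s k | k <- iota 1 h] <= iota 1 h}.
    by move=> x /mapP[k]; rewrite !mem_iota !add1n !ltnS => /ss hs ->.
  have [_ eqi] := uniq_min_size us sub (eq_leq (esym (size_map s (iota 1 h)))).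
  by rewrite uniq_perm ?iota_uniq.
have prodE : \prod_(k <- iota 1 h) (a * k)%:R =
   (-1) ^+ (\sum_(k <- iota 1 h) (2 * (a * k)) %/ p) * \prod_(k <- iota 1 h) k%:R :> 'F_p.
  have -> : \prod_(k <- iota 1 h) k%:R = \prod_(k <- iota 1 h) (s k)%:R :> 'F_p.
    by rewrite -(big_map s predT (fun j => j%:R)) (perm_big _ perm).
  rewrite -prodrXr -big_split /=.
  rewrite !big_seq; apply: eq_bigr => k; rewrite mem_iota => hk; apply: sE; lia.
have nz : \prod_(k <- iota 1 h) k%:R != 0 :> 'F_p.
  rewrite big_seq; apply: (big_ind (fun x => x != 0)); first exact: oner_neq0.
    exact: mulf_neq0.
  by move=> k; rewrite mem_iota natFp_eq0 => hk; apply: nd; lia.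
have lhs : \prod_(k <- iota 1 h) (a * k)%:R = a%:R ^+ h * \prod_(k <- iota 1 h) k%:R :> 'F_p.
  rewrite -{2}(size_iota 1 h); elim: (iota 1 h) => [|k t IHt].
    by rewrite !big_nil mulr1.
  by rewrite !big_cons IHt natrM exprS; ring.
rewrite /index_iota subSS subn0; apply: sign_Fp_inj; rewrite ?legendre_vals ?sign_exp_vals //.
by rewrite legendre_Fp rmorphXn /= rmorphN1; apply: (mulIf nz); rewrite -lhs -prodE.
Qed.

End Legendre.

(** * The supplementary laws and quadratic reciprocity *)

Section Supplements.
Variable p : nat.
Hypotheses (pp : prime p) (p2 : (2 < p)%N).

Lemma legendre_neg1 : legendre p p.-1 = (-1) ^+ p./2.
Proof.
apply: (sign_Fp_inj pp p2); rewrite ?legendre_vals ?sign_exp_vals //.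
rewrite legendre_Fp // rmorphXn /= rmorphN1; congr (_ ^+ _).
apply/eqP; rewrite -subr_eq0 opprK.
by rewrite -[1]/(1%:R) -natrD addn1 prednK ?pchar_Fp_0 ?eqxx ?(prime_gt0 pp).
Qed.

Let h := p./2.
Let Ep : p = h.*2.+1. Proof. exact: odd_half_prime. Qed.

(** Eisenstein's device: modulo p, 2 a is 4 b with b = (a + p) / 2, so (2a/p) = (b/p), and in
    Gauss's lemma 2 b k / p = k + a k / p. Taking a = 1 isolates (2/p), which then cancels for the
    other odd a. *)
Lemma legendre_2a a : odd a -> ~~ (p %| a)%N ->
  legendre p 2 * legendre p a =
  (-1) ^+ (\sum_(1 <= k < h.+1) k) * (-1) ^+ (\sum_(1 <= k < h.+1) (a * k) %/ p).
Proof.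
move=> oa pa; rewrite -legendreM // -exprD -big_split /=.
pose b := (a + p)./2.
have bE : (2 * b = a + p)%N by rewrite /b; have := Ep; lia.
have l4 : legendre p (2 * 2) = 1.
  rewrite legendreM //; move: (legendre_vals p 2) (legendre_eq0 pp p2 2).
  rewrite !inE => /or3P[] /eqP -> //=.
  by rewrite eqxx => /esym/dvdn_leq; lia.
have -> : legendre p (2 * a) = legendre p b.
  rewrite -[RHS]mul1r -l4 -legendreM // -mulnA bE -(legendre_mod pp) -[RHS](legendre_mod pp).
  by rewrite mulnDr -[in RHS]modnDm modnMl addn0 modn_mod.
have pb : ~~ (p %| b)%N.
  apply: contra pa => /(dvdn_mull 2); rewrite bE => h1.
  by rewrite -(dvdn_addl a (dvdnn p)).
rewrite gauss_lemma //; congr (_ ^+ _); apply: eq_bigr => k _.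
by rewrite mulnA bE mulnDl divnDr ?dvdn_mulr // mulKn ?(prime_gt0 pp) // addnC.
Qed.

Lemma legendre2 : legendre p 2 = (-1) ^+ (\sum_(1 <= k < h.+1) k).
Proof.
have p1 : ~~ (p %| 1)%N by rewrite dvdn1; lia.
have := @legendre_2a 1 isT p1; rewrite legendre1 // mulr1 => ->.
have -> : (\sum_(1 <= k < h.+1) (1 * k) %/ p = 0)%N.
  by rewrite big_nat big1 // => k hk; rewrite mul1n divn_small //; have := Ep; lia.
by rewrite mulr1.
Qed.

Lemma legendre_odd a : odd a -> ~~ (p %| a)%N ->
  legendre p a = (-1) ^+ (\sum_(1 <= k < h.+1) (a * k) %/ p).
Proof.
move=> oa pa; have := legendre_2a oa pa; rewrite -legendre2.
by apply: mulfI; rewrite legendre_eq0 //; apply/negP => /dvdn_leq; lia.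
Qed.

Lemma sum_nat_half n : (2 * \sum_(1 <= k < n.+1) k = n * n.+1)%N.
Proof.
elim: n => [|n IHn]; first by rewrite big_geq.
by rewrite big_nat_recr //= mulnDr IHn; lia.
Qed.

Lemma legendre2_mod8 : legendre p 2 = if (p %% 8 \in [:: 1; 7])%N then 1 else -1.
Proof.
rewrite legendre2 -signr_odd; set s := \sum_(_ <= _ < _) _.
have := sum_nat_half h; rewrite -/s => hs.
have E := divn_eq h 4; have : (h %% 4 < 4)%N by rewrite ltn_mod.
have := Ep; move: E hs; move: (h %/ 4)%N (h %% 4)%N => t [|[|[|[|c]]]] // E hs pE _.
- have -> : odd s = false by nia.
  by have -> : (p %% 8 = 1)%N by lia.
- have -> : odd s = true by nia.
  by have -> : (p %% 8 = 3)%N by lia.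
- have -> : odd s = true by nia.
  by have -> : (p %% 8 = 5)%N by lia.
- have -> : odd s = false by nia.
  by have -> : (p %% 8 = 7)%N by lia.
Qed.

Lemma legendre_neg1_mod4 : legendre p p.-1 = if (p %% 4 == 1)%N then 1 else -1.
Proof.
rewrite legendre_neg1 -signr_odd -/h; have := Ep => E.
have : (p %% 4 < 4)%N by rewrite ltn_mod.
case: eqP => h1 h2; first by have -> : odd h = false by lia.
by have -> : odd h = true by lia.
Qed.

End Supplements.

(** Turns a floor into a number of lattice points. *)
Lemma sum_leq_nat m n : (m <= n)%N -> (\sum_(1 <= j < n.+1) (j <= m) = m)%N.
Proof.
elim: n m => [|n IHn] m mn; first by rewrite big_geq //; lia.
rewrite big_nat_recr //=; have [e|ne] := eqVneq m n.+1.
  rewrite e leqnn; have := IHn n (leqnn n) => {}IHn.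
  rewrite -[X in _ = X.+1]IHn addn1; congr S.
  by rewrite !big_nat; apply: eq_bigr => j hj; lia.
by rewrite IHn; lia.
Qed.

(** Eisenstein's count: the two exponents count the points of a rectangle below and above its
    diagonal, which contains none of them. *)
Lemma quadratic_reciprocity p q : prime p -> prime q -> (2 < p)%N -> (2 < q)%N ->
  p != q -> legendre p q * legendre q p = (-1) ^+ (p./2 * q./2).
Proof.
move=> pp pq p2 q2 npq.
have Ep := odd_half_prime pp p2; have Eq := odd_half_prime pq q2.
have npdq : ~~ (p %| q)%N by rewrite dvdn_prime2.
have nqdp : ~~ (q %| p)%N by rewrite dvdn_prime2 // eq_sym.
have op : odd p by rewrite Ep /= odd_double.
have oq : odd q by rewrite Eq /= odd_double.
rewrite !legendre_odd // -exprD; congr (_ ^+ _).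
have cnt (a b : nat) : prime a -> (2 < a)%N -> (2 < b)%N -> a = (a./2).*2.+1 -> b = (b./2).*2.+1 ->
   (\sum_(1 <= k < (a./2).+1) (b * k) %/ a =
   \sum_(1 <= k < (a./2).+1) \sum_(1 <= j < (b./2).+1) (a * j <= b * k))%N.
  move=> pa a2 b2 Ea Eb; rewrite !big_nat; apply: eq_bigr => k hk.
  rewrite -[LHS](@sum_leq_nat _ b./2).
    by apply: eq_bigr => j _; rewrite leq_divRL ?(prime_gt0 pa) // mulnC.
  rewrite -ltnS ltn_divLR ?(prime_gt0 pa) //; nia.
rewrite (cnt p q) // (cnt q p) // [X in (_ + X)%N]exchange_big /= -big_split /=.
rewrite (eq_big_nat _ _ (F2 := fun=> q./2)); first by rewrite sum_nat_const_nat subSS subn0.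
move=> k hk; rewrite -big_split /= (eq_big_nat _ _ (F2 := fun=> 1%N)).
  by rewrite sum_nat_const_nat subSS subn0 muln1.
move=> j hj.
have : (p * j != q * k)%N.
  apply/eqP => e; have : (p %| q * k)%N by rewrite -e dvdn_mulr.
  by rewrite Euclid_dvdM // (negbTE npdq) => /dvdn_leq; lia.
by case: ltngtP.
Qed.

Lemma legendre_sym p q : prime p -> prime q -> (2 < p)%N -> p != q ->
  (q %% 4 = 1)%N -> legendre q p = legendre p q.
Proof.
move=> pp pq p2 npq q4.
have q2 : (2 < q)%N by have := prime_gt1 pq; case: (q) q4 => [|[|[|]]].
have := quadratic_reciprocity pp pq p2 q2 npq.
have -> : (-1) ^+ (p./2 * q./2) = 1 :> int.
  have hq : odd q./2 = false.
    by move: q4 (odd_half_prime pq q2); move: (q./2) => u h E; lia.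
  by rewrite -signr_odd oddM hq andbF.
move: (legendre_vals p q) (legendre_vals q p).
by rewrite !inE => /or3P[] /eqP -> /or3P[] /eqP ->.
Qed.

(** * Primes with prescribed quadratic characters *)

Record real_character (m : nat) (chi : nat -> int) : Prop := RealCharacter {
  modulus_gt0 : (0 < m)%N;
  character1 : chi 1%N = 1;
  characterM : forall a b, chi (a * b)%N = chi a * chi b;
  character_mod : forall a, chi (a %% m)%N = chi a;
  character_vals : forall a, chi a \in [:: 0; 1; -1] }.

Definition nonprincipal (m : nat) (chi : nat -> int) : Prop :=
  exists2 a, coprime a m & chi a = -1.

Lemma real_character_legendre r : prime r -> (2 < r)%N -> real_character r (legendre r).
Proof.
move=> pr r2; split; first exact: prime_gt0.
- exact: legendre1.
- exact: legendreM.
- exact: legendre_mod.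
- exact: legendre_vals.
Qed.

Lemma real_character_mul m n chi psi : real_character m chi -> real_character n psi ->
  real_character (m * n) (fun a => chi a * psi a).
Proof.
move=> [m0 c1 cM cp cv] [n0 d1 dM dp dv]; split=> [||a b|a|a].
- by rewrite muln_gt0 m0.
- by rewrite c1 d1.
- by rewrite cM dM; ring.
- rewrite -[X in X * _ = _]cp -[X in _ * X = _]dp.
  by rewrite modn_dvdm ?dvdn_mulr // modn_dvdm ?dvdn_mull // cp dp.
- exact: sign_mul_vals.
Qed.

Lemma nonprincipal_mul m n chi psi a b : real_character m chi -> real_character n psi ->
  coprime m n -> coprime a m -> coprime b n -> chi a * psi b = -1 ->
  nonprincipal (m * n) (fun k => chi k * psi k).
Proof.
move=> [m0 c1 cM cp cv] [n0 d1 dM dp dv] mn am bn E.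
exists (chinese m n a b).
  by rewrite coprimeMr -[coprime _ m]coprime_modl -[coprime _ n]coprime_modl
     chinese_modl // chinese_modr // !coprime_modl am.
by rewrite -[X in X * _]cp -[X in _ * X]dp chinese_modl // chinese_modr // cp dp.
Qed.

(** Multiplication by a unit [a] with [chi a = -1] permutes the residues and changes the sign of the
    sum. *)
Lemma character_period_sum m chi : real_character m chi -> nonprincipal m chi ->
  \sum_(0 <= k < m) chi k = 0.
Proof.
move=> [m0 c1 cM cp cv] [a am ca]; rewrite big_mkord.
pose h (i : 'I_m) : 'I_m := Ordinal (ltn_pmod (a * i) m0).
have hinj : injective h.
  move=> i j /(congr1 val) /= /eqP.
  wlog ij : i j / (i <= j)%N => [wl|].
    by case/orP: (leq_total i j) => ?; [|rewrite eq_sym => H; apply/esym; move: H]; apply: wl.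
  rewrite eq_sym eqn_mod_dvd; last by rewrite leq_mul2l ij orbT.
  rewrite -mulnBr Gauss_dvdr 1?coprime_sym // => d; apply/val_inj => /=.
  have := ltn_ord j; have := ltn_ord i => hi hj.
  have [e|ne] := posnP (j - i)%N; first by apply/eqP; rewrite eqn_leq ij /=; lia.
  by have := dvdn_leq ne d; lia.
have E : \sum_(i < m) chi i = chi a * \sum_(i < m) chi i.
  rewrite {1}(reindex_inj hinj) /= big_distrr /=; apply: eq_bigr => i _.
  by rewrite cp cM.
by move: E; rewrite ca; move: (\sum_(i < m) chi i) => u; lia.
Qed.

(** Full periods cancel, so a sum from 0 is at most [m]; a general sum is a difference of two
    such. *)
Lemma character_partial_sums (R : realFieldType) m chi : real_character m chi ->
  nonprincipal m chi ->
  forall i j, `|\sum_(i <= k < j) (chi k)%:~R| <= (m + m)%:R :> R.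
Proof.
move=> C N i j; have Z := character_period_sum C N; case: C => m0 c1 cM cp cv.
have n1 a : `|(chi a)%:~R| <= 1 :> R.
  by move: (cv a); rewrite !inE => /or3P[] /eqP ->; rewrite ?mulrN1z ?normrN ?normr0 ?normr1.
have T n : \sum_(0 <= k < n) (chi k)%:~R = \sum_(0 <= k < n %% m) (chi k)%:~R :> R.
  rewrite {1}(divn_eq n m); move: (n %/ m)%N (n %% m)%N => q r.
  elim: q => [|q IHq]; first by rewrite mul0n add0n.
  rewrite mulSn -addnA (@big_cat_nat _ _ _ m) //=; last by rewrite leq_addr.
  rewrite -(rmorph_sum (intmul 1)) Z add0r -{1}[m]add0n big_addn.
  have -> : (m + (q * m + r) - m = q * m + r)%N by lia.
  rewrite -IHq; apply: eq_bigr => k _.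
  by rewrite -cp modnDr cp.
have Tb n : `|\sum_(0 <= k < n) (chi k)%:~R| <= m%:R :> R.
  rewrite T; apply: le_trans (ler_norm_sum _ _ _) _.
  apply: (@le_trans _ _ (\sum_(0 <= k < n %% m) 1)); first exact: ler_sum.
  by rewrite sumr_const_nat subn0 ler_nat ltnW // ltn_mod.
have [ij|ij] := leqP i j; last by rewrite big_geq ?normr0 // ltnW.
have -> : \sum_(i <= k < j) (chi k)%:~R =
   \sum_(0 <= k < j) (chi k)%:~R - \sum_(0 <= k < i) (chi k)%:~R :> R.
  by rewrite (@big_cat_nat _ _ _ i 0 j) //= addrAC subrr add0r.
by apply: le_trans (ler_normB _ _) _; rewrite natrD lerD.
Qed.

(** * Prime sums sieved by quadratic characters *)

Section PrimeExistence.
Variable R : realType.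

(** For signs [eps], and for primes outside [rs], the product is nonzero exactly when all the
    prescribed symbols [legendre r p = eps r] hold. *)
Definition sieved_prime_sum (eps : nat -> int) (rs : seq nat) (psi : nat -> int) : nat -> R :=
  prime_sum (fun p => (psi p * \prod_(r <- rs) (1 + eps r * legendre r p))%:~R).

Lemma prime_sum_ext (f g : nat -> R) x : f =1 g -> prime_sum f x = prime_sum g x.
Proof. by move=> fg; rewrite /prime_sum; apply: eq_bigr => p _; rewrite fg. Qed.

Lemma sieved_prime_sum_cons eps r rs psi x :
  sieved_prime_sum eps (r :: rs) psi x = sieved_prime_sum eps rs psi x +
  (eps r)%:~R * sieved_prime_sum eps rs (fun p => psi p * legendre r p) x.
Proof.
rewrite /sieved_prime_sum /prime_sum big_distrr -big_split /=; apply: eq_bigr => p _.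
rewrite big_cons; set P := \prod_(_ <- _) _.
rewrite !(rmorphM, rmorphD) /= rmorph1; ring.
Qed.

(** Expanding the product gives [psi] times products of Legendre symbols. As the moduli are coprime,
    a unit with [psi] equal to -1 lifts to one where all these symbols are 1, so every term is
    nonprincipal. *)
Lemma sieved_prime_sum_bounded eps rs m psi :
  uniq rs -> (forall r, r \in rs -> [/\ prime r, (2 < r)%N & coprime m r]) ->
  (forall r, eps r \in [:: 0; 1; -1]) ->
  real_character m psi -> nonprincipal m psi ->
  exists C : R, exists y : nat, forall x, (y <= x)%N -> `|sieved_prime_sum eps rs psi x| <= C.
Proof.
move=> urs hrs heps; elim: rs m psi urs hrs => [|r rs IHrs] m psi.
  move=> _ _ C N; have B := character_partial_sums R C N; case: C => m0 c1 cM cp cv.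
  have [|||K [y H]] := @prime_sum_bounded R (fun n => (psi n)%:~R) _ _ _ _ B.
  - by rewrite c1.
  - by move=> a b; rewrite cM rmorphM.
  - by move=> a; move: (cv a); rewrite !inE => /or3P[] /eqP ->; rewrite ?mulrN1z eqxx ?orbT.
  exists K, y => x /H; congr (`|_| <= _); apply: prime_sum_ext => p.
  by rewrite big_nil mulr1.
move=> /= /andP[rrs urs] hrs C N.
have [pr r2 mr] := hrs r (mem_head _ _).
have hrs' s : s \in rs -> [/\ prime s, (2 < s)%N & coprime (m * r) s].
  move=> ss; have [ps s2 ms] : [/\ prime s, (2 < s)%N & coprime m s].
    by apply: hrs; rewrite inE ss orbT.
  split=> //; rewrite coprimeMl ms prime_coprime // dvdn_prime2 //.
  by apply: contraNneq rrs => ->.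
have [C1 [y1 H1]] := IHrs m psi urs (fun s ss => hrs s (mem_behead (s := r :: rs) ss)) C N.
have Cr := real_character_legendre pr r2.
have [a am pa] := N.
have N' : nonprincipal (m * r) (fun k => psi k * legendre r k).
  apply: (nonprincipal_mul C Cr mr am (coprime1n r)).
  by rewrite pa legendre1 // mulr1.
have [C2 [y2 H2]] := IHrs _ _ urs hrs' (real_character_mul C Cr) N'.
exists (C1 + C2), (maxn y1 y2) => x; rewrite geq_max => /andP[x1 x2].
rewrite sieved_prime_sum_cons; apply: le_trans (ler_normD _ _) _; apply: lerD; first exact: H1.
rewrite normrM; apply: le_trans (H2 x x2); rewrite ler_piMl //.
by move: (heps r); rewrite !inE => /or3P[] /eqP ->; rewrite ?mulrN1z ?normrN ?normr0 ?normr1.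
Qed.

(** Of the expanded product only the term 1 keeps a principal character and diverges; all the others
    are bounded by the previous lemma. *)
Lemma sieved_prime_sum_unbounded eps rs m psi :
  uniq rs -> (forall r, r \in rs -> [/\ prime r, (2 < r)%N & coprime m r]) ->
  (forall r, eps r \in [:: 0; 1; -1]) ->
  real_character m psi -> (forall a, coprime a m -> psi a = 1) ->
  forall C : R, exists y : nat, forall x, (y <= x)%N -> C <= sieved_prime_sum eps rs psi x.
Proof.
move=> urs hrs heps; elim: rs m psi urs hrs => [|r rs IHrs] m psi.
  move=> _ _ [m0 c1 cM cp cv] P C.
  (* Beyond [m] every prime is coprime to [m]; the primes up to [m] lower the sum by at most twice
     their full contribution. *)
  have [y H] := prime_sum1_unbounded (C + 2 * prime_sum (fun=> 1 : R) m).
  exists (maxn y m) => x; rewrite geq_max => /andP[xy mx].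
  have split_sum (f : nat -> R) : prime_sum f x = prime_sum f m +
      \sum_(m.+1 <= p < x.+1 | prime p) f p * ln p%:R / p%:R.
    by rewrite /prime_sum -big_cat_nat //=; lia.
  have := H x xy; rewrite /sieved_prime_sum !split_sum.
  have -> : \sum_(m.+1 <= p < x.+1 | prime p) (1 : R) * ln p%:R / p%:R =
     \sum_(m.+1 <= p < x.+1 | prime p)
       (psi p * \prod_(r <- [::]) (1 + eps r * legendre r p))%:~R * ln p%:R / p%:R.
    rewrite big_nat_cond [RHS]big_nat_cond; apply: eq_bigr => p /andP[/andP[mp _] pp].
    rewrite big_nil mulr1 P // prime_coprime //; apply/negP => /(dvdn_leq m0); lia.
  suff : - prime_sum (fun=> 1) m <= prime_sum
     (fun p => (psi p * \prod_(r <- [::]) (1 + eps r * legendre r p))%:~R) m :> R by lra.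
  rewrite /prime_sum -sumrN; apply: ler_sum => p _; rewrite big_nil mulr1 mul1r.
  have : 0 <= ln p%:R / p%:R :> R by rewrite divr_ge0 // ln_nat_ge0.
  rewrite -mulrA; move: (ln _ / _) => u u0.
  by move: (cv p); rewrite !inE => /or3P[] /eqP ->; rewrite ?mulrN1z ?mulr0z ?mulr1z; lra.
move=> /= /andP[rrs urs] hrs C P K.
have [pr r2 mr] := hrs r (mem_head _ _).
have hrs' s : s \in rs -> [/\ prime s, (2 < s)%N & coprime (m * r) s].
  move=> ss; have [ps s2 ms] : [/\ prime s, (2 < s)%N & coprime m s].
    by apply: hrs; rewrite inE ss orbT.
  split=> //; rewrite coprimeMl ms prime_coprime // dvdn_prime2 //.
  by apply: contraNneq rrs => ->.
have Cr := real_character_legendre pr r2.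
have N' : nonprincipal (m * r) (fun k => psi k * legendre r k).
  have [a ha] := legendre_nonresidue pr r2.
  apply: (nonprincipal_mul (a := 1) (b := a) C Cr mr (coprime1n m)).
    rewrite coprime_sym prime_coprime // -legendre_eq0 // ha //.
  by rewrite (character1 C) mul1r.
have [C2 [y2 H2]] := sieved_prime_sum_bounded urs hrs' heps (real_character_mul C Cr) N'.
have [y1 H1] := IHrs m psi urs (fun s ss => hrs s (mem_behead (s := r :: rs) ss)) C P (K + C2).
exists (maxn y1 y2) => x; rewrite geq_max => /andP[x1 x2].
rewrite sieved_prime_sum_cons; have := H1 x x1; have := H2 x x2.
rewrite ler_norml => /andP[h1 h2].
by move: (heps r); rewrite !inE => /or3P[] /eqP ->; rewrite ?mulrN1z ?mulr0z ?mulr1z; lra.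
Qed.

End PrimeExistence.

Definition mod8_character (t : seq int) (n : nat) : int := nth 0 t (n %% 8).

Lemma real_character_mod8 t :
  all (fun i => (nth 0 t i \in [:: 0; 1; -1]) &&
     all (fun j => nth 0 t ((i * j) %% 8) == nth 0 t i * nth 0 t j) (iota 0 8)) (iota 0 8) ->
  nth 0 t 1 = 1 -> real_character 8 (mod8_character t).
Proof.
move=> /allP H t1; have lt8 a : (a %% 8)%N \in iota 0 8 by rewrite mem_iota ltn_mod.
split=> //= [a b|a|a]; rewrite /mod8_character ?modn_mod //.
  by have /andP[_ /allP/(_ _ (lt8 b))/eqP <-] := H _ (lt8 a); rewrite modnMm.
by have /andP[] := H _ (lt8 a).
Qed.

Definition chi1 := mod8_character [:: 0; 1; 0; 1; 0; 1; 0; 1].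
(* The Kronecker symbols of discriminant -4, 8 and -8. *)
Definition chi_m4 := mod8_character [:: 0; 1; 0; -1; 0; 1; 0; -1].
Definition chi_8 := mod8_character [:: 0; 1; 0; -1; 0; -1; 0; 1].
Definition chi_m8 := mod8_character [:: 0; 1; 0; 1; 0; -1; 0; -1].

(** Dirichlet's argument with characters modulo 8 times Legendre symbols: the weighted sum over
    primes diverges, so the weight cannot vanish at all large primes. *)
Lemma prime_with_legendre (rs : seq nat) (eps : nat -> int) (c B : nat) :
  uniq rs -> (forall r, r \in rs -> prime r /\ (2 < r)%N) ->
  (forall r, eps r \in [:: 1; -1]) -> c \in [:: 1; 5]%N ->
  exists q, [/\ prime q, (B < q)%N, (q %% 8 = c)%N &
                forall r, r \in rs -> legendre r q = eps r].
Proof.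
move=> urs hrs heps hc; pose R : realType := Rdefinitions.R.
have heps0 r : eps r \in [:: 0; 1; -1] by rewrite inE heps orbT.
have hrs8 r : r \in rs -> [/\ prime r, (2 < r)%N & coprime 8 r].
  move=> /hrs[pr r2]; split=> //; rewrite (@coprime_pexpl 3 2) // prime_coprime //.
  by rewrite dvdn_prime2 //; lia.
pose e : int := if c == 1%N then 1 else -1.
pose F := sieved_prime_sum R eps rs.
have [C1 [y1 H1]] : exists C : R, exists y : nat, forall x, (y <= x)%N -> `|F chi_m4 x| <= C.
  apply: (sieved_prime_sum_bounded R urs hrs8 heps0); first exact: real_character_mod8.
  by exists 3%N.
have [C2 [y2 H2]] : exists C : R, exists y : nat, forall x, (y <= x)%N -> `|F chi_8 x| <= C.
  apply: (sieved_prime_sum_bounded R urs hrs8 heps0); first exact: real_character_mod8.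
  by exists 3%N.
have [C3 [y3 H3]] : exists C : R, exists y : nat, forall x, (y <= x)%N -> `|F chi_m8 x| <= C.
  apply: (sieved_prime_sum_bounded R urs hrs8 heps0); first exact: real_character_mod8.
  by exists 5%N.
(* The first factor is 4 times the indicator of the class [c] modulo 8; [e] is the value of [chi_8]
   and of [chi_m8] on that class. *)
pose W p : int := (chi1 p + chi_m4 p + e * chi_8 p + e * chi_m8 p) *
   \prod_(r <- rs) (1 + eps r * legendre r p).
have FW x : prime_sum (fun p => (W p)%:~R : R) x =
   F chi1 x + F chi_m4 x + e%:~R * F chi_8 x + e%:~R * F chi_m8 x.
  rewrite /F /sieved_prime_sum /prime_sum !big_distrr -!big_split /=.
  apply: eq_bigr => p _; rewrite /W; set P := \prod_(_ <- _) _.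
  rewrite !(rmorphM, rmorphD) /=; ring.
(* Beyond all r in [rs], so that [legendre r q] is not 0 and the factor at r decides the sign. *)
pose M := maxn B (\max_(r <- rs) r).
have chi1P a : coprime a 8 -> chi1 a = 1.
  rewrite -coprime_modl /chi1 /mod8_character; have : (a %% 8 < 8)%N by rewrite ltn_mod.
  by case: (a %% 8)%N => [|[|[|[|[|[|[|[|]]]]]]]].
have [y0 H0] := sieved_prime_sum_unbounded (R := R) urs hrs8 heps0
   (real_character_mod8 (t := [:: 0; 1; 0; 1; 0; 1; 0; 1]) isT erefl)
   chi1P (C1 + C2 + C3 + prime_sum (fun p => (W p)%:~R) M + 1).
pose x := maxn M (maxn y0 (maxn y1 (maxn y2 y3))).
have [q [pq Mq Wq]] : exists q, [/\ prime q, (M < q)%N & W q != 0].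
  have [/hasP[q]|] := boolP (has (fun q => prime q && (W q != 0)) (iota M.+1 (x - M))).
    by rewrite mem_iota => /andP[Mq _] /andP[pq Wq]; exists q.
  rewrite -all_predC => /allP al; exfalso.
  have E : prime_sum (fun p => (W p)%:~R : R) x = prime_sum (fun p => (W p)%:~R) M.
    have Mx : (M <= x)%N by rewrite /x leq_maxl.
    rewrite /prime_sum (@big_cat_nat _ _ _ M.+1) //= ?ltnS //.
    have -> : \sum_(M.+1 <= p < x.+1 | prime p) (W p)%:~R * ln p%:R / p%:R = 0 :> R.
      2: by rewrite addr0.
    rewrite big_nat_cond; apply: big1 => p /andP[hp pp].
    have := al p; rewrite mem_iota; have -> : (M < p < M.+1 + (x - M))%N by lia.
    by move=> /(_ isT) /=; rewrite pp /= negbK => /eqP ->; rewrite !mul0r.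
  have := FW x; rewrite E.
  have := H0 x; have := H1 x; have := H2 x; have := H3 x.
  have -> : (y0 <= x)%N by rewrite /x; lia.
  have -> : (y1 <= x)%N by rewrite /x; lia.
  have -> : (y2 <= x)%N by rewrite /x; lia.
  have -> : (y3 <= x)%N by rewrite /x; lia.
  move=> /(_ isT) h3 /(_ isT) h2 /(_ isT) h1 /(_ isT) h0.
  move: h1 h2 h3; rewrite !ler_norml => /andP[h1 h1'] /andP[h2 h2'] /andP[h3 h3'].
  rewrite -/(F chi1) in h0.
  by rewrite /e; case: eqP => _; rewrite ?mulrN1z ?mulr1z; lra.
have qr r : r \in rs -> (r < q)%N.
  move=> rr; apply: leq_ltn_trans Mq; rewrite /M.
  by rewrite leq_max; apply/orP; right; apply: (leq_bigmax_seq (P := xpredT) (F := id)).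
exists q; split=> //.
- by apply: leq_ltn_trans Mq; rewrite leq_maxl.
- move: Wq; rewrite /W mulf_eq0 negb_or => /andP[+ _].
  rewrite /chi1 /chi_m4 /chi_8 /chi_m8 /mod8_character /e.
  have : (q %% 8 < 8)%N by rewrite ltn_mod.
  move: hc; rewrite !inE => /orP[] /eqP -> /=.
    by case: (q %% 8)%N => [|[|[|[|[|[|[|[|]]]]]]]].
  by case: (q %% 8)%N => [|[|[|[|[|[|[|[|]]]]]]]].
move=> r rr; have [pr r2] := hrs r rr.
have : 1 + eps r * legendre r q != 0.
  move: Wq; rewrite /W mulf_eq0 negb_or => /andP[_ +].
  by rewrite (big_rem r) //= mulf_eq0 negb_or => /andP[].
have : legendre r q != 0 by rewrite legendre_eq0 // dvdn_prime2 // ltn_eqF // qr.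
move: (heps r) (legendre_vals r q); rewrite !inE.
by case/orP=> /eqP -> /or3P[] /eqP ->.
Qed.

(** * The three-square theorem *)

Local Open Scope nat_scope.

Lemma sqrt_floor m : exists a, a * a <= m < a.+1 * a.+1.
Proof.
elim: m => [|m [a /andP[h1 h2]]]; first by exists 0.
have [h|h] := ltnP m.+1 (a.+1 * a.+1); first by exists a; rewrite h andbT; lia.
by exists a.+1; apply/andP; split=> //; lia.
Qed.

Lemma pigeonhole (S T : finType) (g : S -> T) : #|T| < #|S| ->
  exists x y, x != y /\ g x = g y.
Proof.
move=> h; have /injectivePn[x [y xy gxy]] : ~~ injectiveb g.
  by apply/negP => /injectiveP/leq_card; rewrite leqNgt h.
by exists x, y.
Qed.

(** A box with sides sqrt (n Q), sqrt n and sqrt Q has volume n Q, the number of pairs of residues;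
    with the integer points counted from 0 it has strictly more of them. *)
Lemma pigeonhole_congruences n Q e f : 0 < n -> 0 < Q ->
  exists w z t w' z' t', [/\ ~ (w = w' /\ z = z' /\ t = t'),
    (w * w <= n * Q) && (w' * w' <= n * Q), (z * z <= n) && (z' * z' <= n),
    (t * t <= Q) && (t' * t' <= Q) &
    w + e * t = w' + e * t' %[mod Q] /\ w + f * z = w' + f * z' %[mod n]].
Proof.
move=> n0 Q0.
have [a /andP[a1 a2]] := sqrt_floor (n * Q).
have [b /andP[b1 b2]] := sqrt_floor n.
have [c /andP[c1 c2]] := sqrt_floor Q.
pose g (x : 'I_a.+1 * 'I_b.+1 * 'I_c.+1) : 'I_Q * 'I_n :=
  (Ordinal (ltn_pmod (x.1.1 + e * x.2) Q0), Ordinal (ltn_pmod (x.1.1 + f * x.1.2) n0)).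
have [|[[w z] t] [[[w' z'] t'] [ne /eqP]]] := @pigeonhole _ _ g.
  rewrite !card_prod !card_ord.
  (* Compare squares, since only the squares of the sides are known. *)
  rewrite -ltn_sqr -!mulnn.
  have -> : Q * n * (Q * n) = (n * Q) * (n * Q) by lia.
  have -> : a.+1 * b.+1 * c.+1 * (a.+1 * b.+1 * c.+1) =
     (a.+1 * a.+1) * ((b.+1 * b.+1) * (c.+1 * c.+1)) by lia.
  by apply: ltn_mul => //; apply: ltn_mul.
rewrite /g /= xpair_eqE -!val_eqE /= => /andP[/eqP E1 /eqP E2].
have le (i m k : nat) : i < m.+1 -> m * m <= k -> i * i <= k.
  by move=> h1 h2; apply: leq_trans h2; apply: leq_mul.
exists w, z, t, w', z', t'; split=> //.
- move=> [ew [ez et]]; case/eqP: ne.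
  by rewrite (val_inj ew : w = w') (val_inj ez : z = z') (val_inj et : t = t').
- by rewrite (le _ _ _ (ltn_ord w) a1) (le _ _ _ (ltn_ord w') a1).
- by rewrite (le _ _ _ (ltn_ord z) b1) (le _ _ _ (ltn_ord z') b1).
- by rewrite (le _ _ _ (ltn_ord t) c1) (le _ _ _ (ltn_ord t') c1).
Qed.

Lemma modn_eq_Z x y d : x = y %[mod d] ->
  exists u : Z, (Z.of_nat x - Z.of_nat y = Z.of_nat d * u)%Z.
Proof.
move=> h; exists (Z.of_nat (x %/ d) - Z.of_nat (y %/ d))%Z.
have := divn_eq x d; have := divn_eq y d; rewrite h; lia.
Qed.

Lemma square_abs_nat (s : Z) : (s * s = Z.of_nat (Z.abs_nat s * Z.abs_nat s))%Z.
Proof. by rewrite Nat2Z.inj_mul Zabs2Nat.id_abs Z.abs_square. Qed.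

Lemma three_squares_of_residues n Q e f a b : 0 < n -> 0 < Q -> coprime n Q ->
  (forall s, s * s <> Q) -> (forall s, s * s <> n * Q) ->
  e * e = n %[mod Q] -> n %| f * f + Q -> Q = a * a + b * b ->
  three_squares (Z.of_nat n).
Proof.
move=> n0 Q0 cnQ nsQ nsnQ he /dvdnP[f1 hf] hQ.
have [w [z [t [w' [z' [t' [ne /andP[bw bw'] /andP[bz bz'] /andP[bt bt'] [E1 E2]]]]]]]] :=
  pigeonhole_congruences e f n0 Q0.
have [u hu] := modn_eq_Z E1; have [v hv] := modn_eq_Z E2; have [e1 he1] := modn_eq_Z he.
have /coprimeP-/(_ n0)[[al be] /= hab] := cnQ.
apply: (@three_squares_of_congruences (Z.of_nat n) (Z.of_nat Q) (Z.of_nat e) (Z.of_nat f)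
  e1 (Z.of_nat f1) (Z.of_nat al) (- Z.of_nat be) (Z.of_nat a) (Z.of_nat b)
  (Z.of_nat w - Z.of_nat w') (Z.of_nat z - Z.of_nat z') (Z.of_nat t - Z.of_nat t') u v).
- by clear -n0; lia.
- by clear -Q0; lia.
- by move=> s; rewrite square_abs_nat => /Nat2Z.inj; apply: nsQ.
- by move=> s; rewrite square_abs_nat -Nat2Z.inj_mul => /Nat2Z.inj; apply: nsnQ.
- by clear -hab; lia.
- by clear -he1; lia.
- by clear -hf; lia.
- by clear -hQ; lia.
- by clear -hu; lia.
- by clear -hv; lia.
- by apply: square_sub_le; [clear; lia | clear; lia | clear -bw; lia | clear -bw'; lia].
- by apply: square_sub_le; [clear; lia | clear; lia | clear -bz; lia | clear -bz'; lia].
- by apply: square_sub_le; [clear; lia | clear; lia | clear -bt; lia | clear -bt'; lia].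
- by clear -ne; move=> [h1 [h2 h3]]; apply: ne; lia.
Qed.

(** Thue's argument: with e^2 = -1 mod q, the pigeonhole gives small X, Y with X = - e Y mod q, and
    X^2 + Y^2 is a multiple of q strictly between 0 and 2 q. *)
Lemma two_squares q : prime q -> q %% 4 = 1 -> exists a b, q = a * a + b * b.
Proof.
move=> pq q4; have q2 : 2 < q by have := prime_gt1 pq; case: (q) q4 => [|[|[|]]].
have q0 := prime_gt0 pq.
have [e he] : exists e, e * e = q.-1 %[mod q].
  by apply: legendre_square => //; rewrite legendre_neg1_mod4 // q4.
have [s /andP[s1 s2]] := sqrt_floor q.
have nsq : s * s != q.
  apply/eqP => E; have : s %| q by rewrite -E dvdn_mulr.
  case/primeP: pq => q1 /[apply] /orP[] /eqP h; rewrite h in E.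
    by rewrite -E in q1.
  have : q * 1 < q * q by rewrite ltn_pmul2l.
  by rewrite E muln1 ltnn.
pose g (x : 'I_s.+1 * 'I_s.+1) : 'I_q := Ordinal (ltn_pmod (x.1 + e * x.2) q0).
have [|[x y] [[x' y'] [ne /eqP]]] := @pigeonhole _ _ g.
  by rewrite card_prod !card_ord.
rewrite /g -val_eqE /= => /eqP E.
have [u hu] := modn_eq_Z E; have [e1 he1] := modn_eq_Z he.
have hx := ltn_ord x; have hy := ltn_ord y; have hx' := ltn_ord x'; have hy' := ltn_ord y'.
pose X := (Z.of_nat x - Z.of_nat x')%Z; pose Y := (Z.of_nat y - Z.of_nat y')%Z.
have bd (i j : nat) : i < s.+1 -> j < s.+1 ->
    ((Z.of_nat i - Z.of_nat j) * (Z.of_nat i - Z.of_nat j) < Z.of_nat q)%Z.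
  move=> hi hj; have h3 : s * s < q by rewrite ltn_neqAle nsq.
  have h1 : i * i <= s * s by apply: leq_mul.
  have h2 : j * j <= s * s by apply: leq_mul.
  have := @square_sub_le (Z.of_nat i) (Z.of_nat j) (Z.of_nat (s * s)).
  by clear -h1 h2 h3; lia.
have BX : (X * X < Z.of_nat q)%Z := bd x x' hx hx'.
have BY : (Y * Y < Z.of_nat q)%Z := bd y y' hy hy'.
have E1 : (Z.of_nat e * Z.of_nat e = Z.of_nat q * (e1 + 1) - 1)%Z by clear -he1 q0; lia.
have hX : (X + Z.of_nat e * Y = Z.of_nat q * u)%Z by rewrite /X /Y; clear -hu; lia.
have XY0 : ~ (X = 0 /\ Y = 0)%Z.
  move=> [hx0 hy0]; case/eqP: ne.
  have ex : x = x' by apply: val_inj => /=; rewrite /X in hx0; clear -hx0; lia.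
  have ey : y = y' by apply: val_inj => /=; rewrite /Y in hy0; clear -hy0; lia.
  by rewrite ex ey.
move: X Y BX BY hX XY0 => X Y BX BY hX XY0.
have D : (X * X + Y * Y = Z.of_nat q * (u * (X - Z.of_nat e * Y) + (e1 + 1) * (Y * Y)))%Z.
  have -> : (X * X + Y * Y = (X + Z.of_nat e * Y) * (X - Z.of_nat e * Y)
     + (Z.of_nat e * Z.of_nat e + 1) * (Y * Y))%Z by ring.
  by rewrite hX E1; ring.
exists (Z.abs_nat X), (Z.abs_nat Y); apply: Nat2Z.inj.
rewrite Nat2Z.inj_add -!square_abs_nat.
have := sum_squares_pos _ _ XY0; move: D; move: (u * _ + _)%Z => k D pos.
have : (k = 1)%Z by apply: (@multiplier_eq1 (Z.of_nat q)); clear -q0 BX BY D pos; lia.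
by move=> hk; rewrite hk in D; clear -D; lia.
Qed.

(** The squarefree case comes as a list of distinct primes, as the Chinese remainder theorem and the
    products of symbols want it. *)
Lemma squarefree_or_square n : 0 < n ->
  (exists p, prime p /\ p * p %| n) \/
  (exists rs, [/\ uniq rs, all prime rs & n = \prod_(r <- rs) r]).
Proof.
elim/ltn_ind: n => n IHn n0; have [n1|n1] := leqP n 1.
  by right; exists [::]; split=> //; rewrite big_nil; lia.
have pp := pdiv_prime n1; have /dvdnP[m nE] := pdiv_dvd n; set p := pdiv n in pp nE.
have m0 : 0 < m by move: n0; rewrite nE; case: (m).
have mn : m < n by rewrite nE ltn_Pmulr // prime_gt1.
have [pm|pm] := boolP (p %| m).
  by left; exists p; split=> //; rewrite nE dvdn_mul.
have [[r [pr rm]]|[rs [urs prs mE]]] := IHn m mn m0.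
  by left; exists r; split=> //; rewrite nE dvdn_mulr.
right; exists (p :: rs); split; rewrite /= ?pp ?urs ?andbT //; last by rewrite big_cons -mE mulnC.
by apply: contra pm => prs'; rewrite mE (big_rem p) //= dvdn_mulr.
Qed.

Lemma square_root_crt Q rs : uniq rs -> all prime rs ->
  (forall r, r \in rs -> exists f, r %| f * f + Q) ->
  exists f, \prod_(r <- rs) r %| f * f + Q.
Proof.
elim: rs => [|r rs IHrs] /=; first by exists 0; rewrite big_nil dvd1n.
case/andP=> rrs urs /andP[pr prs] H.
have [|f hf] := IHrs urs prs; first by move=> s ss; apply: H; rewrite inE ss orbT.
have [g hg] := H r (mem_head _ _).
have cop : coprime r (\prod_(s <- rs) s).
  rewrite prime_coprime //; apply: contra rrs.
  elim: rs prs {IHrs urs H hf} => [|s t IHt] /=; first by rewrite big_nil dvdn1 => _ /eqP E; rewrite E in pr.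
  case/andP=> ps pt; rewrite big_cons Euclid_dvdM // inE => /orP[].
    by rewrite dvdn_prime2 // => ->.
  by move=> h; rewrite (IHt pt h) orbT.
exists (chinese r (\prod_(s <- rs) s) g f).
rewrite big_cons Gauss_dvd //; set c := chinese _ _ _ _.
have c1 : c = g %[mod r] by rewrite chinese_modl.
have c2 : c = f %[mod \prod_(s <- rs) s] by rewrite chinese_modr.
apply/andP; split.
  by rewrite /dvdn -modnDml -modnMm c1 modnMm modnDml.
by rewrite /dvdn -modnDml -modnMm c2 modnMm modnDml.
Qed.

(** In natural numbers [r.-1] stands for -1 modulo r. *)
Lemma square_root_of_neg r Q : prime r -> 2 < r ->
  (legendre r r.-1 * legendre r Q = 1)%R -> exists f, r %| f * f + Q.
Proof.
move=> pr r2; rewrite -legendreM // => /(legendre_square pr r2)[f hf].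
exists f; rewrite /dvdn -modnDml hf modnDml addnC -mulSn prednK ?(prime_gt0 pr) //.
by rewrite modnMr.
Qed.

Lemma legendre_prod (r : nat) (s : seq nat) : prime r -> 2 < r ->
  legendre r (\prod_(a <- s) a) = (\prod_(a <- s) legendre r a)%R.
Proof.
move=> pr r2; elim: s => [|a s IHs]; first by rewrite !big_nil legendre1.
by rewrite !big_cons legendreM // IHs.
Qed.

Lemma character_prod m chi (s : seq nat) : real_character m chi ->
  chi (\prod_(a <- s) a) = (\prod_(a <- s) chi a)%R.
Proof.
move=> C; elim: s => [|a s IHs]; first by rewrite !big_nil (character1 C).
by rewrite !big_cons (characterM C) IHs.
Qed.

Lemma real_character_m4 : real_character 8 chi_m4.
Proof. exact: real_character_mod8. Qed.

Lemma real_character_m8 : real_character 8 chi_m8.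
Proof. exact: real_character_mod8. Qed.

Lemma legendre_neg1_chi r : prime r -> 2 < r -> legendre r r.-1 = chi_m4 r.
Proof.
move=> pr r2; rewrite legendre_neg1_mod4 // /chi_m4 /mod8_character.
have -> : r %% 4 = (r %% 8) %% 4 by rewrite modn_dvdm.
have : odd (r %% 8) by have := odd_half_prime pr r2; lia.
have : r %% 8 < 8 by rewrite ltn_mod.
by case: (r %% 8) => [|[|[|[|[|[|[|[|]]]]]]]].
Qed.

Lemma legendre_neg2_chi r : prime r -> 2 < r ->
  (legendre r r.-1 * legendre r 2)%R = chi_m8 r.
Proof.
move=> pr r2; rewrite legendre_neg1_chi // legendre2_mod8 //.
rewrite /chi_m4 /chi_m8 /mod8_character.
have : odd (r %% 8) by have := odd_half_prime pr r2; lia.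
have : r %% 8 < 8 by rewrite ltn_mod.
by case: (r %% 8) => [|[|[|[|[|[|[|[|]]]]]]]].
Qed.

(** The exponent of q in m q is 1, in a square it is even. *)
Lemma nonsquare_prime_mul q m s : prime q -> ~~ (q %| m) -> s * s <> m * q.
Proof.
move=> pq qm E; have m0 : 0 < m by case: (m) qm => //; rewrite dvdn0.
have q0 := prime_gt0 pq.
have s0 : 0 < s by case: (s) E => //; lia.
have := congr1 (logn q) E; rewrite !lognM // (logn_prime q pq) eqxx.
rewrite (lognE q m) pq m0 (negbTE qm) /=; clear; lia.
Qed.

Lemma two_squares_double q a b : q = a * a + b * b -> exists c d, 2 * q = c * c + d * d.
Proof.
move=> ->; have [ab|/ltnW ab] := leqP a b.
  have [d ->] : exists d, b = a + d by exists (b - a); lia.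
  by exists (a + a + d), d; lia.
have [d ->] : exists d, a = b + d by exists (a - b); lia.
by exists (b + b + d), d; lia.
Qed.

(** * Squarefree numbers as sums of three squares *)

Section Squarefree.
Variable rs : seq nat.
Hypotheses (urs : uniq rs) (prs : all prime rs) (ors : all odd rs).
Let n := \prod_(r <- rs) r.

Let rsP r : r \in rs -> prime r /\ 2 < r.
Proof.
move=> rr; have pr := allP prs r rr; split=> //.
by have := allP ors r rr; have := prime_gt1 pr; case: (r) => [|[|[|]]].
Qed.

Let n0 : 0 < n.
Proof. by rewrite /n big_seq prodn_cond_gt0 // => r /rsP[/prime_gt0]. Qed.

Let chi_sign chi r : real_character 8 chi -> (r \in rs -> chi r != 0)%R ->
  (if r \in rs then chi r else 1)%R \in [:: 1; -1]%R.
Proof.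
move=> C; case: ifP => // rr /(_ isT) nz.
by have := character_vals C r; rewrite inE (negbTE nz).
Qed.

Let chi_odd chi r : chi = chi_m4 \/ chi = chi_m8 -> r \in rs -> (chi r != 0)%R.
Proof.
move=> h rr; have : odd (r %% 8) by have := allP ors r rr; lia.
have : r %% 8 < 8 by rewrite ltn_mod.
case: h => ->; rewrite /chi_m4 /chi_m8 /mod8_character;
by case: (r %% 8) => [|[|[|[|[|[|[|[|]]]]]]]].
Qed.

(** The values (q/r) = chi(r) are prescribed at each prime r of n; as q = 1 mod 4, they equal (r/q),
    and multiplicativity yields (n/q) = chi(n). *)
Lemma prime_with_character chi c (B : nat) : chi = chi_m4 \/ chi = chi_m8 -> c \in [:: 1; 5] ->
  exists q, [/\ prime q, B < q, q %% 8 = c, q %% 4 = 1 &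
     [/\ ~~ (q %| n), forall r, r \in rs -> legendre r q = chi r &
     legendre q n = chi n]].
Proof.
move=> hchi hc; have C : real_character 8 chi.
  by case: hchi => ->; [exact: real_character_m4 | exact: real_character_m8].
have hrs (r : nat) : r \in rs -> prime r /\ 2 < r by exact: rsP.
have [q [pq Bq qc qr]] := prime_with_legendre (eps := fun r => if r \in rs then chi r else 1%R)
   (maxn n B) urs hrs (fun r => chi_sign C (chi_odd hchi)) hc.
have q4 : q %% 4 = 1.
  have -> : q %% 4 = (q %% 8) %% 4 by rewrite modn_dvdm.
  by rewrite qc; move: hc; rewrite !inE => /orP[] /eqP ->.
exists q; split=> //; first by apply: leq_ltn_trans Bq; rewrite leq_maxr.
have q2 : 2 < q by have := prime_gt1 pq; case: (q) q4 => [|[|[|]]].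
have qr' r : r \in rs -> legendre r q = chi r by move=> rr; rewrite qr // rr.
split=> //.
  apply/negP => /(dvdn_leq n0); have : n < q by apply: leq_ltn_trans Bq; rewrite leq_maxl.
  by case: ltnP.
rewrite /n (character_prod rs C) legendre_prod //.
rewrite !big_seq; apply: eq_bigr => r rr; have [pr r2] := rsP rr.
(* The case r = q is impossible: [legendre r r] is 0, while chi is nonzero at odd r. *)
rewrite (legendre_sym pr pq r2) ?qr' //; apply/eqP => e; move: (qr' r rr).
rewrite -{1}e => h; have := legendre_eq0 pr r2 r; rewrite h dvdnn => /eqP z.
by have := chi_odd hchi rr; rewrite z.
Qed.

Lemma three_squares_squarefree_1mod4 : n %% 4 = 1 -> three_squares (Z.of_nat n).
Proof.
move=> n4.
have [q [pq nq q8 q4 [qn qr ql]]] :=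
  prime_with_character n (or_introl (erefl chi_m4)) (mem_head 1 [:: 5]).
have q2 : 2 < q by have := prime_gt1 pq; case: (q) q4 => [|[|[|]]].
have {}ql : (legendre q n = 1)%R.
  rewrite ql /chi_m4 /mod8_character.
  have : n %% 8 = 1 \/ n %% 8 = 5 by lia.
  by case=> ->.
have [e he] := legendre_square pq q2 ql.
have [f hf] : exists f, n %| f * f + q.
  apply: square_root_crt => // r rr; have [pr r2] := rsP rr.
  apply: square_root_of_neg => //; rewrite legendre_neg1_chi // qr //.
  by have := chi_odd (or_introl erefl) rr; have := character_vals real_character_m4 r;
    rewrite !inE => /or3P[] /eqP ->.
have [a [b hab]] := two_squares pq q4.
apply: (@three_squares_of_residues n q e f a b) => //.
- exact: prime_gt0.
- by rewrite coprime_sym prime_coprime.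
- by move=> s; rewrite -[q]mul1n; apply: nonsquare_prime_mul => //; rewrite dvdn1; lia.
- by move=> s; apply: nonsquare_prime_mul.
Qed.

Lemma three_squares_squarefree_3mod8 : n %% 8 = 3 -> three_squares (Z.of_nat n).
Proof.
move=> n8.
have [q [pq nq q8 q4 [qn qr ql]]] :=
  prime_with_character n (or_intror (erefl chi_m8)) (mem_head 1 [:: 5]).
have q2 : 2 < q by have := prime_gt1 pq; case: (q) q4 => [|[|[|]]].
have {}ql : (legendre q n = 1)%R by rewrite ql /chi_m8 /mod8_character n8.
have oq : odd q by lia.
have on : odd n by lia.
(* The modulus is 2 q and n is odd, so the root modulo q has to be odd; add q if it is not. *)
have [e [oe he]] : exists e, odd e /\ e * e = n %[mod q].
  have [e he] := legendre_square pq q2 ql; have [oe|oe] := boolP (odd e); first by exists e.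
  exists (e + q); split; first by rewrite oddD oq (negbTE oe).
  by rewrite -modnMm modnDr modnMm.
have [f hf] : exists f, n %| f * f + 2 * q.
  apply: square_root_crt => // r rr; have [pr r2] := rsP rr.
  apply: square_root_of_neg => //; rewrite legendreM // mulrA legendre_neg2_chi // qr //.
  by have := chi_odd (or_intror erefl) rr; have := character_vals real_character_m8 r;
    rewrite !inE => /or3P[] /eqP ->.
have [a0 [b0 hab0]] := two_squares pq q4; have [a [b hab]] := two_squares_double hab0.
have q2n m : ~~ (q %| m) -> ~~ (q %| 2 * m).
  move=> qm; rewrite Euclid_dvdM // negb_or qm andbT; apply/negP => /dvdn_leq; lia.
have cq2 : coprime 2 q by rewrite coprime2n.
apply: (@three_squares_of_residues n (2 * q) e f a b) => //.
- lia.
- by rewrite coprimeMr coprime_sym coprime2n on coprime_sym prime_coprime.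
- by move=> s; apply: nonsquare_prime_mul => //; apply/negP => /dvdn_leq; lia.
- by move=> s; rewrite mulnCA mulnA; apply: nonsquare_prime_mul => //; apply: q2n.
- apply/eqP; rewrite chinese_remainder // he eqxx andbT.
  by rewrite !modn2 oddM oe on.
Qed.

Lemma three_squares_squarefree_double : three_squares (Z.of_nat (2 * n)).
Proof.
have on : odd n.
  rewrite /n; elim: rs ors => [|r s IHs] /=; first by rewrite big_nil.
  by case/andP=> or os; rewrite big_cons oddM or IHs.
(* The class of q modulo 8 fixes (2/q) to be [chi_m4 n], which makes (2n/q) = 1. *)
pose c := if (n %% 4 == 1) then 1 else 5.
have hc : c \in [:: 1; 5] by rewrite /c; case: ifP.
have [q [pq nq q8 q4 [qn qr ql]]] := prime_with_character n (or_introl (erefl chi_m4)) hc.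
have q2 : 2 < q by have := prime_gt1 pq; case: (q) q4 => [|[|[|]]].
have {}ql : (legendre q (2 * n) = 1)%R.
  rewrite legendreM // ql legendre2_mod8 // q8 /c /chi_m4 /mod8_character.
  have -> : n %% 4 = (n %% 8) %% 4 by rewrite modn_dvdm.
  have : odd (n %% 8) by lia.
  have : n %% 8 < 8 by rewrite ltn_mod.
  by case: (n %% 8) => [|[|[|[|[|[|[|[|]]]]]]]].
have oq : odd q by lia.
have [e he] := legendre_square pq q2 ql.
have [f hf] : exists f, 2 * n %| f * f + q.
  have [f hf] : exists f, n %| f * f + q.
    apply: square_root_crt => // r rr; have [pr r2] := rsP rr.
    apply: square_root_of_neg => //; rewrite legendre_neg1_chi // qr //.
    by have := chi_odd (or_introl erefl) rr; have := character_vals real_character_m4 r;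
      rewrite !inE => /or3P[] /eqP ->.
  have c2n : coprime 2 n by rewrite coprime2n.
  have [of1|of1] := boolP (odd f).
    by exists f; rewrite Gauss_dvd // hf andbT dvdn2 oddD oddM of1 oq.
  (* As q is odd, 2 divides f^2 + q only for odd f; adding the odd n changes the parity. *)
  exists (f + n); rewrite Gauss_dvd // dvdn2 oddD oddM oddD (negbTE of1) on oq /=.
  have -> : (f + n) * (f + n) + q = (f * f + q) + (2 * f + n) * n by lia.
  by rewrite dvdn_addr // dvdn_mull.
have [a [b hab]] := two_squares pq q4.
have q2n : ~~ (q %| 2 * n).
  rewrite Euclid_dvdM // negb_or qn andbT; apply/negP => /dvdn_leq; lia.
apply: (@three_squares_of_residues (2 * n) q e f a b) => //.
- lia.
- exact: prime_gt0.
- by rewrite coprime_sym prime_coprime.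
- by move=> s; rewrite -[q]mul1n; apply: nonsquare_prime_mul => //; rewrite dvdn1; lia.
- by move=> s; apply: nonsquare_prime_mul.
Qed.

End Squarefree.

(** A prime whose square divides n is odd because 4 does not divide n, and p^2 = 1 mod 8 keeps the
    residue class when p^2 is divided out. *)
Lemma three_squares_nat n : n %% 4 = 1 \/ n %% 4 = 2 \/ n %% 8 = 3 ->
  three_squares (Z.of_nat n).
Proof.
elim/ltn_ind: n => n IHn hn; have n0 : 0 < n by lia.
case: (squarefree_or_square n0) => [[p [pp /dvdnP[m nE]]]|[rs [urs prs nE]]].
  have op : odd p.
    have [p2|//] := even_prime pp; move: hn nE; rewrite p2; lia.
  have p8 : (p * p) %% 8 = 1.
    rewrite -modnMm; have : odd (p %% 8) by lia.
    have : p %% 8 < 8 by rewrite ltn_mod.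
    by case: (p %% 8) => [|[|[|[|[|[|[|[|]]]]]]]].
  have m8 : n %% 8 = m %% 8 by rewrite nE -modnMmr p8 muln1.
  have -> : (Z.of_nat n = Z.of_nat p * Z.of_nat p * Z.of_nat m)%Z by rewrite nE; lia.
  apply: three_squares_scale; apply: IHn; last by clear -hn m8; lia.
  rewrite nE -{1}[m]muln1 ltn_pmul2l; last by case: (m) nE n0 => // ->.
  have := prime_gt1 pp; clear; case: p => [|[|p]] // _; by [].
have [o2|o2] := boolP (2 \in rs); last first.
  have ors : all odd rs.
    apply/allP => r rr; have [r2|//] := even_prime (allP prs r rr).
    by move: o2; rewrite -r2 rr.
  case: hn => [h|[h|h]]; rewrite nE in h *.
  - exact: three_squares_squarefree_1mod4.
  - exfalso; have : odd (\prod_(r <- rs) r).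
      elim: (rs) ors => [|r s IHs] /=; first by rewrite big_nil.
      by case/andP=> or os; rewrite big_cons oddM or IHs.
    by move: h; clear; lia.
  - exact: three_squares_squarefree_3mod8.
rewrite nE (big_rem 2) //=; apply: three_squares_squarefree_double.
- exact: rem_uniq.
- by apply/allP => r /mem_rem /(allP prs).
- apply/allP => r; rewrite mem_rem_uniq // inE => /andP[r2 rr].
  by have [e|//] := even_prime (allP prs r rr); rewrite e eqxx in r2.
Qed.

Lemma Z_of_modn k d : 0 < d -> Z.of_nat (k %% d) = (Z.of_nat k mod Z.of_nat d)%Z.
Proof.
move=> d0; have kE := divn_eq k d; have kd : k %% d < d by rewrite ltn_mod.
apply: (Z.mod_unique _ _ (Z.of_nat (k %/ d))); first by left; clear -kd; lia.
by rewrite {1}kE; clear; lia.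
Qed.

Lemma three_squares_mod (n : Z) : (0 <= n)%Z ->
  (n mod 4 = 1 \/ n mod 4 = 2 \/ n mod 8 = 3)%Z -> three_squares n.
Proof.
move=> n0; rewrite -(Z2Nat.id n n0); move: (Z.to_nat n) => k h.
have E4 := @Z_of_modn k 4 isT; have E8 := @Z_of_modn k 8 isT.
apply: three_squares_nat; rewrite -E4 -E8 in h; clear -h.
move: (k %% 4) (k %% 8) h => i j; lia.
Qed.

Arguments three_squares_mod : clear implicits.
End ThreeSquares.

(** * Sums with terms prime to three *)

(** If 3 divided both c + d and c - d it would divide c and d. *)
Lemma cancel_three (c d : Z) : c mod 3 <> 0 \/ d mod 3 <> 0 ->
  exists s, (s = 1 \/ s = -1) /\ (c + s * d) mod 3 <> 0.
Proof.
intros H. destruct (Z.eq_dec ((c + 1 * d) mod 3) 0).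
- exists (-1). split; [now right|]. Z.div_mod_to_equations. lia.
- exists 1. split; [now left|assumption].
Qed.

Lemma multiple_of_three (c : Z) : c mod 3 = 0 -> exists c1, c = 3 * c1.
Proof. intros H. exists (c / 3). Z.div_mod_to_equations. lia. Qed.

(* Multiplication by the unit (-1 + 2 sqrt(-2)) / 3 or its conjugate preserves
   c^2 + 2 d^2 and clears one common factor 3. *)
Lemma norm2_prime_to_three (c d : Z) :
  ~ (c = 0 /\ d = 0) -> c mod 3 = 0 -> d mod 3 = 0 ->
  exists u v, u * u + 2 * (v * v) = c * c + 2 * (d * d) /\
    u mod 3 <> 0 /\ v mod 3 <> 0 /\ u mod 2 = c mod 2 /\ v mod 2 = d mod 2.
Proof.
enough (H : forall k c d, 0 <= k -> Z.abs c + Z.abs d <= k -> ~ (c = 0 /\ d = 0) ->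
  c mod 3 = 0 -> d mod 3 = 0 ->
  exists u v, u * u + 2 * (v * v) = c * c + 2 * (d * d) /\
    u mod 3 <> 0 /\ v mod 3 <> 0 /\ u mod 2 = c mod 2 /\ v mod 2 = d mod 2).
{ intros H0 H1 H2. apply (H (Z.abs c + Z.abs d)); auto; lia. }
clear c d. intros k c d Hk. revert k Hk c d.
refine (natlike_ind _ _ _); [intros; lia|].
intros k Hk IH c d Hcd Hnz Hc Hd.
destruct (multiple_of_three c Hc) as [c1 ->]. destruct (multiple_of_three d Hd) as [d1 ->].
assert (Hw : exists c2 d2, c2 * c2 + 2 * (d2 * d2) = c1 * c1 + 2 * (d1 * d1) /\
  (c2 mod 3 <> 0 \/ d2 mod 3 <> 0) /\ c2 mod 2 = c1 mod 2 /\ d2 mod 2 = d1 mod 2).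
{ destruct (Z.eq_dec (c1 mod 3) 0) as [E1|E1]; [destruct (Z.eq_dec (d1 mod 3) 0) as [E2|E2]|].
  - destruct (IH c1 d1) as (u & v & H1 & H2 & H3 & H4 & H5); [lia..|].
    exists u, v. auto.
  - exists c1, d1. auto.
  - exists c1, d1. auto. }
destruct Hw as (c2 & d2 & E & Hnd & P1 & P2).
destruct (cancel_three c2 d2 Hnd) as (s & Hs & Hsd).
(* Both are c2 + s d2 modulo 3 up to sign; the choice of [s] is the choice between the unit and its
   conjugate. *)
exists (c2 + 4 * (s * d2)), (2 * c2 - s * d2).
assert (Es : s * s = 1) by (destruct Hs; subst; reflexivity).
assert (Ps : (s * d2) mod 2 = d2 mod 2)
  by (destruct Hs; subst s; clear; Z.div_mod_to_equations; lia).
split.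
- replace ((c2 + 4 * (s * d2)) * (c2 + 4 * (s * d2)) + 2 * ((2 * c2 - s * d2) * (2 * c2 - s * d2)))
    with (9 * (c2 * c2) + 18 * (s * s * (d2 * d2))) by ring.
  rewrite Es. lia.
- clear - Hsd Ps P1 P2. revert Hsd Ps. generalize (s * d2). intros e Hsd Ps.
  repeat split; Z.div_mod_to_equations; lia.
Qed.

(** Multiplication by 1 + sqrt(-2), of norm 3, or by its conjugate; both components are then c + d
    or c - d modulo 3. *)
Lemma norm2_triple (c d : Z) : ~ (c = 0 /\ d = 0) ->
  exists u v, u * u + 2 * (v * v) = 3 * (c * c + 2 * (d * d)) /\
    u mod 3 <> 0 /\ v mod 3 <> 0 /\ u mod 2 = c mod 2 /\ v mod 2 = (c + d) mod 2.
Proof.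
intros Hnz.
assert (Hw : exists c2 d2, c2 * c2 + 2 * (d2 * d2) = c * c + 2 * (d * d) /\
  (c2 mod 3 <> 0 \/ d2 mod 3 <> 0) /\ c2 mod 2 = c mod 2 /\ d2 mod 2 = d mod 2).
{ destruct (Z.eq_dec (c mod 3) 0) as [E1|E1]; [destruct (Z.eq_dec (d mod 3) 0) as [E2|E2]|].
  - destruct (norm2_prime_to_three c d Hnz E1 E2) as (u & v & H1 & H2 & H3 & H4 & H5).
    exists u, v. auto.
  - exists c, d. auto.
  - exists c, d. auto. }
destruct Hw as (c2 & d2 & E & Hnd & P1 & P2).
destruct (cancel_three c2 d2 Hnd) as (s & Hs & Hsd).
exists (c2 - 2 * (s * d2)), (c2 + s * d2).
assert (Es : s * s = 1) by (destruct Hs; subst; reflexivity).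
assert (Ps : (s * d2) mod 2 = d2 mod 2)
  by (destruct Hs; subst s; clear; Z.div_mod_to_equations; lia).
split.
- replace ((c2 - 2 * (s * d2)) * (c2 - 2 * (s * d2)) + 2 * ((c2 + s * d2) * (c2 + s * d2)))
    with (3 * (c2 * c2) + 6 * (s * s * (d2 * d2))) by ring.
  rewrite Es. lia.
- clear - Hsd Ps P1 P2. revert Hsd Ps. generalize (s * d2). intros e Hsd Ps.
  repeat split; Z.div_mod_to_equations; lia.
Qed.

(* The matrix (3 I - 2 J) / 3, with J the all-ones matrix, is orthogonal. *)
Lemma three_squares_prime_to_three (a b c : Z) :
  ~ (a = 0 /\ b = 0 /\ c = 0) -> a mod 3 = 0 -> b mod 3 = 0 -> c mod 3 = 0 ->
  exists x y z, x * x + y * y + z * z = a * a + b * b + c * c /\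
    (x mod 3 <> 0 /\ y mod 3 <> 0 /\ z mod 3 <> 0) /\
    x mod 2 = a mod 2 /\ y mod 2 = b mod 2 /\ z mod 2 = c mod 2.
Proof.
enough (H : forall k a b c, 0 <= k -> Z.abs a + Z.abs b + Z.abs c <= k ->
  ~ (a = 0 /\ b = 0 /\ c = 0) -> a mod 3 = 0 -> b mod 3 = 0 -> c mod 3 = 0 ->
  exists x y z, x * x + y * y + z * z = a * a + b * b + c * c /\
    (x mod 3 <> 0 /\ y mod 3 <> 0 /\ z mod 3 <> 0) /\
    x mod 2 = a mod 2 /\ y mod 2 = b mod 2 /\ z mod 2 = c mod 2).
{ intros H0 H1 H2 H3. apply (H (Z.abs a + Z.abs b + Z.abs c)); auto; lia. }
clear a b c. intros k a b c Hk. revert k Hk a b c.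
refine (natlike_ind _ _ _); [intros; lia|].
intros k Hk IH a b c Habc Hnz Ha Hb Hc.
destruct (multiple_of_three a Ha) as [a1 ->]. destruct (multiple_of_three b Hb) as [b1 ->].
destruct (multiple_of_three c Hc) as [c1 ->].
assert (Hw : exists a2 b2 c2, a2 * a2 + b2 * b2 + c2 * c2 = a1 * a1 + b1 * b1 + c1 * c1 /\
  (a2 + b2 + c2) mod 3 <> 0 /\
  a2 mod 2 = a1 mod 2 /\ b2 mod 2 = b1 mod 2 /\ c2 mod 2 = c1 mod 2).
{ assert (Hw : exists a2 b2 c2, a2 * a2 + b2 * b2 + c2 * c2 = a1 * a1 + b1 * b1 + c1 * c1 /\
    (a2 mod 3 <> 0 \/ b2 mod 3 <> 0 \/ c2 mod 3 <> 0) /\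
    a2 mod 2 = a1 mod 2 /\ b2 mod 2 = b1 mod 2 /\ c2 mod 2 = c1 mod 2).
  { destruct (Z.eq_dec (a1 mod 3) 0) as [E1|E1];
     [destruct (Z.eq_dec (b1 mod 3) 0) as [E2|E2];
      [destruct (Z.eq_dec (c1 mod 3) 0) as [E3|E3]|]|].
    - destruct (IH a1 b1 c1) as (u & v & w & H1 & (H2 & H3 & H4) & H5 & H6 & H7); [lia..|].
      exists u, v, w. auto.
    - exists a1, b1, c1. auto.
    - exists a1, b1, c1. auto.
    - exists a1, b1, c1. auto. }
  destruct Hw as (a2 & b2 & c2 & E & Hnd & P1 & P2 & P3). rewrite <- E, <- P1, <- P2, <- P3.
  clear - Hnd.
  (* If the sum and both sums with one sign changed were divisible by 3, so would be 2 a2 and 2 b2,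
     hence all three. *)
  destruct (Z.eq_dec ((a2 + b2 + c2) mod 3) 0) as [E1|E1]; [|exists a2, b2, c2; auto].
  destruct (Z.eq_dec ((- a2 + b2 + c2) mod 3) 0) as [E2|E2];
    [|exists (- a2), b2, c2; repeat split; auto; Z.div_mod_to_equations; lia].
  destruct (Z.eq_dec ((a2 - b2 + c2) mod 3) 0) as [E3|E3];
    [|exists a2, (- b2), c2; repeat split; auto; Z.div_mod_to_equations; lia].
  exfalso. Z.div_mod_to_equations; lia. }
destruct Hw as (a2 & b2 & c2 & E & Hnd & P1 & P2 & P3).
(* Modulo 3 all three are a2 + b2 + c2. *)
exists (a2 - 2 * b2 - 2 * c2), (- 2 * a2 + b2 - 2 * c2), (- 2 * a2 - 2 * b2 + c2).
split; [lia|]. clear - Hnd P1 P2 P3. repeat split; Z.div_mod_to_equations; lia.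
Qed.

Lemma square_mod3 (y : Z) :
  (y mod 3 = 0 /\ (y * y) mod 3 = 0) \/ (y mod 3 <> 0 /\ (y * y) mod 3 = 1).
Proof.
rewrite Z.mul_mod by lia. pose proof (Z.mod_pos_bound y 3 ltac:(lia)).
assert (y mod 3 = 0 \/ y mod 3 = 1 \/ y mod 3 = 2) as [-> | [-> | ->]] by lia;
  [left | right | right]; split; (reflexivity || lia).
Qed.

Lemma square_mod8 (y : Z) :
  (y mod 2 = 1 /\ (y * y) mod 8 = 1) \/
  (y mod 2 = 0 /\ ((y * y) mod 8 = 4 \/ (y * y) mod 8 = 0)).
Proof.
assert (E : y mod 2 = (y mod 8) mod 2) by (Z.div_mod_to_equations; lia).
rewrite E, Z.mul_mod by lia. pose proof (Z.mod_pos_bound y 8 ltac:(lia)).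
assert (Hy : y mod 8 = 0 \/ y mod 8 = 1 \/ y mod 8 = 2 \/ y mod 8 = 3 \/ y mod 8 = 4 \/
  y mod 8 = 5 \/ y mod 8 = 6 \/ y mod 8 = 7) by lia.
repeat destruct Hy as [Hy|Hy]; rewrite Hy; vm_compute; auto.
Qed.

Lemma even_double (y : Z) : y mod 2 = 0 -> exists k, y = 2 * k.
Proof. intros H. exists (y / 2). Z.div_mod_to_equations. lia. Qed.

Lemma three_squares_same_parity (n : Z) : three_squares n ->
  exists x b c, n = x * x + b * b + c * c /\ b mod 2 = c mod 2.
Proof.
intros (x & y & z & E).
assert (H : x mod 2 = y mod 2 \/ y mod 2 = z mod 2 \/ z mod 2 = x mod 2)
  by (Z.div_mod_to_equations; lia).
destruct H as [H|[H|H]].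
- exists z, x, y. lia.
- exists x, y, z. lia.
- exists y, z, x. lia.
Qed.

Lemma half_sum_diff (b c : Z) : b mod 2 = c mod 2 -> exists y z, b = y + z /\ c = y - z.
Proof. intros H. exists ((b + c) / 2), ((b - c) / 2). Z.div_mod_to_equations. lia. Qed.

(** Of three squares with even sum, two have roots of equal parity, x + y and x - y, and the third
    root is even. *)
Lemma rep112_of_three_squares (n : Z) : three_squares (2 * n) ->
  exists x y z, n = x * x + y * y + 2 * (z * z).
Proof.
intros (a & b & c & E).
assert (H : exists b c d, 2 * n = b * b + c * c + d * d /\ b mod 2 = c mod 2 /\ d mod 2 = 0).
{ pose proof (square_mod8 a). pose proof (square_mod8 b). pose proof (square_mod8 c).
  assert (H2 : (2 * n) mod 2 = 0) by (Z.div_mod_to_equations; lia).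
  destruct (Z.eq_dec (a mod 2) 0) as [Ha|Ha]; [exists b, c, a|
  destruct (Z.eq_dec (b mod 2) 0) as [Hb|Hb]; [exists a, c, b|
  exists a, b, c]]; (split; [lia|]);
  revert E H H0 H1 H2; generalize (a * a) (b * b) (c * c); intros;
  Z.div_mod_to_equations; lia. }
destruct H as (b' & c' & d & E' & Hbc & Hd).
destruct (half_sum_diff b' c' Hbc) as (x & y & -> & ->).
destruct (even_double d Hd) as (z & ->).
exists x, y, z. lia.
Qed.

Definition prime_to_three (x y z : Z) : Prop := x mod 3 <> 0 /\ y mod 3 <> 0 /\ z mod 3 <> 0.

(** For n = 1 mod 3 either all variables are prime to 3, or only x, or only y. The two others then
    form c^2 + 2 d^2, from which the 3 is cleared unless both are zero. *)
Lemma rep112_nontrivial (n x y z : Z) : n mod 3 = 1 -> n = x * x + y * y + 2 * (z * z) ->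
  ~ (y = 0 /\ z = 0) -> ~ (x = 0 /\ z = 0) ->
  exists u v w, n = u * u + v * v + 2 * (w * w) /\ prime_to_three u v w.
Proof.
intros Hn E Hyz Hxz.
pose proof (square_mod3 x) as Sx. pose proof (square_mod3 y) as Sy. pose proof (square_mod3 z) as Sz.
assert (H : prime_to_three x y z \/ (x mod 3 <> 0 /\ y mod 3 = 0 /\ z mod 3 = 0) \/
   (x mod 3 = 0 /\ y mod 3 <> 0 /\ z mod 3 = 0)).
{ unfold prime_to_three. revert E Sx Sy Sz. generalize (x * x) (y * y) (z * z). intros.
  Z.div_mod_to_equations; lia. }
destruct H as [H|[(Hx & Hy & Hz)|(Hx & Hy & Hz)]].
- exists x, y, z. auto.
- destruct (norm2_prime_to_three y z Hyz Hy Hz) as (u & v & Euv & Hu & Hv & _).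
  exists x, u, v. unfold prime_to_three. split; [lia|auto].
- destruct (norm2_prime_to_three x z Hxz Hx Hz) as (u & v & Euv & Hu & Hv & _).
  exists u, y, v. unfold prime_to_three. split; [lia|auto].
Qed.

(** The trivial representation e^2 + 0 + 0 is replaced by squaring a representation of e itself:
    with e = a^2 + b^2 + 2 c^2, e^2 = (a^2 - b^2 - 2 c^2)^2 + (2 a b)^2 + 2 (2 a c)^2. If e is a
    square, induction provides its representation. *)
Lemma rep112_square (e : Z) : 1 < e -> e mod 3 <> 0 ->
  exists u v w, e * e = u * u + v * v + 2 * (w * w) /\ prime_to_three u v w.
Proof.
intros He. assert (H0 : 0 <= e) by lia. revert He. pattern e.
apply Z_lt_induction; [clear e H0|exact H0].
intros e IH He H3.
destruct (Z.eq_dec (e mod 2) 0) as [H2|H2].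
{ destruct (even_double e H2) as (k & ->). exists k, k, k.
  split; [ring|]. unfold prime_to_three. Z.div_mod_to_equations; lia. }
assert (Hrep : exists a b c, e = a * a + b * b + 2 * (c * c) /\ ~ (b = 0 /\ c = 0) /\
  ~ (a = 0 /\ c = 0)).
{ destruct (rep112_of_three_squares e) as (a & b & c & E).
  { apply three_squares_mod; Z.div_mod_to_equations; lia. }
  assert (Hsq : forall a, e = a * a -> exists a b c, e = a * a + b * b + 2 * (c * c) /\
    ~ (b = 0 /\ c = 0) /\ ~ (a = 0 /\ c = 0)).
  { clear a b c E. intros a E.
    assert (Ha : Z.abs a * Z.abs a = e) by (rewrite Z.abs_square; lia).
    assert (1 < Z.abs a < e) by nia.
    destruct (IH (Z.abs a)) as (u & v & w & Ew & Hu & Hv & Hw); [lia|lia| |].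
    { intros C. pose proof (square_mod3 (Z.abs a)). rewrite Ha in H0. lia. }
    exists u, v, w. split; [lia|].
    split; intros [C1 C2]; subst; (apply Hw; reflexivity). }
  destruct (Z.eq_dec c 0) as [->|Hc]; [|exists a, b, c; lia].
  destruct (Z.eq_dec b 0) as [->|Hb]; [apply (Hsq a); lia|].
  destruct (Z.eq_dec a 0) as [->|Ha]; [apply (Hsq b); lia|].
  exists a, b, 0. lia. }
(* If a = 0, exchange a and b; b = 0 as well would make e even. *)
assert (Hrep' : exists a b c, e = a * a + b * b + 2 * (c * c) /\ ~ (b = 0 /\ c = 0) /\ a <> 0).
{ destruct Hrep as (a & b & c & E & H4 & H5).
  destruct (Z.eq_dec a 0) as [->|Ha]; [|exists a, b, c; auto].
  exists b, 0, c. split; [lia|]. split; [lia|]. intros ->.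
  apply H2. rewrite E. clear. generalize (c * c). intros. Z.div_mod_to_equations; lia. }
destruct Hrep' as (a & b & c & E & Hbc & Ha).
apply (rep112_nontrivial (e * e) (a * a - b * b - 2 * (c * c)) (2 * (a * b)) (2 * (a * c))).
- pose proof (square_mod3 e). lia.
- rewrite E. ring.
- intros [C1 C2]. apply Hbc. split; [apply (Z.eq_mul_0_r a)|apply (Z.eq_mul_0_r a)]; lia.
- intros [C1 C2]. assert (c = 0) by (apply (Z.eq_mul_0_r a); lia). subst c.
  apply H2. assert (Ee : e = 2 * (a * a)) by lia. rewrite Ee. clear. generalize (a * a).
  intros. Z.div_mod_to_equations; lia.
Qed.

Lemma rep112_prime_to_three (n : Z) : n mod 3 = 1 -> 1 < n -> three_squares (2 * n) ->
  exists x y z, n = x * x + y * y + 2 * (z * z) /\ prime_to_three x y z.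
Proof.
intros H3 H1 HS.
assert (Hsq : forall a, n = a * a ->
  exists x y z, n = x * x + y * y + 2 * (z * z) /\ prime_to_three x y z).
{ intros a E. assert (Ha : Z.abs a * Z.abs a = n) by (rewrite Z.abs_square; lia).
  rewrite <- Ha. apply rep112_square; [nia|].
  intros C. pose proof (square_mod3 (Z.abs a)). rewrite Ha in H. lia. }
destruct (rep112_of_three_squares n HS) as (x & y & z & E).
destruct (Z.eq_dec z 0) as [->|Hz]; [|apply (rep112_nontrivial n x y z); auto; lia].
destruct (Z.eq_dec y 0) as [->|Hy]; [apply (Hsq x); lia|].
destruct (Z.eq_dec x 0) as [->|Hx]; [apply (Hsq y); lia|].
apply (rep112_nontrivial n x y 0); auto; lia.
Qed.

(** Two of three squares have roots of equal parity, y + z and y - z. The exceptional values are n =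
    2 a^2: for odd a, twice a representation a^2 = p^2 + q^2 + 2 r^2 gives (2 r)^2 + 2 p^2 + 2
    q^2. *)
Lemma rep122_prime_to_three (n : Z) : n mod 3 = 2 -> 2 < n -> three_squares n ->
  exists x y z, n = x * x + 2 * (y * y) + 2 * (z * z) /\ prime_to_three x y z.
Proof.
intros H3 H2 HS.
destruct (three_squares_same_parity n HS) as (x & b & c & E & Hbc).
destruct (half_sum_diff b c Hbc) as (y & z & -> & ->).
assert (E' : n = x * x + 2 * (y * y) + 2 * (z * z)) by lia. clear E Hbc.
assert (Hsq : forall a, n = 2 * (a * a) ->
  exists x y z, n = x * x + 2 * (y * y) + 2 * (z * z) /\ prime_to_three x y z).
{ intros a En. pose proof (square_mod3 a) as Sa.
  assert (Ha3 : a mod 3 <> 0).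
  { revert En Sa. generalize (a * a). intros. Z.div_mod_to_equations; lia. }
  destruct (Z.eq_dec (a mod 2) 0) as [Ha|Ha].
  - destruct (even_double a Ha) as (k & ->). exists (2 * k), k, k.
    split; [lia|]. unfold prime_to_three. Z.div_mod_to_equations; lia.
  - destruct (rep112_prime_to_three (a * a)) as (p & q & r & Ep & Hp & Hq & Hr).
    + lia.
    + lia.
    + pose proof (square_mod8 a) as S8. apply three_squares_mod; [nia|].
      revert S8. generalize (a * a). intros. Z.div_mod_to_equations; lia.
    + exists (2 * r), p, q. split; [lia|]. unfold prime_to_three. repeat split; auto.
      Z.div_mod_to_equations; lia. }
pose proof (square_mod3 x) as Sx. pose proof (square_mod3 y) as Sy. pose proof (square_mod3 z) as Sz.
assert (H : prime_to_three x y z \/ (x mod 3 = 0 /\ y mod 3 = 0 /\ z mod 3 <> 0) \/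
   (x mod 3 = 0 /\ y mod 3 <> 0 /\ z mod 3 = 0)).
{ unfold prime_to_three. revert E' Sx Sy Sz. generalize (x * x) (y * y) (z * z). intros.
  Z.div_mod_to_equations; lia. }
destruct H as [H|[(Hx & Hy & Hz)|(Hx & Hy & Hz)]].
- exists x, y, z. auto.
- destruct (Z.eq_dec y 0) as [->|Hy0].
  + destruct (Z.eq_dec x 0) as [->|Hx0]; [apply (Hsq z); lia|].
    destruct (norm2_prime_to_three x 0 ltac:(lia) Hx Hy) as (u & v & Euv & Hu & Hv & _).
    exists u, v, z. unfold prime_to_three. split; [lia|auto].
  + destruct (norm2_prime_to_three x y ltac:(lia) Hx Hy) as (u & v & Euv & Hu & Hv & _).
    exists u, v, z. unfold prime_to_three. split; [lia|auto].
- destruct (Z.eq_dec z 0) as [->|Hz0].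
  + destruct (Z.eq_dec x 0) as [->|Hx0]; [apply (Hsq y); lia|].
    destruct (norm2_prime_to_three x 0 ltac:(lia) Hx Hz) as (u & v & Euv & Hu & Hv & _).
    exists u, y, v. unfold prime_to_three. split; [lia|auto].
  + destruct (norm2_prime_to_three x z ltac:(lia) Hx Hz) as (u & v & Euv & Hu & Hv & _).
    exists u, y, v. unfold prime_to_three. split; [lia|auto].
Qed.

(** Factors 4 are divided out; then w = 2 suits M = 1 mod 4, apart from M = 1, and w = 1 suits M = 2
    and M = 3 mod 4. *)
Lemma four_squares_prime_to_three (M : Z) : 1 <= M ->
  exists w, w mod 3 <> 0 /\ three_squares (M - w * w).
Proof.
intros HM. assert (H0 : 0 <= M) by lia. revert HM. pattern M.
apply Z_lt_induction; [clear M H0|exact H0].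
intros M IH HM.
destruct (Z.eq_dec (M mod 4) 0) as [H4|H4].
{ destruct (IH (M / 4)) as (w & Hw & S); [Z.div_mod_to_equations; lia..|].
  exists (2 * w). split; [Z.div_mod_to_equations; lia|].
  replace (M - 2 * w * (2 * w)) with (2 * 2 * (M / 4 - w * w)) by (Z.div_mod_to_equations; lia).
  now apply three_squares_scale. }
destruct (Z.eq_dec M 1) as [->|H1].
{ exists 1. split; [discriminate|]. exists 0, 0, 0. reflexivity. }
destruct (Z.eq_dec (M mod 4) 1) as [H41|H41].
- exists 2. split; [discriminate|]. apply three_squares_mod; Z.div_mod_to_equations; lia.
- exists 1. split; [discriminate|]. apply three_squares_mod; Z.div_mod_to_equations; lia.
Qed.

(** * Ternary sums of polygonal numbers *)

Lemma pgon3_double (x : Z) : 2 * pgon 3 x = x * x + x.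
Proof.
unfold pgon. rewrite Z.pow_2_r. pose proof (square_mod8 x). revert H.
generalize (x * x). intros. Z.div_mod_to_equations; lia.
Qed.

Lemma pgon4_square (x : Z) : pgon 4 x = x * x.
Proof. unfold pgon. rewrite Z.pow_2_r. generalize (x * x). intros. Z.div_mod_to_equations; lia. Qed.

Lemma pgon5_double (x : Z) : 2 * pgon 5 x = 3 * (x * x) - x.
Proof.
unfold pgon. rewrite Z.pow_2_r. pose proof (square_mod8 x). revert H.
generalize (x * x). intros. Z.div_mod_to_equations; lia.
Qed.

Lemma pgon8_eq (x : Z) : pgon 8 x = 3 * (x * x) - 2 * x.
Proof. unfold pgon. rewrite Z.pow_2_r. generalize (x * x). intros. Z.div_mod_to_equations; lia. Qed.

Lemma pgon_0 (m : Z) : pgon m 0 = 0.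
Proof. unfold pgon. replace ((m - 2) * 0 ^ 2 - (m - 4) * 0) with 0 by ring. reflexivity. Qed.

Lemma pgon_nonneg (m x : Z) : 3 <= m -> 0 <= pgon m x.
Proof.
intros Hm. apply Z.div_pos; [|lia]. rewrite Z.pow_2_r.
replace ((m - 2) * (x * x) - (m - 4) * x) with ((m - 3) * (x * (x - 1)) + x * (x + 1)) by ring.
assert (0 <= x * (x - 1)) by nia. assert (0 <= x * (x + 1)) by nia.
assert (0 <= (m - 3) * (x * (x - 1))) by (apply Z.mul_nonneg_nonneg; lia). lia.
Qed.

Lemma pgon3_of_odd (a : Z) : a mod 2 = 1 -> exists x, a * a = 8 * pgon 3 x + 1.
Proof.
intros H. exists (a / 2). pose proof (pgon3_double (a / 2)).
assert (a = 2 * (a / 2) + 1) by (Z.div_mod_to_equations; lia).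
revert H0 H1. generalize (a / 2) (pgon 3 (a / 2)). intros y p E ->. lia.
Qed.

Lemma pgon5_of_coprime (u : Z) : u mod 2 = 1 -> u mod 3 <> 0 ->
  exists x, u * u = 24 * pgon 5 x + 1.
Proof.
intros H2 H3.
assert (H : exists x, u = 6 * x - 1 \/ u = 1 - 6 * x).
{ destruct (Z.eq_dec (u mod 6) 5).
  - exists (u / 6 + 1). left. Z.div_mod_to_equations; lia.
  - exists (- (u / 6)). right. Z.div_mod_to_equations; lia. }
destruct H as (x & H). exists x. pose proof (pgon5_double x).
destruct H as [-> | ->]; lia.
Qed.

Lemma pgon8_of_coprime (y : Z) : y mod 3 <> 0 -> exists x, y * y = 3 * pgon 8 x + 1.
Proof.
intros H3.
assert (H : exists x, y = 3 * x - 1 \/ y = 1 - 3 * x).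
{ destruct (Z.eq_dec (y mod 3) 2).
  - exists (y / 3 + 1). left. Z.div_mod_to_equations; lia.
  - exists (- (y / 3)). right. Z.div_mod_to_equations; lia. }
destruct H as (x & H). exists x. rewrite pgon8_eq. destruct H as [-> | ->]; ring.
Qed.

(** This identity and the next two are used from left to right: a universal sum containing the left
    pair stays universal with the right pair in its place. *)
Lemma exchange_2p5_p8 (h l : Z) :
  2 * pgon 5 h + pgon 8 l = 3 * pgon 3 (h + l - 1) + pgon 5 (l - h).
Proof.
pose proof (pgon5_double h). pose proof (pgon8_eq l). pose proof (pgon3_double (h + l - 1)).
pose proof (pgon5_double (l - h)). lia.
Qed.

Lemma exchange_p5_2p5 (h l : Z) :
  pgon 5 h + 2 * pgon 5 l = pgon 3 (h + 2 * l - 1) + pgon 4 (l - h).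
Proof.
pose proof (pgon5_double h). pose proof (pgon5_double l). pose proof (pgon3_double (h + 2 * l - 1)).
pose proof (pgon4_square (l - h)). lia.
Qed.

Lemma exchange_p5_p8 (h l : Z) :
  pgon 5 h + pgon 8 l = pgon 3 (h - 2 * l) + 2 * pgon 3 (h + l - 1).
Proof.
pose proof (pgon5_double h). pose proof (pgon8_eq l). pose proof (pgon3_double (h - 2 * l)).
pose proof (pgon3_double (h + l - 1)). lia.
Qed.

Definition represented (a r b s c t N : Z) : Prop :=
  exists h l m, a * pgon r h + b * pgon s l + c * pgon t m = N.

(* Nonlinear subterms are left as atoms. *)
Ltac residues := Z.div_mod_to_equations; lia.

Lemma three_squares_odd_first (n : Z) : three_squares n -> n mod 4 = 1 ->
  exists a b c, n = a * a + b * b + c * c /\ a mod 2 = 1 /\ b mod 2 = 0 /\ c mod 2 = 0.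
Proof.
intros (a & b & c & E) Hn.
pose proof (square_mod8 a). pose proof (square_mod8 b). pose proof (square_mod8 c).
assert (D : (a mod 2 = 1 /\ b mod 2 = 0 /\ c mod 2 = 0) \/ (a mod 2 = 0 /\ b mod 2 = 1 /\ c mod 2 = 0)
  \/ (a mod 2 = 0 /\ b mod 2 = 0 /\ c mod 2 = 1)).
{ revert E H H0 H1. generalize (a * a) (b * b) (c * c). intros. residues. }
destruct D as [D|[D|D]]; [exists a, b, c|exists b, a, c|exists c, a, b]; lia.
Qed.

(** The residue 3 modulo 8 makes all three roots odd, and 2 modulo 3 makes exactly one of them
    divisible by 3. *)
Lemma three_squares_11mod24 (n : Z) : 0 <= n -> n mod 24 = 11 ->
  exists a b c, n = a * a + b * b + (3 * c) * (3 * c) /\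
    (a mod 2 = 1 /\ a mod 3 <> 0) /\ (b mod 2 = 1 /\ b mod 3 <> 0) /\ c mod 2 = 1.
Proof.
intros H0 Hn. destruct (three_squares_mod n H0) as (a & b & c & E); [residues|].
pose proof (square_mod8 a) as A8. pose proof (square_mod8 b) as B8. pose proof (square_mod8 c) as C8.
pose proof (square_mod3 a) as A3. pose proof (square_mod3 b) as B3. pose proof (square_mod3 c) as C3.
assert (P : a mod 2 = 1 /\ b mod 2 = 1 /\ c mod 2 = 1).
{ clear A3 B3 C3. revert E A8 B8 C8. generalize (a * a) (b * b) (c * c). intros. residues. }
assert (D : (a mod 3 <> 0 /\ b mod 3 <> 0 /\ c mod 3 = 0) \/ (a mod 3 <> 0 /\ b mod 3 = 0 /\ c mod 3 <> 0)
  \/ (a mod 3 = 0 /\ b mod 3 <> 0 /\ c mod 3 <> 0)).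
{ clear A8 B8 C8 P. revert E A3 B3 C3. generalize (a * a) (b * b) (c * c). intros. residues. }
clear A8 B8 C8 A3 B3 C3.
assert (W : exists a b c, n = a * a + b * b + c * c /\ (a mod 2 = 1 /\ b mod 2 = 1 /\ c mod 2 = 1) /\
  a mod 3 <> 0 /\ b mod 3 <> 0 /\ c mod 3 = 0).
{ destruct D as [D|[D|D]]; [exists a, b, c|exists a, c, b|exists b, c, a]; lia. }
clear a b c E P D. destruct W as (a & b & c & E & P & A3 & B3 & C3).
destruct (multiple_of_three c C3) as (c1 & ->). exists a, b, c1.
repeat split; try tauto. destruct P as (_ & _ & P). residues.
Qed.

(** As 24 p_5 + 1 and 12 p_8 + 4 are squares, 12 N + 9 must be a^2 + (2 y)^2 + (2 z)^2. It is
    divisible by 3, so the roots are all prime to 3 or all divisible by 3. *)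
Lemma represented_2p5_p8_p8 (N : Z) : 0 <= N -> represented 2 5 1 8 1 8 N.
Proof.
intros HN.
destruct (three_squares_odd_first (12 * N + 9)) as (a & b & c & E & Pa & Pb & Pc);
  [apply three_squares_mod; residues|residues|].
assert (W : exists a b c, 12 * N + 9 = a * a + b * b + c * c /\
   (a mod 2 = 1 /\ b mod 2 = 0 /\ c mod 2 = 0) /\ prime_to_three a b c).
{ pose proof (square_mod3 a) as A3. pose proof (square_mod3 b) as B3. pose proof (square_mod3 c) as C3.
  assert (D : prime_to_three a b c \/ (a mod 3 = 0 /\ b mod 3 = 0 /\ c mod 3 = 0)).
  { unfold prime_to_three. revert E A3 B3 C3. generalize (a * a) (b * b) (c * c). intros. residues. }
  destruct D as [D|(Da & Db & Dc)]; [exists a, b, c; auto|].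
  destruct (three_squares_prime_to_three a b c) as (x & y & z & Exyz & D & Px & Py & Pz); auto.
  { intros (-> & _). discriminate. }
  exists x, y, z. split; [lia|]. split; [lia|exact D]. }
clear a b c E Pa Pb Pc. destruct W as (a & b & c & E & (Pa & Pb & Pc) & (Da & Db & Dc)).
destruct (even_double b Pb) as (y & ->). destruct (even_double c Pc) as (z & ->).
destruct (pgon5_of_coprime a Pa Da) as (h & Eh).
destruct (pgon8_of_coprime y) as (l & El); [residues|].
destruct (pgon8_of_coprime z) as (m & Em); [residues|].
exists h, l, m. lia.
Qed.

(** The target is 24 N + 11 = a^2 + 2 v^2 + 8 y^2. *)
Lemma represented_p5_2p5_p8 (N : Z) : 0 <= N -> represented 1 5 2 5 1 8 N.
Proof.
intros HN. destruct (three_squares_11mod24 (24 * N + 11)) as (a & b & c & E & (A2 & A3) & (B2 & B3) & C2);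
  [lia|residues|].
(* b = v + 2 y and 3 c = v - 2 y up to the sign of c *)
assert (W : exists v y, b * b + (3 * c) * (3 * c) = 2 * (v * v) + 8 * (y * y) /\
  v mod 2 = 1 /\ v mod 3 <> 0 /\ y mod 3 <> 0).
{ clear E. assert (D3 : (3 * c) mod 3 = 0) by residues.
  destruct (half_sum_diff b (3 * c)) as (p & q & -> & Ec); [residues|].
  rewrite Ec in *. clear c C2 Ec.
  destruct (Z.eq_dec (q mod 2) 0) as [Q|Q].
  - destruct (even_double q Q) as (y & ->). exists p, y. split; [ring|]. repeat split; residues.
  - destruct (even_double p) as (y & ->); [residues|]. exists q, y. split; [ring|].
    repeat split; residues. }
destruct W as (v & y & W & V2 & V3 & Y3).
destruct (pgon5_of_coprime a A2 A3) as (h & Eh). destruct (pgon5_of_coprime v V2 V3) as (l & El).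
destruct (pgon8_of_coprime y Y3) as (m & Em).
exists h, l, m. lia.
Qed.

Lemma represented_3p3_p5_p5 (N : Z) : 0 <= N -> represented 3 3 1 5 1 5 N.
Proof.
intros HN. destruct (three_squares_11mod24 (24 * N + 11)) as (a & b & c & E & (A2 & A3) & (B2 & B3) & C2);
  [lia|residues|].
destruct (pgon3_of_odd c C2) as (h & Eh). destruct (pgon5_of_coprime a A2 A3) as (l & El).
destruct (pgon5_of_coprime b B2 B3) as (m & Em).
exists h, l, m. lia.
Qed.

(** The target is 6 N + 7 = (9 a^2 + u^2) / 2 + 2 x^2; the first part is e^2 + f^2 rotated by 45
    degrees. *)
Lemma represented_6p3_2p5_p8 (N : Z) : 0 <= N -> represented 6 3 2 5 1 8 N.
Proof.
intros HN. destruct (rep112_prime_to_three (6 * N + 7)) as (e & f & x & E & He & Hf & Hx);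
  [residues|lia|apply three_squares_mod; residues|].
assert (P : (e + f) mod 2 = 1).
{ pose proof (square_mod8 e). pose proof (square_mod8 f). revert E H H0.
  generalize (e * e) (f * f) (x * x). intros. residues. }
(* e + f and e - f are odd and exactly one of them is divisible by 3 *)
assert (W : exists a u, 2 * (e * e + f * f) = 9 * (a * a) + u * u /\ a mod 2 = 1 /\ u mod 2 = 1 /\ u mod 3 <> 0).
{ destruct (Z.eq_dec ((e + f) mod 3) 0) as [H|H].
  - destruct (multiple_of_three _ H) as (a & Ha). exists a, (e - f).
    split; [replace (9 * (a * a)) with ((e + f) * (e + f)) by (rewrite Ha; ring); ring|].
    clear E. repeat split; residues.
  - assert (H' : (e - f) mod 3 = 0) by (clear E; residues).
    destruct (multiple_of_three _ H') as (a & Ha). exists a, (e + f).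
    split; [replace (9 * (a * a)) with ((e - f) * (e - f)) by (rewrite Ha; ring); ring|].
    clear E. repeat split; residues. }
destruct W as (a & u & W & A2 & U2 & U3).
destruct (pgon3_of_odd a A2) as (h & Eh). destruct (pgon5_of_coprime u U2 U3) as (l & El).
destruct (pgon8_of_coprime x Hx) as (m & Em).
exists h, l, m. lia.
Qed.

(** The target is 24 N + 17 = u^2 + 8 g^2 + 8 d^2 with u prime to 6 and g, d prime to 3. *)
Lemma represented_p5_p8_p8 (N : Z) : 0 <= N -> represented 1 5 1 8 1 8 N.
Proof.
intros HN.
destruct (three_squares_odd_first (24 * N + 17)) as (a & b & c & E & A2 & B2 & C2);
  [apply three_squares_mod; residues|residues|].
assert (W : exists g d, 24 * N + 17 = a * a + 8 * (g * g) + 8 * (d * d)).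
{ destruct (even_double b B2) as (b1 & ->). destruct (even_double c C2) as (c1 & ->).
  assert (P : b1 mod 2 = c1 mod 2).
  { pose proof (square_mod8 a). pose proof (square_mod8 b1). pose proof (square_mod8 c1).
    replace (2 * b1 * (2 * b1)) with (4 * (b1 * b1)) in E by ring.
    replace (2 * c1 * (2 * c1)) with (4 * (c1 * c1)) in E by ring.
    revert E H H0 H1. generalize (a * a) (b1 * b1) (c1 * c1). intros. residues. }
  destruct (half_sum_diff b1 c1 P) as (g & d & -> & ->). exists g, d. lia. }
destruct W as (g & d & W). clear b c E B2 C2.
assert (V : exists u g d, 24 * N + 17 = u * u + 8 * (g * g) + 8 * (d * d) /\ u mod 2 = 1 /\ prime_to_three u g d).
{ pose proof (square_mod3 a) as A3. pose proof (square_mod3 g) as G3. pose proof (square_mod3 d) as D3.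
  assert (C : prime_to_three a g d \/ (a mod 3 = 0 /\ g mod 3 = 0 /\ d mod 3 <> 0) \/
    (a mod 3 = 0 /\ g mod 3 <> 0 /\ d mod 3 = 0)).
  { unfold prime_to_three. revert W A3 G3 D3. generalize (a * a) (g * g) (d * d). intros. residues. }
  clear A3 G3 D3.
  (* View a^2 + 8 g^2 as a^2 + 2 (2 g)^2; clearing the 3 preserves parities, so the second variable
     remains even. *)
  assert (K : forall g d, 24 * N + 17 = a * a + 8 * (g * g) + 8 * (d * d) ->
    a mod 3 = 0 -> g mod 3 = 0 -> d mod 3 <> 0 ->
    exists u g d, 24 * N + 17 = u * u + 8 * (g * g) + 8 * (d * d) /\ u mod 2 = 1 /\ prime_to_three u g d).
  { clear g d W C. intros g d W A3 G3 D3.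
    destruct (norm2_prime_to_three a (2 * g)) as (u & v & Euv & U3 & V3 & U2 & V2);
      [intros (-> & _); discriminate|exact A3|clear W; residues|].
    destruct (even_double v) as (v1 & ->); [clear W Euv; residues|].
    exists u, v1, d. split; [lia|]. split; [congruence|]. unfold prime_to_three.
    clear W Euv. repeat split; auto; residues. }
  destruct C as [C|[(C1 & C2 & C3)|(C1 & C2 & C3)]].
  - exists a, g, d. auto.
  - now apply (K g d).
  - apply (K d g); auto. lia. }
clear a g d A2 W. destruct V as (u & g & d & E & U2 & U3 & G3 & D3).
destruct (pgon5_of_coprime u U2 U3) as (h & Eh). destruct (pgon8_of_coprime g G3) as (l & El).
destruct (pgon8_of_coprime d D3) as (m & Em).
exists h, l, m. lia.
Qed.

Lemma rep112_odd_even (n : Z) : n mod 2 = 1 -> n mod 3 = 1 -> 1 < n ->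
  exists u y z, n = u * u + 4 * (y * y) + 2 * (z * z) /\ u mod 2 = 1 /\ prime_to_three u y z.
Proof.
intros H2 H3 H1. destruct (rep112_prime_to_three n H3 H1) as (a & b & z & E & A3 & B3 & Z3);
  [apply three_squares_mod; residues|].
assert (P : (a mod 2 = 1 /\ b mod 2 = 0) \/ (b mod 2 = 1 /\ a mod 2 = 0)).
{ pose proof (square_mod8 a). pose proof (square_mod8 b). revert E H H0.
  generalize (a * a) (b * b) (z * z). intros. residues. }
unfold prime_to_three.
destruct P as [(P & Q)|(P & Q)]; destruct (even_double _ Q) as (y & ->).
- exists a, y, z. split; [lia|]. clear E. repeat split; auto; residues.
- exists b, y, z. split; [lia|]. clear E. repeat split; auto; residues.
Qed.

(** In 6 N + 7 = u^2 + 2 z^2 + 4 y^2 the terms belong to 4 p_5, p_8 and 2 p_8. *)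
Lemma represented_4p5_p8_2p8 (N : Z) : 0 <= N -> represented 4 5 1 8 2 8 N.
Proof.
intros HN. destruct (rep112_odd_even (6 * N + 7)) as (u & y & z & E & U2 & U3 & Y3 & Z3);
  [residues|residues|lia|].
destruct (pgon5_of_coprime u U2 U3) as (h & Eh). destruct (pgon8_of_coprime y Y3) as (m & Em).
destruct (pgon8_of_coprime z Z3) as (l & El).
exists h, l, m. lia.
Qed.

Lemma represented_2p5_p8_2p8 (N : Z) : 0 <= N -> represented 2 5 1 8 2 8 N.
Proof.
intros HN. destruct (rep112_odd_even (12 * N + 13)) as (u & y & z & E & U2 & U3 & Y3 & Z3);
  [residues|residues|lia|].
assert (Z2 : z mod 2 = 0).
{ pose proof (square_mod8 u). pose proof (square_mod8 z). revert E H H0.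
  generalize (u * u) (y * y) (z * z). intros. residues. }
destruct (even_double z Z2) as (z1 & ->).
destruct (pgon5_of_coprime u U2 U3) as (h & Eh). destruct (pgon8_of_coprime y Y3) as (l & El).
destruct (pgon8_of_coprime z1) as (m & Em); [clear E; residues|].
exists h, l, m. lia.
Qed.

Lemma represented_2p5_4p5_p8 (N : Z) : 0 <= N -> represented 2 5 4 5 1 8 N.
Proof.
intros HN. destruct (rep112_odd_even (12 * N + 7)) as (u & y & z & E & U2 & U3 & Y3 & Z3);
  [residues|residues|lia|].
assert (Z2 : z mod 2 = 1).
{ pose proof (square_mod8 u). pose proof (square_mod8 z). revert E H H0.
  generalize (u * u) (y * y) (z * z). intros. residues. }
destruct (pgon5_of_coprime u U2 U3) as (h & Eh). destruct (pgon5_of_coprime z Z2 Z3) as (l & El).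
destruct (pgon8_of_coprime y Y3) as (m & Em).
exists h, l, m. lia.
Qed.

(** Since 2 n = 6 mod 8, it is x^2 + y^2 + (2 c)^2 with x, y, c odd; of the half sum and half
    difference of x and y exactly one is even. *)
Lemma rep124_of_3mod4 (n : Z) : 0 <= n -> n mod 4 = 3 ->
  exists a c d, n = a * a + 2 * (c * c) + 4 * (d * d) /\ a mod 2 = 1 /\ c mod 2 = 1.
Proof.
intros H0 Hn. destruct (three_squares_mod (2 * n)) as (x & y & z & E); [lia|residues|].
pose proof (square_mod8 x) as X8. pose proof (square_mod8 y) as Y8. pose proof (square_mod8 z) as Z8.
assert (W : exists x y z, 2 * n = x * x + y * y + z * z /\ x mod 2 = 1 /\ y mod 2 = 1 /\ z mod 2 = 0).
{ assert (D : (x mod 2 = 1 /\ y mod 2 = 1 /\ z mod 2 = 0) \/ (x mod 2 = 1 /\ z mod 2 = 1 /\ y mod 2 = 0)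
    \/ (y mod 2 = 1 /\ z mod 2 = 1 /\ x mod 2 = 0)).
  { revert E X8 Y8 Z8. generalize (x * x) (y * y) (z * z). intros. residues. }
  destruct D as [D|[D|D]]; [exists x, y, z|exists x, z, y|exists y, z, x]; lia. }
clear x y z E X8 Y8 Z8. destruct W as (x & y & z & E & X2 & Y2 & Z2).
destruct (even_double z Z2) as (c & ->).
assert (C2 : c mod 2 = 1).
{ pose proof (square_mod8 x). pose proof (square_mod8 y). pose proof (square_mod8 c).
  replace (2 * c * (2 * c)) with (4 * (c * c)) in E by ring.
  revert E H H1 H2. generalize (x * x) (y * y) (c * c). intros. residues. }
assert (W : exists a d, x * x + y * y = 2 * (a * a) + 8 * (d * d) /\ a mod 2 = 1).
{ destruct (half_sum_diff x y) as (p & q & -> & ->); [congruence|].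
  destruct (Z.eq_dec (p mod 2) 1) as [P2|P2].
  - destruct (even_double q) as (d & ->); [clear E; residues|]. exists p, d. split; [ring|exact P2].
  - destruct (even_double p) as (d & ->); [clear E; residues|]. exists q, d. split; [ring|].
    clear E. residues. }
destruct W as (a & d & W & A2). exists a, c, d. split; [lia|auto].
Qed.

(** The target 24 N + 9 = 3 a^2 + 2 (u^2 + 2 v^2) is three times a representation of 8 N + 3;
    [norm2_triple] absorbs the 3 and makes u and v prime to 3. *)
Lemma represented_p3_2p5_4p5 (N : Z) : 0 <= N -> represented 1 3 2 5 4 5 N.
Proof.
intros HN. destruct (rep124_of_3mod4 (8 * N + 3)) as (a & c & d & E & A2 & C2); [lia|residues|].
assert (D2 : d mod 2 = 0).
{ pose proof (square_mod8 a). pose proof (square_mod8 c). pose proof (square_mod8 d). revert E H H0 H1.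
  generalize (a * a) (c * c) (d * d). intros. residues. }
destruct (norm2_triple c d) as (u & v & Euv & U3 & V3 & U2 & V2); [intros (-> & _); discriminate|].
destruct (pgon3_of_odd a A2) as (h & Eh).
destruct (pgon5_of_coprime u) as (l & El); [congruence|exact U3|].
destruct (pgon5_of_coprime v) as (m & Em); [clear E Euv; residues|exact V3|].
exists h, l, m. lia.
Qed.

Lemma represented_p3_2p5_2p8 (N : Z) : 0 <= N -> represented 1 3 2 5 2 8 N.
Proof.
intros HN. destruct (rep124_of_3mod4 (8 * N + 7)) as (a & c & d & E & A2 & C2); [lia|residues|].
assert (D2 : d mod 2 = 1).
{ pose proof (square_mod8 a). pose proof (square_mod8 c). pose proof (square_mod8 d). revert E H H0 H1.
  generalize (a * a) (c * c) (d * d). intros. residues. }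
destruct (norm2_triple c d) as (u & v & Euv & U3 & V3 & U2 & V2); [intros (-> & _); discriminate|].
destruct (even_double v) as (y & ->); [clear E Euv; residues|].
destruct (pgon3_of_odd a A2) as (h & Eh).
destruct (pgon5_of_coprime u) as (l & El); [congruence|exact U3|].
destruct (pgon8_of_coprime y) as (m & Em); [clear E Euv; residues|].
exists h, l, m. lia.
Qed.

Lemma represented_6p3_2p5_2p5 (N : Z) : 0 <= N -> N mod 2 = 0 -> represented 6 3 2 5 2 5 N.
Proof.
intros HN H2. destruct (three_squares_11mod24 (12 * N + 11)) as (a & b & c & E & (A2 & A3) & (B2 & B3) & C2);
  [lia|residues|].
destruct (pgon3_of_odd c C2) as (h & Eh). destruct (pgon5_of_coprime a A2 A3) as (l & El).
destruct (pgon5_of_coprime b B2 B3) as (m & Em).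
exists h, l, m. lia.
Qed.

(** The excluded class is the one where 6 N + 5 = u^2 + 2 y^2 + 2 z^2 would be 7 modulo 8. *)
Lemma represented_4p5_p8_p8 (N : Z) : 0 <= N -> N mod 4 <> 3 -> represented 4 5 1 8 1 8 N.
Proof.
intros HN H4. destruct (rep122_prime_to_three (6 * N + 5)) as (u & y & z & E & U3 & Y3 & Z3);
  [residues|lia|apply three_squares_mod; residues|].
assert (U2 : u mod 2 = 1).
{ pose proof (square_mod8 u). revert E H. generalize (u * u) (y * y) (z * z). intros. residues. }
destruct (pgon5_of_coprime u U2 U3) as (h & Eh). destruct (pgon8_of_coprime y Y3) as (l & El).
destruct (pgon8_of_coprime z Z3) as (m & Em).
exists h, l, m. lia.
Qed.

Lemma represented_p8_p8_2p8 (N : Z) : 0 <= N -> three_squares (6 * N + 8) -> represented 1 8 1 8 2 8 N.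
Proof.
intros HN HS. destruct (rep112_prime_to_three (3 * N + 4)) as (x & y & z & E & X3 & Y3 & Z3);
  [residues|lia|replace (2 * (3 * N + 4)) with (6 * N + 8) by ring; exact HS|].
destruct (pgon8_of_coprime x X3) as (h & Eh). destruct (pgon8_of_coprime y Y3) as (l & El).
destruct (pgon8_of_coprime z Z3) as (m & Em).
exists h, l, m. lia.
Qed.

Lemma represented_p8_2p8_2p8 (N : Z) : 0 <= N -> three_squares (3 * N + 5) -> represented 1 8 2 8 2 8 N.
Proof.
intros HN HS. destruct (rep122_prime_to_three (3 * N + 5)) as (x & y & z & E & X3 & Y3 & Z3);
  [residues|lia|exact HS|].
destruct (pgon8_of_coprime x X3) as (h & Eh). destruct (pgon8_of_coprime y Y3) as (l & El).
destruct (pgon8_of_coprime z Z3) as (m & Em).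
exists h, l, m. lia.
Qed.

Lemma represented_3p4_p8_p8 (N : Z) : three_squares (3 * N + 2) -> represented 3 4 1 8 1 8 N.
Proof.
intros (a & b & c & E).
assert (W : exists a b c, 3 * N + 2 = a * a + b * b + c * c /\ a mod 3 = 0 /\ b mod 3 <> 0 /\ c mod 3 <> 0).
{ pose proof (square_mod3 a) as A3. pose proof (square_mod3 b) as B3. pose proof (square_mod3 c) as C3.
  assert (D : (a mod 3 <> 0 /\ b mod 3 <> 0 /\ c mod 3 = 0) \/ (a mod 3 <> 0 /\ b mod 3 = 0 /\ c mod 3 <> 0)
    \/ (a mod 3 = 0 /\ b mod 3 <> 0 /\ c mod 3 <> 0)).
  { revert E A3 B3 C3. generalize (a * a) (b * b) (c * c). intros. residues. }
  destruct D as [D|[D|D]]; [exists c, a, b|exists b, a, c|exists a, b, c]; lia. }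
clear a b c E. destruct W as (a & b & c & E & A3 & B3 & C3).
destruct (multiple_of_three a A3) as (h & ->).
destruct (pgon8_of_coprime b B3) as (l & El). destruct (pgon8_of_coprime c C3) as (m & Em).
exists h, l, m. rewrite pgon4_square. lia.
Qed.

(* The octagonal numbers 0, 1, 5 suffice to leave the residues 7 mod 8 and 0 mod 4. *)
Lemma three_squares_minus_octagonal (k n : Z) : k = 2 \/ k = 3 \/ k = 5 \/ k = 6 ->
  n mod 3 = 2 -> 2 < n ->
  exists x, 2 < n - 3 * k * pgon 8 x /\ three_squares (n - 3 * k * pgon 8 x).
Proof.
intros Hk H3 H2.
assert (P0 : pgon 8 0 = 0) by reflexivity. assert (P1 : pgon 8 1 = 1) by reflexivity.
assert (P5 : pgon 8 (-1) = 5) by reflexivity.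
assert (S8 : three_squares 8) by (exists 2, 2, 0; reflexivity).
assert (S20 : three_squares 20) by (exists 4, 2, 0; reflexivity).
assert (S32 : three_squares 32) by (exists 4, 4, 0; reflexivity).
assert (Good : forall x p, pgon 8 x = p -> 2 < n - 3 * k * p ->
  (let r := n - 3 * k * p in r = 8 \/ r = 20 \/ r = 32 \/ r mod 4 = 1 \/ r mod 4 = 2 \/ r mod 8 = 3 \/
     r mod 16 = 8 \/ r mod 16 = 4) ->
  exists x, 2 < n - 3 * k * pgon 8 x /\ three_squares (n - 3 * k * pgon 8 x)).
{ intros x p Ep Hpos Hr. exists x. rewrite Ep. split; [exact Hpos|].
  revert Hpos Hr. cbv zeta. generalize (n - 3 * k * p). intros r Hpos Hr.
  destruct Hr as [-> | [-> | [-> | Hr]]]; auto.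
  destruct (Z.eq_dec (r mod 4) 0) as [H|H]; [|apply three_squares_mod; [lia|residues]].
  replace r with (2 * 2 * (r / 4)) by residues. apply three_squares_scale.
  apply three_squares_mod; residues. }
(* 8, 20 and 32 are too small for the subtraction that some [k] calls for, but are themselves sums
   of two squares. *)
destruct (Z.eq_dec n 8) as [->|N8]; [apply (Good 0 0 P0); cbv zeta; lia|].
destruct (Z.eq_dec n 20) as [->|N20]; [apply (Good 0 0 P0); cbv zeta; lia|].
destruct (Z.eq_dec n 32) as [->|N32]; [apply (Good 0 0 P0); cbv zeta; lia|].
(* For k = 5 the class 15 modulo 16 calls for the octagonal number 5, and 75 > 47; subtracting 15
   leaves 32. *)
destruct (Z.eq_dec n 47) as [->|N47].
{ destruct Hk as [-> | [-> | [-> | ->]]]; apply (Good 1 1 P1); cbv zeta; vm_compute; intuition discriminate. }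
destruct (Z.eq_dec (n mod 4) 1); [apply (Good 0 0 P0); cbv zeta; [lia|residues]|].
destruct (Z.eq_dec (n mod 4) 2); [apply (Good 0 0 P0); cbv zeta; [lia|residues]|].
destruct (Z.eq_dec (n mod 8) 3); [apply (Good 0 0 P0); cbv zeta; [lia|residues]|].
(* The subtrahends are 6; 9 or 45; 15 or 75; 18. For k = 5 the residue 7 modulo 16 goes to 8 and 15
   goes to 4. *)
destruct Hk as [-> | [-> | [-> | ->]]].
- apply (Good 1 1 P1); cbv zeta; residues.
- destruct (Z.eq_dec (n mod 8) 0); [apply (Good (-1) 5 P5)|apply (Good 1 1 P1)]; cbv zeta; residues.
- destruct (Z.eq_dec (n mod 16) 15); [apply (Good (-1) 5 P5)|apply (Good 1 1 P1)]; cbv zeta; residues.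
- apply (Good 1 1 P1); cbv zeta; residues.
Qed.

(** * Quaternary sums *)

Lemma universal_of_representations (a r b s c t d u : Z) :
  0 <= a -> 0 <= b -> 0 <= c -> 0 <= d -> 3 <= r -> 3 <= s -> 3 <= t -> 3 <= u ->
  (forall N, 0 <= N -> exists n, represented a r b s c t (N - d * pgon u n)) ->
  universal a r b s c t d u.
Proof.
intros Ha Hb Hc Hd Hr Hs Ht Hu H N. split.
- intros (h & l & m & n & <-).
  pose proof (Z.mul_nonneg_nonneg _ _ Ha (pgon_nonneg r h Hr)).
  pose proof (Z.mul_nonneg_nonneg _ _ Hb (pgon_nonneg s l Hs)).
  pose proof (Z.mul_nonneg_nonneg _ _ Hc (pgon_nonneg t m Ht)).
  pose proof (Z.mul_nonneg_nonneg _ _ Hd (pgon_nonneg u n Hu)). lia.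
- intros HN. destruct (H N HN) as (n & h & l & m & E). exists h, l, m, n. lia.
Qed.

Lemma universal_swap12 (a r b s c t d u : Z) :
  universal a r b s c t d u -> universal b s a r c t d u.
Proof.
intros H N. rewrite <- (H N). split; intros (h & l & m & n & E); exists l, h, m, n; lia.
Qed.

Lemma universal_of_ternary (a r b s c t d u : Z) :
  0 <= a -> 0 <= b -> 0 <= c -> 0 <= d -> 3 <= r -> 3 <= s -> 3 <= t -> 3 <= u ->
  (forall N, 0 <= N -> represented a r b s c t N) -> universal a r b s c t d u.
Proof.
intros. apply universal_of_representations; auto. intros N HN. exists 0.
rewrite pgon_0. replace (N - d * 0) with N by ring. auto.
Qed.

Lemma universal_swap23 (a r b s c t d u : Z) :
  universal a r b s c t d u -> universal a r c t b s d u.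
Proof.
intros H N. rewrite <- (H N). split; intros (h & l & m & n & E); exists h, m, l, n; lia.
Qed.

Lemma universal_swap34 (a r b s c t d u : Z) :
  universal a r b s c t d u -> universal a r b s d u c t.
Proof.
intros H N. rewrite <- (H N). split; intros (h & l & m & n & E); exists h, l, n, m; lia.
Qed.

Lemma universal_exchange (a r b s a' r' b' s' c t d u : Z) :
  0 <= a' -> 0 <= b' -> 0 <= c -> 0 <= d -> 3 <= r' -> 3 <= s' -> 3 <= t -> 3 <= u ->
  (forall h l, exists h' l', a * pgon r h + b * pgon s l = a' * pgon r' h' + b' * pgon s' l') ->
  universal a r b s c t d u -> universal a' r' b' s' c t d u.
Proof.
intros Ha Hb Hc Hd Hr Hs Ht Hu H U. apply universal_of_representations; auto. intros N HN.
destruct (proj2 (U N) HN) as (h & l & m & n & E). destruct (H h l) as (h' & l' & E').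
exists n, h', l', m. lia.
Qed.

Lemma universal_3p3_p5 (c t d u : Z) : 0 <= c -> 0 <= d -> 3 <= t -> 3 <= u ->
  universal 2 5 1 8 c t d u -> universal 3 3 1 5 c t d u.
Proof.
intros Hc Hd Ht Hu. apply universal_exchange; try lia. intros h l.
exists (h + l - 1), (l - h). pose proof (exchange_2p5_p8 h l). lia.
Qed.

Lemma universal_p3_p4 (c t d u : Z) : 0 <= c -> 0 <= d -> 3 <= t -> 3 <= u ->
  universal 1 5 2 5 c t d u -> universal 1 3 1 4 c t d u.
Proof.
intros Hc Hd Ht Hu. apply universal_exchange; try lia. intros h l.
exists (h + 2 * l - 1), (l - h). pose proof (exchange_p5_2p5 h l). lia.
Qed.

Lemma universal_2p3_2p4 (c t d u : Z) : 0 <= c -> 0 <= d -> 3 <= t -> 3 <= u ->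
  universal 2 5 4 5 c t d u -> universal 2 3 2 4 c t d u.
Proof.
intros Hc Hd Ht Hu. apply universal_exchange; try lia. intros h l.
exists (h + 2 * l - 1), (l - h). pose proof (exchange_p5_2p5 h l). lia.
Qed.

Lemma universal_p3_2p3 (c t d u : Z) : 0 <= c -> 0 <= d -> 3 <= t -> 3 <= u ->
  universal 1 5 1 8 c t d u -> universal 1 3 2 3 c t d u.
Proof.
intros Hc Hd Ht Hu. apply universal_exchange; try lia. intros h l.
exists (h - 2 * l), (h + l - 1). pose proof (exchange_p5_p8 h l). lia.
Qed.

Lemma universal_2p3_4p3 (c t d u : Z) : 0 <= c -> 0 <= d -> 3 <= t -> 3 <= u ->
  universal 2 5 2 8 c t d u -> universal 2 3 4 3 c t d u.
Proof.
intros Hc Hd Ht Hu. apply universal_exchange; try lia. intros h l.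
exists (h - 2 * l), (h + l - 1). pose proof (exchange_p5_p8 h l). lia.
Qed.

Lemma pgon5_1 : pgon 5 1 = 1. Proof. reflexivity. Qed.
Lemma pgon8_1 : pgon 8 1 = 1. Proof. reflexivity. Qed.

Lemma universal_4p5_p8_p8_p8 : universal 4 5 1 8 1 8 1 8.
Proof.
apply universal_of_representations; try lia. intros N HN.
destruct (Z.eq_dec (N mod 4) 3) as [H|H].
- exists 1. rewrite pgon8_1. apply represented_4p5_p8_p8; residues.
- exists 0. rewrite pgon_0. apply represented_4p5_p8_p8; residues.
Qed.

Lemma universal_4p5_p8_p8_3p8 : universal 4 5 1 8 1 8 3 8.
Proof.
apply universal_of_representations; try lia. intros N HN.
destruct (Z.eq_dec (N mod 4) 3) as [H|H].
- exists 1. rewrite pgon8_1. apply represented_4p5_p8_p8; residues.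
- exists 0. rewrite pgon_0. apply represented_4p5_p8_p8; residues.
Qed.

Lemma universal_6p3_2p5_2p5_p5 : universal 6 3 2 5 2 5 1 5.
Proof.
apply universal_of_representations; try lia. intros N HN.
destruct (Z.eq_dec (N mod 2) 0) as [H|H].
- exists 0. rewrite pgon_0. apply represented_6p3_2p5_2p5; residues.
- exists 1. rewrite pgon5_1. apply represented_6p3_2p5_2p5; residues.
Qed.

Lemma universal_p8_p8_2p8_p8 : universal 1 8 1 8 2 8 1 8.
Proof.
apply universal_of_representations; try lia. intros N HN.
destruct (Z.eq_dec N 0) as [->|H0].
{ exists 0. exists 0, 0, 0. reflexivity. }
destruct (Z.eq_dec (N mod 2) 0) as [H|H].
- exists 1. rewrite pgon8_1. apply represented_p8_p8_2p8; [lia|].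
  apply three_squares_mod; residues.
- exists 0. rewrite pgon_0. apply represented_p8_p8_2p8; [lia|].
  apply three_squares_mod; residues.
Qed.

Lemma universal_p8_p8_2p8_3p8 : universal 1 8 1 8 2 8 3 8.
Proof.
apply universal_of_representations; try lia. intros N HN.
destruct (Z.eq_dec (N mod 2) 0) as [H|H];
  [destruct (Z.eq_dec N 0) as [->|H0]; [|destruct (Z.eq_dec N 2) as [->|H2]]|].
- exists 0. exists 0, 0, 0. reflexivity.
- exists 0. exists 0, 0, 1. reflexivity.
- exists 1. rewrite pgon8_1. apply represented_p8_p8_2p8; [residues|].
  apply three_squares_mod; residues.
- exists 0. rewrite pgon_0. apply represented_p8_p8_2p8; [lia|].
  apply three_squares_mod; residues.
Qed.

(** The fourth term cannot change the parity of N. For even N the number to represent is instead 4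
    ((3 N + 4) / 2 + 1 - w^2), and w is chosen by [four_squares_prime_to_three]. *)
Lemma universal_p8_p8_2p8_2p8 : universal 1 8 1 8 2 8 2 8.
Proof.
apply universal_of_representations; try lia. intros N HN.
destruct (Z.eq_dec (N mod 2) 0) as [H|H].
- destruct (four_squares_prime_to_three ((3 * N + 4) / 2 + 1)) as (w & W3 & S); [residues|].
  destruct (pgon8_of_coprime w W3) as (n & En). exists n.
  assert (E : 6 * (N - 2 * pgon 8 n) + 8 = 2 * 2 * ((3 * N + 4) / 2 + 1 - w * w)) by residues.
  apply represented_p8_p8_2p8.
  + assert (0 <= (3 * N + 4) / 2 + 1 - w * w); [|lia]. destruct S as (x & y & z & ->).
    pose proof (Z.square_nonneg x). pose proof (Z.square_nonneg y). pose proof (Z.square_nonneg z). lia.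
  + rewrite E. now apply three_squares_scale.
- exists 0. rewrite pgon_0. apply represented_p8_p8_2p8; [lia|].
  apply three_squares_mod; residues.
Qed.

Lemma universal_3p4_p8_p8_p8 : universal 3 4 1 8 1 8 1 8.
Proof.
apply universal_of_representations; try lia. intros N HN.
destruct (four_squares_prime_to_three (3 * N + 3)) as (w & W3 & S); [lia|].
destruct (pgon8_of_coprime w W3) as (n & En). exists n. apply represented_3p4_p8_p8.
now replace (3 * (N - 1 * pgon 8 n) + 2) with (3 * N + 3 - w * w) by lia.
Qed.

(** The fourth term subtracts a multiple of 12 from 3 N + 2, which moves 7 to 3 modulo 8 but leaves
    multiples of 4; those are divided by 4 and treated by four squares. *)
Lemma universal_3p4_p8_p8_4p8 : universal 3 4 1 8 1 8 4 8.
Proof.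
apply universal_of_representations; try lia. intros N HN.
destruct (Z.eq_dec ((3 * N + 2) mod 4) 0) as [H|H].
- destruct (four_squares_prime_to_three ((3 * N + 2) / 4 + 1)) as (w & W3 & S); [residues|].
  destruct (pgon8_of_coprime w W3) as (n & En). exists n. apply represented_3p4_p8_p8.
  replace (3 * (N - 4 * pgon 8 n) + 2) with (2 * 2 * ((3 * N + 2) / 4 + 1 - w * w)) by residues.
  now apply three_squares_scale.
- destruct (Z.eq_dec ((3 * N + 2) mod 8) 7) as [H7|H7].
  + exists 1. rewrite pgon8_1. apply represented_3p4_p8_p8. apply three_squares_mod; residues.
  + exists 0. rewrite pgon_0. apply represented_3p4_p8_p8. apply three_squares_mod; residues.
Qed.

Lemma universal_3p4_p8_p8_kp8 (k : Z) : k = 2 \/ k = 3 \/ k = 5 \/ k = 6 -> universal 3 4 1 8 1 8 k 8.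
Proof.
intros Hk. apply universal_of_representations; try lia. intros N HN.
destruct (Z.eq_dec N 0) as [->|H0].
{ exists 0. rewrite pgon_0. exists 0, 0, 0. rewrite !pgon_0. ring. }
destruct (three_squares_minus_octagonal k (3 * N + 2) Hk) as (x & H2 & S); [residues|lia|].
exists x. apply represented_3p4_p8_p8.
now replace (3 * (N - k * pgon 8 x) + 2) with (3 * N + 2 - 3 * k * pgon 8 x) by ring.
Qed.

Lemma universal_p8_2p8_2p8_kp8 (k : Z) : k = 2 \/ k = 3 \/ k = 5 \/ k = 6 -> universal 1 8 2 8 2 8 k 8.
Proof.
intros Hk. apply universal_of_representations; try lia. intros N HN.
destruct (three_squares_minus_octagonal k (3 * N + 5) Hk) as (x & H2 & S); [residues|lia|].
exists x.
assert (E : 3 * (N - k * pgon 8 x) + 5 = 3 * N + 5 - 3 * k * pgon 8 x) by ring.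
apply represented_p8_2p8_2p8; [|now rewrite E].
revert H2 E. generalize (3 * k * pgon 8 x) (k * pgon 8 x). intros. lia.
Qed.

Lemma universal_2p5_p8_6p3_2p5 : universal 2 5 1 8 6 3 2 5.
Proof.
apply universal_of_ternary; try lia. intros N HN.
destruct (represented_6p3_2p5_p8 N HN) as (h & l & m & E). exists l, m, h. lia.
Qed.

Lemma universal_2p5_p5_p8 (b s : Z) : 0 <= b -> 3 <= s -> universal 2 5 1 5 1 8 b s.
Proof.
intros Hb Hs. apply universal_of_ternary; try lia. intros N HN.
destruct (represented_p5_2p5_p8 N HN) as (h & l & m & E). exists l, h, m. lia.
Qed.

(** The summand of the given position is set to 0; the other three keep their order. *)
Ltac drop4 L := apply universal_of_ternary; [lia..|exact L].
Ltac drop3 L := apply universal_swap34; drop4 L.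
Ltac drop2 L := apply universal_swap23; drop3 L.
Ltac drop1 L := apply universal_swap12; drop2 L.

Theorem theorem3p1 :
  universal 2 5 4 5 1 8 1 8 /\
  universal 4 5 1 8 1 8 1 8 /\
  universal 2 5 1 8 1 8 2 8 /\
  universal 1 8 1 8 1 8 2 8 /\
  universal 4 5 1 8 2 8 2 8 /\
  universal 1 8 2 8 2 8 2 8 /\
  universal 3 4 1 5 2 5 1 8 /\
  universal 6 3 1 5 2 5 2 5 /\
  universal 3 4 1 5 1 8 1 8 /\
  universal 6 3 1 5 2 5 1 8 /\
  universal 3 4 2 5 1 8 1 8 /\
  universal 3 4 1 8 1 8 1 8 /\
  universal 6 3 2 5 2 5 1 8 /\
  universal 6 3 2 5 1 8 1 8 /\
  universal 3 3 1 5 1 5 4 5 /\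
  universal 3 3 1 5 1 5 2 8 /\
  universal 3 3 3 4 1 5 1 8 /\
  universal 3 3 6 3 1 5 2 5 /\
  universal 3 4 1 8 1 8 2 8 /\
  universal 6 3 2 5 1 8 2 8 /\
  universal 3 3 1 5 4 5 1 8 /\
  universal 3 3 1 5 1 8 2 8 /\
  universal 1 3 1 4 3 4 1 8 /\
  universal 1 3 6 3 1 4 2 5 /\
  universal 1 3 2 3 3 4 1 8 /\
  universal 1 3 6 3 1 4 1 8 /\
  universal 2 5 4 5 1 8 2 8 /\
  universal 4 5 1 8 1 8 2 8 /\
  universal 2 5 1 8 2 8 2 8 /\
  universal 1 8 1 8 2 8 2 8 /\
  universal 1 5 2 5 4 5 1 8 /\
  universal 1 5 2 5 1 8 2 8 /\
  universal 1 5 4 5 1 8 1 8 /\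
  universal 1 5 1 8 1 8 2 8 /\
  universal 1 3 1 4 4 5 1 8 /\
  universal 1 3 1 4 1 8 2 8 /\
  universal 1 3 2 3 2 5 4 5 /\
  universal 1 3 2 3 2 5 2 8 /\
  universal 2 3 2 4 1 5 1 8 /\
  universal 2 3 4 3 1 5 1 8 /\
  universal 1 3 2 5 4 5 6 5 /\
  universal 1 3 2 5 6 5 2 8 /\
  universal 2 5 4 5 1 8 3 8 /\
  universal 4 5 1 8 1 8 3 8 /\
  universal 2 5 1 8 2 8 3 8 /\
  universal 1 8 1 8 2 8 3 8 /\
  universal 4 5 1 8 2 8 6 8 /\
  universal 1 8 2 8 2 8 6 8 /\
  universal 3 4 1 8 1 8 3 8 /\
  universal 6 3 2 5 1 8 3 8 /\
  universal 3 4 1 8 1 8 4 8 /\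
  universal 6 3 2 5 1 8 4 8 /\
  universal 3 3 1 5 4 5 2 8 /\
  universal 3 3 1 5 2 8 2 8 /\
  universal 3 4 1 8 1 8 5 8 /\
  universal 6 3 2 5 1 8 5 8 /\
  universal 3 4 1 8 1 8 6 8 /\
  universal 6 3 2 5 1 8 6 8 /\
  universal 3 3 1 5 4 5 3 8 /\
  universal 3 3 1 5 2 8 3 8 /\
  universal 4 5 1 8 2 8 3 8 /\
  universal 1 8 2 8 2 8 3 8 /\
  universal 4 5 1 8 2 8 5 8 /\
  universal 1 8 2 8 2 8 5 8 /\
  universal 2 3 2 4 1 8 3 8 /\
  universal 2 3 4 3 1 8 3 8.
Proof.
repeat apply conj.
- drop4 represented_2p5_4p5_p8.
- exact universal_4p5_p8_p8_p8.
- drop4 represented_2p5_p8_p8.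
- apply universal_swap34. exact universal_p8_p8_2p8_p8.
- drop4 represented_4p5_p8_2p8.
- apply universal_p8_2p8_2p8_kp8; lia.
- drop1 represented_p5_2p5_p8.
- apply universal_swap23. apply universal_swap34. exact universal_6p3_2p5_2p5_p5.
- drop1 represented_p5_p8_p8.
- drop1 represented_p5_2p5_p8.
- drop1 represented_2p5_p8_p8.
- exact universal_3p4_p8_p8_p8.
- drop3 represented_6p3_2p5_p8.
- drop4 represented_6p3_2p5_p8.
- drop4 represented_3p3_p5_p5.
- drop4 represented_3p3_p5_p5.
- apply universal_swap23. apply universal_3p3_p5; try lia. drop3 represented_2p5_p8_p8.
- apply universal_swap23. apply universal_3p3_p5; try lia. exact universal_2p5_p8_6p3_2p5.
- apply universal_3p4_p8_p8_kp8; lia.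
- drop4 represented_6p3_2p5_p8.
- apply universal_3p3_p5; try lia. drop3 represented_2p5_p8_p8.
- apply universal_3p3_p5; try lia. drop4 represented_2p5_p8_p8.
- apply universal_p3_p4; try lia. drop3 represented_p5_2p5_p8.
- apply universal_swap23. apply universal_p3_p4; try lia. apply universal_swap23.
  apply universal_swap12. apply universal_swap23. apply universal_swap34. exact universal_6p3_2p5_2p5_p5.
- apply universal_p3_2p3; try lia. drop3 represented_p5_p8_p8.
- apply universal_swap23. apply universal_p3_p4; try lia. drop3 represented_p5_2p5_p8.
- drop4 represented_2p5_4p5_p8.
- drop3 represented_4p5_p8_2p8.
- drop4 represented_2p5_p8_2p8.
- exact universal_p8_p8_2p8_2p8.
- drop3 represented_p5_2p5_p8.
- drop4 represented_p5_2p5_p8.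
- drop2 represented_p5_p8_p8.
- drop4 represented_p5_p8_p8.
- apply universal_p3_p4; try lia. drop3 represented_p5_2p5_p8.
- apply universal_p3_p4; try lia. drop4 represented_p5_2p5_p8.
- apply universal_p3_2p3; try lia. apply universal_swap23. drop4 represented_p5_2p5_p8.
- apply universal_p3_2p3; try lia. apply universal_swap23. drop4 represented_p5_2p5_p8.
- apply universal_2p3_2p4; try lia. apply universal_swap23. apply universal_swap34. apply universal_2p5_p5_p8; lia.
- apply universal_2p3_4p3; try lia. apply universal_swap23. apply universal_swap34. apply universal_2p5_p5_p8; lia.
- drop4 represented_p3_2p5_4p5.
- drop3 represented_p3_2p5_2p8.
- drop4 represented_2p5_4p5_p8.
- exact universal_4p5_p8_p8_3p8.
- drop4 represented_2p5_p8_2p8.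
- exact universal_p8_p8_2p8_3p8.
- drop4 represented_4p5_p8_2p8.
- apply universal_p8_2p8_2p8_kp8; lia.
- apply universal_3p4_p8_p8_kp8; lia.
- drop4 represented_6p3_2p5_p8.
- exact universal_3p4_p8_p8_4p8.
- drop4 represented_6p3_2p5_p8.
- apply universal_3p3_p5; try lia. apply universal_swap23. drop4 represented_2p5_4p5_p8.
- apply universal_3p3_p5; try lia. drop4 represented_2p5_p8_2p8.
- apply universal_3p4_p8_p8_kp8; lia.
- drop4 represented_6p3_2p5_p8.
- apply universal_3p4_p8_p8_kp8; lia.
- drop4 represented_6p3_2p5_p8.
- apply universal_3p3_p5; try lia. apply universal_swap23. drop4 represented_2p5_4p5_p8.
- apply universal_3p3_p5; try lia. drop4 represented_2p5_p8_2p8.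
- drop4 represented_4p5_p8_2p8.
- apply universal_p8_2p8_2p8_kp8; lia.
- drop4 represented_4p5_p8_2p8.
- apply universal_p8_2p8_2p8_kp8; lia.
- apply universal_2p3_2p4; try lia. drop4 represented_2p5_4p5_p8.
- apply universal_2p3_4p3; try lia. apply universal_swap23. drop4 represented_2p5_p8_2p8.
Qed.
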